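(* Let $\Omega \subset \mathbb{R}^d$ be an open set of finite volume $|\Omega|$, and let $T : \mathbb{R}^d \to \mathbb{R}$ be a symbol satisfying the standing assumptions (I) and (II) given in the context. Let $\mathcal{L}_T$ be the self-adjoint operator with symbol $T$ on $\Omega$. Then for all $\Lambda > 0$ $$\operatorname{Tr} \left( \mathcal{L}_T - \Lambda \right)_- \leq \frac{|\Omega|}{(2\pi)^d} \int_{\mathbb{R}^d} \left( T(p) - \Lambda \right)_- dp .$$
   Context: The Fourier transform is $\hat u(p) = (2\pi)^{-d/2} \int_{\mathbb{R}^d} e^{-ip\cdot x} u(x)\, dx$. $|\cdot|$ applied to a set denotes Lebesgue measure. The symbol $T$ is (implicitly) Lebesgue measurable. Definition of $\mathcal{L}_T$: consider the quadratic form $$Q_T[u] = \int_{\mathbb{R}^d} T(p) |\hat u(p)|^2 \, dp$$ restricted to the form domain $$\mathcal{H}_T(\Omega) = \left\{ u \in L^2(\mathbb{R}^d) : \int_{\mathbb{R}^d} (1 + T(p)) |\hat u(p)|^2 \, dp < \infty \text{ and } u \equiv 0 \text{ on } \mathbb{R}^d \setminus \Omega \right\}.$$ Then $\mathcal{L}_T$ is the self-adjoint operator associated with this form, i.e. satisfying $Q_T[u] = \langle u, \mathcal{L}_T u\rangle$, where $\langle\cdot,\cdot\rangle$ is the $L^2(\mathbb{R}^d)$ scalar product; it acts in the space of $L^2(\mathbb{R}^d)$ functions vanishing on $\mathbb{R}^d \setminus \Omega$, identified with $L^2(\Omega)$. Standing assumptions on $T$: (I) There is a function $T_0 : \mathbb{R}^d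 \to \mathbb{R}$ with the following three properties. First, $T_0$ is homogeneous of degree $\alpha > 0$: $T_0(\nu p) = \nu^{\alpha} T_0(p)$ for all $p \in \mathbb{R}^d$ and $\nu > 0$. Second, $V_T := | \{ p \in \mathbb{R}^d : T_0(p) < 1 \} | < \infty$. Third, for all $p \in \mathbb{R}^d$, $\lim_{\nu \to \infty} \nu^{-\alpha} T(\nu p) = T_0(p)$. Moreover, if this convergence is not uniform in $p \in \mathbb{R}^d$, it is also required that there is a function $\tilde T : \mathbb{R}^d \to \mathbb{R}$ which is locally integrable, is larger than $1$ at infinity (i.e. there is $R > 0$ such that $\tilde T(p) \geq 1$ for $|p| \geq R$), and is such that for some $\nu_0 > 0$ one has $\tilde T(p) \leq \nu^{-\alpha} T(\nu p)$ for all $p \in \mathbb{R}^d$ and all $\nu \geq \nu_0$. (II) There are constants $C_0 > 0$ and $N_0 \in \mathbb{N}$ such that for all $\eta \in \mathbb{R}^d$ $$\sup_{p \in \mathbb{R}^d} \left( \tfrac12 \left( T(p+\eta) + T(p-\eta) \right) - T(p) \right) \leq C_0 (1+|\eta|)^{N_0} .$$ Under these assumptions the spectrum of $\mathcal{L}_T$ is discrete and consists of eigenvalues $(\lambda_k)_{k\in\mathbb{N}}$ of finite multiplicity (repeated according to multiplicity). Here $x_\pm = (|x| \pm x)/2$ denotes the positive and negative part of $x \in \mathbb{R}$, with the same convention for self-adjoint operators, so that $\operatorname{Tr}(\mathcal{L}_T - \Lambda)_- = \sum_{k} (\Lambda - \lambda_k)_+$. *)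

(* Defs.v *)
From HB Require Import structures.
From mathcomp Require Import all_boot all_order all_algebra.
From mathcomp Require Import all_classical all_reals all_analysis.
From mathcomp.real_closed Require Import complex.
Import Order.TTheory GRing.Theory Num.Theory.
Import numFieldNormedType.Exports.

Set Implicit Arguments.
Unset Strict Implicit.
Unset Printing Implicit Defensive.

Local Open Scope classical_set_scope.
Local Open Scope ring_scope.

(* R^d is 'rV[R]_d, with the sigma-algebra generated by the coordinates (for
   R : realType this is the Borel sigma-algebra). *)
Definition measure_rV_display : measure_display -> measure_display.
Proof. exact. Qed.

Section measurable_rV.
Context {d} {X : sigmaRingType d} (n : nat).

Let coors : 'I_n -> 'rV[X]_n -> X := fun i v => v ord0 i.

Let rV_set0 : g_sigma_preimage coors set0.
Proof. exact: sigma_algebra0. Qed.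

Let rV_setC A : g_sigma_preimage coors A -> g_sigma_preimage coors (~` A).
Proof. exact: sigma_algebraC. Qed.

Let rV_bigcup (F : _^nat) : (forall i, g_sigma_preimage coors (F i)) ->
  g_sigma_preimage coors (\bigcup_i (F i)).
Proof. exact: sigma_algebra_bigcup. Qed.

HB.instance Definition _ := @isMeasurable.Build (measure_rV_display d)
  'rV[X]_n (g_sigma_preimage coors) rV_set0 rV_setC rV_bigcup.

End measurable_rV.

Lemma measurable_coord d (X : sigmaRingType d) n (i : 'I_n) :
  measurable_fun [set: 'rV[X]_n] (fun v : 'rV[X]_n => v ord0 i).
Proof.
move=> _ Y mY; rewrite setTI; apply: sub_sigma_algebra => /=.
rewrite -bigcup_seq/=; exists i => /=; first by rewrite mem_index_enum.
by exists Y => //; rewrite setTI.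
Qed.

Lemma measurable_fun_rV d d' (Y : measurableType d) (X : measurableType d') n
    (f : Y -> 'rV[X]_n) :
  (forall i, measurable_fun [set: Y] (fun y => f y ord0 i)) ->
  measurable_fun [set: Y] f.
Proof.
move=> mf; suff : g_sigma_preimage (fun i y => f y ord0 i) `<=` measurable.
  move=> sub _ A mA; rewrite setTI; apply: sub.
  rewrite (_ : (fun i y => f y ord0 i) =
               (fun i => (fun v : 'rV[X]_n => v ord0 i) \o f))//.
  by rewrite g_sigma_preimage_comp; exists A => //; rewrite setTI.
apply: smallest_sub; first exact: sigma_algebra_measurable.
case: n => [|n] in f mf *; first by rewrite big_ord0.
rewrite -bigcup_mkord_ord; apply: bigcup_sub => i Ii.
by move=> A [B mB <-]; exact: mf.
Qed.

Section lebesgue_rV.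
Context (R : realType).

Definition cons_rV n (xv : measurableTypeR R * 'rV[R]_n) : 'rV[R]_n.+1 :=
  row_mx (const_mx xv.1 : 'rV[R]_1) xv.2.

Lemma measurable_cons_rV n : measurable_fun setT (@cons_rV n).
Proof.
apply: measurable_fun_rV => i.
have [j ij|j ij] := split_ordP (i : 'I_(1 + n)).
  rewrite (_ : (fun xv => _) = fst); first exact: measurable_fst.
  by apply/funext => xv; rewrite ij [LHS]row_mxEl mxE.
rewrite (_ : (fun xv => _) = (fun v : 'rV[R]_n => v ord0 j) \o snd).
  by apply: measurableT_comp; [exact: measurable_coord|exact: measurable_snd].
by apply/funext => xv; rewrite ij [LHS]row_mxEr.
Qed.

Definition uncons_rV n (v : 'rV[R]_n.+1) : measurableTypeR R * 'rV[R]_n :=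
  (v ord0 ord0, rsubmx (v : 'rV[R]_(1 + n))).

Lemma cons_rVK n : cancel (@cons_rV n) (@uncons_rV n).
Proof.
move=> [x v]; rewrite /uncons_rV /cons_rV row_mxKr; congr pair.
rewrite (_ : (ord0 : 'I_n.+1) = lshift n (ord0 : 'I_1)); last exact/val_inj.
by rewrite [LHS]row_mxEl mxE.
Qed.

Lemma measurable_uncons_rV n : measurable_fun setT (@uncons_rV n).
Proof.
apply/measurable_fun_pairP; split; first exact: measurable_coord.
apply: measurable_fun_rV => i.
rewrite (_ : (fun v => _) = fun v : 'rV[R]_n.+1 => v ord0 (rshift 1 i)).
  exact: measurable_coord.
by apply/funext => v; rewrite /= mxE.
Qed.

(* The product of the one-dimensional Lebesgue measure and mu. *)
Section step.
Context n (mu : {sigma_finite_measure set 'rV[R]_n -> \bar R}).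

Definition lebesgue_step : set 'rV[R]_n.+1 -> \bar R :=
  pushforward (lebesgue_measure \x mu)%E (@cons_rV n).

Let mcons := @measurable_cons_rV n.

Let step0 : lebesgue_step set0 = 0%E.
Proof. by rewrite /lebesgue_step /pushforward preimage_set0 measure0. Qed.

Let step_ge0 A : (0 <= lebesgue_step A)%E.
Proof. exact: measure_ge0. Qed.

Let step_sigma_additive : semi_sigma_additive lebesgue_step.
Proof.
exact: (@measure_semi_sigma_additive _ _ _
  (pushforward (lebesgue_measure \x mu)%E (@cons_rV n))).
Qed.

HB.instance Definition _ := isMeasure.Build _ _ _ lebesgue_step
  step0 step_ge0 step_sigma_additive.

Let step_sigma_finite : sigma_finite setT lebesgue_step.
Proof.
have /sigma_finiteP[F [FT ndF Foo]] := sigma_finiteT (@lebesgue_measure R).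
have /sigma_finiteP[G [GT ndG Goo]] := sigma_finiteT mu.
exists (fun k => @uncons_rV n @^-1` (F k `*` G k)).
  rewrite -preimage_bigcup -(preimage_setT (@uncons_rV n)); congr (_ @^-1` _).
  rewrite -setXTT FT GT predeqE => -[x y]; split.
    move=> [/= [i _ Fix] [k _ Gky]]; exists (maxn i k) => //; split.
    - by move: x Fix; exact/subsetPset/ndF/leq_maxl.
    - by move: y Gky; exact/subsetPset/ndG/leq_maxr.
  by move=> [i _ []/= ? ?]; split; exists i.
move=> k; have [? ?] := Foo k; have [? ?] := Goo k; split.
  rewrite -[X in measurable X]setTI; apply: measurable_uncons_rV => //.
  exact: measurableX.
rewrite /lebesgue_step /pushforward -comp_preimage.
rewrite (_ : _ \o _ = id); last by apply/funext => x; exact: cons_rVK.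
by rewrite preimage_id product_measure1E// lte_mul_pinfty// ge0_fin_numE.
Qed.

HB.instance Definition _ := Measure_isSigmaFinite.Build _ _ _ lebesgue_step
  step_sigma_finite.

End step.

(* The d-fold product of the one-dimensional Lebesgue measure. *)
Fixpoint borel_lebesgue d : {sigma_finite_measure set 'rV[R]_d -> \bar R} :=
  match d return {sigma_finite_measure set 'rV[R]_d -> \bar R} with
  | 0%N => \d_(0 : 'rV[R]_0)
  | n.+1 => lebesgue_step (borel_lebesgue n)
  end.

(* R^d with the sigma-algebra of all Lebesgue measurable sets. *)
Definition lebesgue_space d := caratheodory_type (borel_lebesgue d)^*%mu.

HB.instance Definition _ d := Measurable.on (lebesgue_space d).

Definition lebesgue_rV d : set (lebesgue_space d) -> \bar R :=
  @completed_measure_extension _ _ _ (borel_lebesgue d).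

HB.instance Definition _ d := Measure.on (@lebesgue_rV d).

End lebesgue_rV.

Section fourier.
Context (R : realType) (d : nat).
Implicit Types (p x : 'rV[R]_d) (u v f : 'rV[R]_d -> R[i]).

Local Notation mu := (@lebesgue_rV R d).

Definition dot p x : R := \sum_(i < d) p ord0 i * x ord0 i.

(* The norm of 'rV[R]_d in the library is the sup norm. *)
Definition enorm p : R := Num.sqrt (dot p p).

Definition sqnormc (z : R[i]) : R := complex.Re z ^+ 2 + complex.Im z ^+ 2.

Definition cmeasurable u :=
  measurable_fun [set: lebesgue_space R d] (fun x => complex.Re (u x)) /\
  measurable_fun [set: lebesgue_space R d] (fun x => complex.Im (u x)).

Definition cintegral u : R[i] :=
  ((\int[mu]_x complex.Re (u x)) +i* (\int[mu]_x complex.Im (u x)))%C.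

Definition expi (t : R) : R[i] := (cos t +i* sin t)%C.

(* The integral converges for integrable u.  It is only applied below to
   square-integrable functions vanishing outside a set of finite measure. *)
Definition fourier u p : R[i] :=
  ((2 * pi) `^ (- (d%:R / 2)))%:C%C * cintegral (fun x => expi (- dot p x) * u x).

Definition square_integrable u :=
  cmeasurable u /\ (\int[mu]_x (sqnormc (u x))%:E < +oo)%E.

Definition inner u v : R[i] := cintegral (fun x => (u x)^*%C * v x).

End fourier.

Section symbol.
Context (R : realType) (d : nat).
Implicit Types T : 'rV[R]_d -> R.

Local Notation mu := (@lebesgue_rV R d).

Definition locally_integrable_rV (f : 'rV[R]_d -> R) :=
  forall K : set 'rV[R]_d, compact K -> mu.-integrable K (EFin \o f).

Definition assumption_I T :=
  exists (T0 : 'rV[R]_d -> R) (alpha : R),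
  [/\ 0 < alpha,
      forall (p : 'rV[R]_d) (nu : R), 0 < nu -> T0 (nu *: p) = nu `^ alpha * T0 p,
      (mu [set p | (T0 p < 1)%R] < +oo)%E,
      forall p : 'rV[R]_d, nu `^ (- alpha) * T (nu *: p) @[nu --> +oo] --> T0 p &
      ~ {uniform, (fun (nu : R) (p : 'rV[R]_d) => nu `^ (- alpha) * T (nu *: p)) @ +oo
                   --> T0} ->
      exists Tt : 'rV[R]_d -> R,
      [/\ locally_integrable_rV Tt,
          exists2 r : R, 0 < r & forall p, r <= enorm p -> 1 <= Tt p &
          exists2 nu0 : R, 0 < nu0 &
            forall (p : 'rV[R]_d) (nu : R), nu0 <= nu ->
              Tt p <= nu `^ (- alpha) * T (nu *: p)]].

Definition assumption_II T :=
  exists (C0 : R) (N0 : nat), 0 < C0 /\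
  forall eta : 'rV[R]_d,
    (ereal_sup [set ((T (p + eta) + T (p - eta)) / 2 - T p)%:E
                 | p in [set: 'rV[R]_d]] <=
     (C0 * (1 + enorm eta) ^+ N0)%:E)%E.

Definition neg_part (x : R) : R := (`|x| - x) / 2.

End symbol.

Section operator.
Context (R : realType) (d : nat).
Variables (T : 'rV[R]_d -> R) (Omega : set 'rV[R]_d).
Implicit Types (u v f : 'rV[R]_d -> R[i]) (lam Lam : R).

Local Notation mu := (@lebesgue_rV R d).

(* The elements of L^2 are represented by functions, equality in L^2 being
   equality almost everywhere. *)
Definition L2_on u :=
  square_integrable u /\ {ae mu, forall x, ~ Omega x -> u x = 0}.

(* Under the assumptions I and II, T is bounded from below almost everywhere,
   so integrability amounts to the finiteness of the integral. *)
Definition form_domain u :=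
  L2_on u /\
  mu.-integrable setT (fun p => ((1 + T p) * sqnormc (fourier u p))%:E).

(* The sesquilinear form with quadratic form Q_T[u] = qform u u. *)
Definition qform v u : R[i] :=
  cintegral (fun p => (T p)%:C%C * ((fourier v p)^*%C * fourier u p)).

(* Graph of the self-adjoint operator associated with the form: u is in the
   operator domain and L_T u = f.  Taking v = u gives Q_T[u] = <u, L_T u>. *)
Definition op_graph u f :=
  [/\ form_domain u, L2_on f & forall v, form_domain v -> qform v u = inner v f].

Definition eigenfunction lam u := op_graph u (fun x => lam%:C%C * u x).

Definition lin_indep n (e : 'I_n -> 'rV[R]_d -> R[i]) :=
  forall c : 'I_n -> R[i],
    {ae mu, forall x, \sum_(i < n) c i * e i x = 0} -> forall i, c i = 0.

(* Dimension of the eigenspace, hence 0 when lam is not an eigenvalue. *)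
Definition multiplicity lam : \bar R :=
  ereal_sup [set n%:R%:E | n in [set n : nat |
    exists e : 'I_n -> 'rV[R]_d -> R[i],
      (forall i, eigenfunction lam (e i)) /\ lin_indep e]].

(* Tr (L_T - Lam)_-, as the sum of (lam - Lam)_- over the eigenvalues lam
   counted with multiplicity. *)
Definition trace_neg_part Lam : \bar R :=
  (\esum_(lam in [set: R]) (multiplicity lam * (neg_part (lam - Lam))%:E))%E.

End operator.

(* Main.v *)
Require Import Defs.
From mathcomp Require Import all_boot all_order all_algebra.
From mathcomp Require Import all_classical all_reals all_analysis.
From mathcomp Require Import measurable_realfun ring lra.
From mathcomp.real_closed Require Import complex.
Import Order.TTheory GRing.Theory Num.Theory.
Import numFieldNormedType.Exports.

Set Implicit Arguments.
Unset Strict Implicit.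
Unset Printing Implicit Defensive.
Local Open Scope classical_set_scope.
Local Open Scope ring_scope.

(** This is the argument of Berezin and of Li and Yau.  Let f_1, ..., f_n be
orthonormal eigenfunctions, with eigenvalues l_1, ..., l_n and Fourier
transforms F_1, ..., F_n.  By the Plancherel identity |F_j|^2 is a probability
density, and l_j = Q_T[f_j] is the mean of T under it.  Hence
  (l_j - L)_- <= \int (T(p) - L)_- |F_j(p)|^2 dp,
trivially if l_j >= L and because L - T <= (T - L)_- otherwise
([eigenvector_neg_part]).  Up to the factor (2 pi)^(-d/2) and a conjugation,
F_j(p) is the scalar product of f_j with the plane wave e^(i p.x) cut off to
Omega, whose squared norm is |Omega|.  So the Bessel inequality gives
  \sum_j |F_j(p)|^2 <= (2 pi)^(-d) |Omega|   for every p
([fourier_bessel]), and summing the first inequality over j bounds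
\sum_j (l_j - L)_- by the right-hand side of the theorem
([orthonormal_neg_part_sum]).

The trace is a supremum over finite sets of eigenvalues, each weighted with the
dimension of its eigenspace.  Eigenfunctions for distinct eigenvalues are
orthogonal, because the form is Hermitian, and each eigenspace contains
orthonormal families of every size up to its dimension.  Together they form one
orthonormal family, to which the bound applies; the bound itself shows that the
dimensions that matter are finite ([eigen_multiplicity_attained],
[eigen_trace_le]).

The analytic input is the Plancherel identity for functions in L^1 and L^2
([plancherel]).  On the line and for real f, weight the frequencies p >= 0 with
exp (- e p).  Since \int_0^oo exp (- e p) cos (p t) dp = e / (e^2 + t^2), the Poisson
kernel k_e, the weighted integral of |\int f(x) e^(-i p x) dx|^2 equals
\iint f(x) f(y) k_e(x - y) dx dy, and 2 f(x) f(y) = f(x)^2 + f(y)^2 -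
(f(x) - f(y))^2 turns it into
  pi \int f^2 - 1/2 \iint (f(x) - f(y))^2 k_e(x - y) dx dy.
The last integral, called the energy below, tends to 0 with e
([energy_cvg0]): it is at most 4 pi \int f^2, and for continuous f with compact
support the claim follows from the concentration of k_e at 0.  Monotone
convergence on the frequency side concludes ([plancherel_halfline]).  The
identity in R^n is obtained by induction on n, with Fubini, from the partial
transform in all variables but the first.

Transforms are first treated for Borel functions; a Lebesgue measurable function
has a Borel version ([completion_measurable_fun]), with the same integrals. *)

(** * Iterated integrals and translations *)

Section iterated.
Context d1 d2 (T1 : measurableType d1) (T2 : measurableType d2) (R : realType).
Variables (m1 : {sigma_finite_measure set T1 -> \bar R}).
Variables (m2 : {sigma_finite_measure set T2 -> \bar R}).

(** By Tonelli, for the positive and the negative part of F. *)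
Lemma measurable_fun_Rintegral2 (F : T1 -> T2 -> R) :
  measurable_fun [set: T1 * T2] (fun z => F z.1 z.2) ->
  measurable_fun [set: T1] (fun x => \int[m2]_y F x y).
Proof.
move=> mF; pose g (z : T1 * T2) : \bar R := (F z.1 z.2)%:E.
have mg : measurable_fun [set: T1 * T2] g by exact/measurable_EFinP.
apply: (measurableT_comp (fine_measurable measurableT)).
rewrite (_ : (fun x => _) = (fun x => \int[m2]_y (g^\+ (x, y))
   - \int[m2]_y (g^\- (x, y)))%E); last first.
  by apply/funext => x; rewrite [LHS]integralE; congr (_ - _)%E; apply: eq_integral => y _; rewrite ?funeposE ?funenegE.
apply: emeasurable_funB; apply: measurable_fun_fubini_tonelli_F => //.
  exact: measurable_funepos.
exact: measurable_funeneg.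
Qed.

Lemma integrable_prod (g : T1 -> R) (h : T2 -> R) :
  m1.-integrable setT (EFin \o g) -> m2.-integrable setT (EFin \o h) ->
  (m1 \x m2)%E.-integrable setT (fun z => (g z.1 * h z.2)%:E).
Proof.
move=> ig ih.
have mg : measurable_fun [set: T1] g by exact/measurable_EFinP/(measurable_int _ ig).
have mh : measurable_fun setT h by exact/measurable_EFinP/(measurable_int _ ih).
have mgh : measurable_fun [set: T1 * T2] (fun z : T1 * T2 => (g z.1 * h z.2)%:E).
  by apply/measurable_EFinP/measurable_funM; exact: measurableT_comp.
apply/integrable12ltyP => //=.
under eq_integral => x _.
  under eq_integral do rewrite normrM EFinM.
  rewrite ge0_integralZl//; last exact/measurable_EFinP/measurableT_comp.
  over.
rewrite ge0_integralZr//; last 2 first.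
- exact/measurable_EFinP/measurableT_comp.
- exact: integral_ge0.
move: ig => /integrableP[_ /= ig]; move: ih => /integrableP[_ /= ih].
by rewrite lte_mul_pinfty ?integral_ge0// ge0_fin_numE ?integral_ge0.
Qed.

(** The real inner integral differs from the extended one only where the latter is
infinite, which happens on a null set. *)
Lemma Rintegral12_prod (F : T1 -> T2 -> R) :
  (m1 \x m2)%E.-integrable setT (fun z => (F z.1 z.2)%:E) ->
  \int[m1]_x \int[m2]_y F x y = \int[(m1 \x m2)%E]_z F z.1 z.2.
Proof.
move=> iF.
have mF : measurable_fun [set: T1 * T2] (fun z => F z.1 z.2).
  by apply/measurable_EFinP; exact: measurable_int iF.
rewrite /Rintegral; congr fine; rewrite -(integral12_prod_meas1 iF).
apply: ae_eq_integral => //.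
- by apply/measurable_EFinP; exact: measurable_fun_Rintegral2.
- exact: (measurable_fubini_F iF).
- have := ae_integrable1 iF; apply: filterS => x ix _.
  by rewrite fineK//; exact: (integrable_fin_num measurableT ix).
Qed.

Lemma Rintegral_Fubini (F : T1 -> T2 -> R) :
  (m1 \x m2)%E.-integrable setT (fun z => (F z.1 z.2)%:E) ->
  \int[m1]_x \int[m2]_y F x y = \int[m2]_y \int[m1]_x F x y.
Proof.
move=> iF; rewrite Rintegral12_prod//.
rewrite /Rintegral; congr fine; rewrite -(integral21_prod_meas1 iF).
apply/esym; apply: ae_eq_integral => //.
- apply/measurable_EFinP.
  apply: (measurableT_comp (fine_measurable measurableT)).
  exact: (measurable_fubini_G iF).
- exact: (measurable_fubini_G iF).
- have := ae_integrable2 iF; apply: filterS => x ix _.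
  by rewrite fineK//; exact: (integrable_fin_num measurableT ix).
Qed.

End iterated.

Section invariance.
Context (R : realType).
Local Notation mu := (@lebesgue_measure R).
Implicit Types (f : R -> \bar R).
Local Open Scope ereal_scope.

(** Lebesgue measure is determined by its values on half-open intervals. *)
Lemma lebesgue_measure_shift (c : R) (A : set R) : measurable A ->
  pushforward mu ((fun x => x + c)%R : _ -> measurableTypeR R) A = mu A.
Proof.
move=> mA; apply/esym/lebesgue_measure_unique => //=; first exact: measurable_funD.
move=> _ _ [[a b]] _ <-.
rewrite /pushforward/=.
rewrite (_ : _ @^-1` _ = `]a - c, b - c]%classic)%R; last first.
  by apply/seteqP; split=> x /=; rewrite !in_itv/= ltrBlDr lerBrDr.
by rewrite /= !lebesgue_measure_itv/= !lte_fin ltrD2r -!EFinB opprD addrACA opprK addNr addr0.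
Qed.

Lemma ge0_integral_shift (c : R) f : measurable_fun [set: R] f ->
  (forall x, 0 <= f x) -> \int[mu]_x f (x + c)%R = \int[mu]_x f x.
Proof.
move=> mf f0; have mc : measurable_fun [set: measurableTypeR R]
    ((fun x => x + c)%R : _ -> measurableTypeR R) by exact: measurable_funD.
rewrite [RHS](eq_measure_integral (pushforward mu
  ((fun x => x + c)%R : _ -> measurableTypeR R)))//.
  by rewrite ge0_integral_pushforward.
by move=> A mA _; exact/esym/lebesgue_measure_shift.
Qed.

End invariance.

(** * Integrals against sines and cosines *)

Section cossin.
Context d (T : measurableType d) (R : realType) (m : {measure set T -> \bar R}).

Lemma measurable_cos_comp (g : T -> R) : measurable_fun setT g ->
  measurable_fun setT (fun x => cos (g x)).
Proof. exact: measurableT_comp (continuous_measurable_fun (@continuous_cos R)). Qed.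

Lemma measurable_sin_comp (g : T -> R) : measurable_fun setT g ->
  measurable_fun setT (fun x => sin (g x)).
Proof. exact: measurableT_comp (continuous_measurable_fun (@continuous_sin R)). Qed.

Lemma normr_cos_le1 (t : R) : `|cos t| <= 1.
Proof. by rewrite ler_norml cos_geN1 cos_le1. Qed.

Lemma normr_sin_le1 (t : R) : `|sin t| <= 1.
Proof. by rewrite ler_norml sin_geN1 sin_le1. Qed.

Lemma integrableM_bounded (f b : T -> R) (M : R) :
  m.-integrable setT (EFin \o f) -> measurable_fun setT b ->
  (forall x, `|b x| <= M) -> m.-integrable setT (fun x => (f x * b x)%:E).
Proof.
move=> fi mb bM.
have mf : measurable_fun setT f by exact/measurable_EFinP/(measurable_int _ fi).
have := integrableZl measurableT M fi; apply: le_integrable => //.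
  by apply/measurable_EFinP; exact: measurable_funM.
move=> x _ /=; rewrite lee_fin !normrM mulrC ler_wpM2r//.
exact: (le_trans (bM x) (ler_norm M)).
Qed.

Lemma integrableM_cos (f g : T -> R) : m.-integrable setT (EFin \o f) ->
  measurable_fun setT g -> m.-integrable setT (fun x => (f x * cos (g x))%:E).
Proof.
move=> fi mg; apply: (integrableM_bounded fi (measurable_cos_comp mg)) => x.
exact: normr_cos_le1.
Qed.

Lemma integrableM_sin (f g : T -> R) : m.-integrable setT (EFin \o f) ->
  measurable_fun setT g -> m.-integrable setT (fun x => (f x * sin (g x))%:E).
Proof.
move=> fi mg; apply: (integrableM_bounded fi (measurable_sin_comp mg)) => x.
exact: normr_sin_le1.
Qed.

Lemma normr_RintegralM_le (f b : T -> R) : m.-integrable setT (EFin \o f) ->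
  measurable_fun setT b -> (forall x, `|b x| <= 1) ->
  `|\int[m]_x (f x * b x)| <= \int[m]_x `|f x|.
Proof.
move=> fi mb b1; have fb := integrableM_bounded fi mb b1.
rewrite (le_trans (le_normr_Rintegral measurableT fb))//.
apply: le_Rintegral => //.
- exact: integrable_norm fb.
- exact: integrable_norm fi.
by move=> x _; rewrite normrM ler_piMr.
Qed.

Lemma Rintegral_lin2 (g h : T -> R) (a b : R) :
  m.-integrable setT (EFin \o g) -> m.-integrable setT (EFin \o h) ->
  \int[m]_x (a * g x + b * h x) = a * \int[m]_x g x + b * \int[m]_x h x.
Proof.
move=> ig ih; rewrite RintegralD//.
- by rewrite !RintegralZl.
- by have := integrableZl measurableT a ig; apply: eq_integrable.
- by have := integrableZl measurableT b ih; apply: eq_integrable.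
Qed.

End cossin.

(** * The Poisson kernel *)

Section kernel.
Context (R : realType).
Local Notation mu := (@lebesgue_measure R).
Implicit Types e t p x : R.

Lemma ge0_FTC0y (f F : R -> R) (l : R) : (forall x, 0 <= f x) ->
  continuous f -> F x @[x --> +oo%R] --> l ->
  (forall x : R, is_derive x 1 F (f x)) ->
  (\int[mu]_(x in `[0%R, +oo[) (f x)%:E = (l - F 0)%:E)%E.
Proof.
move=> f0 cf Fl dF; rewrite (@ge0_continuous_FTC2y _ f F 0 l)//.
- exact: continuous_subspaceT.
- apply: cvg_at_right_filter; apply: differentiable_continuous.
  exact/derivable1_diffP/ex_derive.
- by move=> x _; rewrite derive1E; exact: derive_val.
Qed.

Definition poisson_kernel (e t : R) : R := e / (e ^+ 2 + t ^+ 2).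

Lemma poisson_kernel_ge0 e t : 0 <= e -> 0 <= poisson_kernel e t.
Proof. by move=> e0; rewrite /poisson_kernel divr_ge0// addr_ge0// sqr_ge0. Qed.

Lemma poisson_kernel_den_gt0 (e t : R) : 0 < e -> 0 < e ^+ 2 + t ^+ 2.
Proof. by move=> e0; rewrite ltr_pwDl ?sqr_ge0// exprn_gt0. Qed.

Lemma continuous_poisson_kernel e : 0 < e -> continuous (poisson_kernel e).
Proof.
move=> e0 x; apply: cvgM; first exact: cvg_cst.
apply: cvgV; first by rewrite gt_eqF// poisson_kernel_den_gt0.
by apply: cvgD; [exact: cvg_cst|exact: exprn_continuous].
Qed.

Lemma integral_poisson_kernel e : 0 < e -> (\int[mu]_t (poisson_kernel e t)%:E = pi%:E)%E.
Proof.
move=> e0; rewrite ge0_symfun_integralT; last 3 first.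
- by move=> x; exact/poisson_kernel_ge0/ltW.
- exact: continuous_poisson_kernel.
- by move=> x; rewrite /poisson_kernel /= sqrrN.
have dF (x : R) : is_derive x 1 (fun t => atan (e^-1 * t)) (poisson_kernel e x).
  apply: is_derive_eq.
  rewrite /poisson_kernel/= /GRing.scale/= mulr1.
  have := poisson_kernel_den_gt0 x e0 => d0.
  field; rewrite ?gt_eqF//.
rewrite -set_itvcy (@ge0_FTC0y _ _ (pi / 2) _ _ _ dF).
- by rewrite mulr0 atan0 subr0 -EFinM mulrC divfK.
- by move=> x; exact/poisson_kernel_ge0/ltW.
- exact: continuous_poisson_kernel.
- apply: (@cvg_comp _ _ _ _ _ _ (pinfty_nbhs R)); last exact: cvgy_atan.
  by apply: gt0_cvgMry => //; rewrite invr_gt0.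
Qed.

(** Weighting only the half-line p >= 0 gives the whole Poisson kernel as cosine
transform, and loses nothing since the transforms of real functions are
symmetric in p. *)
Definition exp_weight (e p : R) : R := expR (- (e * p)) * \1_(`[0, +oo[) p.

Lemma exp_weight_ge0 e p : 0 <= exp_weight e p.
Proof. by rewrite mulr_ge0// expR_ge0. Qed.

Lemma measurable_exp_weight e : measurable_fun [set: R] (exp_weight e).
Proof.
apply: measurable_funM; last exact: measurable_indic.
by apply: measurableT_comp => //; apply: measurable_funN; exact: measurable_funM.
Qed.

Lemma cvg_expR_neg e : 0 < e -> expR (- (e * x)) @[x --> +oo%R] --> (0 : R).
Proof.
move=> e0; apply: (@cvg_comp _ _ _ (fun x => e * x) (fun z => expR (- z)) _
  (pinfty_nbhs R)); last exact: cvgr_expR.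
exact: gt0_cvgMry.
Qed.

Lemma integral_exp_weight_mkcond e (g : R -> R) :
  (\int[mu]_p (exp_weight e p * g p)%:E =
   \int[mu]_(p in `[0%R, +oo[) (expR (- (e * p)) * g p)%:E)%E.
Proof.
rewrite [RHS]integral_mkcond; apply: eq_integral => p _.
rewrite patchE /exp_weight indicE; case: ifP => _; last by rewrite mulr0 mul0r.
by rewrite mulr1.
Qed.

Lemma integral_exp_weight e : 0 < e ->
  (\int[mu]_p (exp_weight e p)%:E = (e^-1)%:E)%E.
Proof.
move=> e0; under eq_integral do rewrite -[exp_weight _ _]mulr1.
rewrite integral_exp_weight_mkcond.
have dF (x : R) : is_derive x 1 (fun x => - (expR (- (e * x)) / e))
    (expR (- (e * x)) * 1).
  apply: is_derive_eq.
  rewrite /GRing.scale/=; field; exact: lt0r_neq0.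
rewrite (@ge0_FTC0y _ _ 0 _ _ _ dF).
- by rewrite mulr0 oppr0 expR0 sub0r opprK mul1r.
- by move=> x; rewrite mulr1 expR_ge0.
- move=> x; apply: cvgM; last exact: cvg_cst.
  apply: continuous_comp; last exact: continuous_expR.
  by apply: cvgN; apply: cvgM; [exact: cvg_cst|exact: cvg_id].
- rewrite -oppr0 -(mul0r e^-1); apply: cvgN; apply: cvgMl; exact: cvg_expR_neg.
Qed.

Lemma integrable_exp_weight e : 0 < e -> mu.-integrable setT (EFin \o exp_weight e).
Proof.
move=> e0; apply/integrableP; split.
  by apply/measurable_EFinP; exact: measurable_exp_weight.
under eq_integral do rewrite /= ger0_norm ?exp_weight_ge0//.
by rewrite integral_exp_weight// ltry.
Qed.

Lemma integrable_exp_weight_cos e t : 0 < e ->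
  mu.-integrable setT (fun p => (exp_weight e p * cos (p * t))%:E).
Proof.
move=> e0; apply: integrableM_cos; first exact: integrable_exp_weight.
exact: measurable_funM.
Qed.

(** The real part of \int_0^oo exp (- (e - i t) p) dp = 1 / (e - i t). *)
Lemma integral_exp_weight_cos e t : 0 < e ->
  (\int[mu]_p (exp_weight e p * cos (p * t)) = poisson_kernel e t)%R.
Proof.
move=> e0; have ie := integrable_exp_weight_cos t e0.
(* Adding 1 to the cosine makes the integrand nonnegative, as ge0_FTC0y
   requires. *)
suff : (\int[mu]_p (exp_weight e p * (1 + cos (p * t)))%:E =
    (e^-1 + poisson_kernel e t)%:E)%E.
  under eq_integral do rewrite mulrDr mulr1 EFinD.
  rewrite integralD//; last exact: integrable_exp_weight.
  rewrite integral_exp_weight// -(fineK (integrable_fin_num _ ie))// -EFinD.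
  by move=> [/addrI].
rewrite integral_exp_weight_mkcond.
have d0 := poisson_kernel_den_gt0 t e0.
have dF (x : R) : is_derive x 1 (fun x => expR (- (e * x)) *
    ((t * sin (x * t) - e * cos (x * t)) / (e ^+ 2 + t ^+ 2) - e^-1))
    (expR (- (e * x)) * (1 + cos (x * t))).
  apply: is_derive_eq.
  by rewrite /GRing.scale/=; field; rewrite ?gt_eqF.
rewrite (@ge0_FTC0y _ _ 0 _ _ _ dF).
- rewrite !mulr0 mul0r oppr0 expR0 sin0 cos0 /poisson_kernel; congr _%:E.
  by field; rewrite ?gt_eqF.
- by move=> x; rewrite mulr_ge0 ?expR_ge0//; have := cos_geN1 (x * t); lra.
- move=> x; apply: cvgM.
    apply: continuous_comp; last exact: continuous_expR.
    by apply: cvgN; apply: cvgM; [exact: cvg_cst|exact: cvg_id].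
  apply: cvgD; first exact: cvg_cst.
  apply: continuous_comp; last exact: continuous_cos.
  by apply: cvgM; [exact: cvg_id|exact: cvg_cst].
- set c := e ^+ 2 + t ^+ 2 in d0 *.
  set M : R := (`|t| + `|e|) / c + e^-1.
  have cM : M * expR (- (e * x)) @[x --> +oo] --> (0 : R).
    by rewrite -(mulr0 M); apply: cvgMr; exact: cvg_expR_neg.
  apply: norm_cvg0; apply: (squeeze_cvgr _ (cvg_cst 0) cM).
  apply: nearW => x; rewrite normr_ge0/= normrM ger0_norm ?expR_ge0// mulrC.
  rewrite ler_wpM2r ?expR_ge0// /M (le_trans (ler_normB _ _))// lerD//; last first.
    by rewrite gtr0_norm// invr_gt0.
  rewrite normrM normfV (gtr0_norm d0) ler_wpM2r ?invr_ge0 ?(ltW d0)//.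
  rewrite (le_trans (ler_normB _ _))// lerD// normrM ler_piMr//.
    exact: normr_sin_le1.
  exact: normr_cos_le1.
Qed.

End kernel.

(** * The Poisson energy *)

Section energy.
Context (R : realType).
Local Notation mu := (@lebesgue_measure R).
Implicit Types (e x y : R) (f g h : R -> R).

Lemma poisson_kernelN e t : poisson_kernel e (- t) = poisson_kernel e t :> R.
Proof. by rewrite /poisson_kernel sqrrN. Qed.

(** Every translate of the kernel has mass pi; this is the source of each factor pi
below. *)
Lemma integral_poisson_kernel_shift e x : 0 < e ->
  (\int[mu]_y (poisson_kernel e (x - y))%:E = pi%:E)%E.
Proof.
move=> e0; rewrite -(integral_poisson_kernel e0).
under eq_integral do rewrite -poisson_kernelN opprB.
rewrite (ge0_integral_shift (- x) (f := EFin \o poisson_kernel e))//.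
  by apply/measurable_EFinP; exact: continuous_measurable_fun (continuous_poisson_kernel e0).
by move=> z; rewrite lee_fin poisson_kernel_ge0// ltW.
Qed.

Lemma measurable_poisson_kernel_sub e : 0 < e ->
  measurable_fun [set: R * R] (fun z : R * R => poisson_kernel e (z.1 - z.2)).
Proof.
move=> e0; apply: (measurableT_comp (continuous_measurable_fun (continuous_poisson_kernel e0))).
exact: measurable_funB.
Qed.

Lemma tonelli_poisson_kernel1 e g : 0 < e -> measurable_fun setT g -> (forall x, 0 <= g x) ->
  (\int[mu]_x \int[mu]_y (g x * poisson_kernel e (x - y))%:E = pi%:E * \int[mu]_x (g x)%:E)%E.
Proof.
move=> e0 mg g0; rewrite -ge0_integralZl//; last 3 first.
- exact/measurable_EFinP.
- by move=> x _; rewrite lee_fin.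
- by rewrite lee_fin pi_ge0.
apply: eq_integral => x _; under eq_integral do rewrite EFinM.
rewrite ge0_integralZl//; last 3 first.
- apply/measurable_EFinP.
  apply: (measurableT_comp (continuous_measurable_fun (continuous_poisson_kernel e0))).
  exact: measurable_funB.
- by move=> y _; rewrite lee_fin poisson_kernel_ge0// ltW.
- by rewrite lee_fin.
by rewrite integral_poisson_kernel_shift// muleC.
Qed.

Lemma tonelli_poisson_kernel2 e g : 0 < e -> measurable_fun setT g -> (forall x, 0 <= g x) ->
  (\int[mu]_x \int[mu]_y (g y * poisson_kernel e (x - y))%:E = pi%:E * \int[mu]_x (g x)%:E)%E.
Proof.
move=> e0 mg g0; rewrite -[RHS](tonelli_poisson_kernel1 e0 mg g0).
have mF : measurable_fun [set: R * R]
    (fun z : R * R => (g z.2 * poisson_kernel e (z.1 - z.2))%:E).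
  apply/measurable_EFinP/measurable_funM; last exact: measurable_poisson_kernel_sub.
  exact: measurableT_comp.
have /= -> := @fubini_tonelli _ _ _ _ R mu mu _ mF.
- apply: eq_integral => x _; apply: eq_integral => y _.
  by rewrite -poisson_kernelN opprB.
- by move=> z; rewrite lee_fin mulr_ge0// poisson_kernel_ge0// ltW.
Qed.

Definition double_integral (u : R * R -> R) : \bar R :=
  (\int[mu]_x \int[mu]_y (u (x, y))%:E)%E.

(** 2 pi times the quadratic form of 1 - P, where P is convolution with the Poisson
kernel divided by pi; see [poisson_form_energy]. *)
Definition energy e f : \bar R :=
  double_integral (fun z => (f z.1 - f z.2) ^+ 2 * poisson_kernel e (z.1 - z.2)).

Lemma measurable_energy_integrand e f : 0 < e -> measurable_fun setT f ->
  measurable_fun [set: R * R]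
    (fun z : R * R => (f z.1 - f z.2) ^+ 2 * poisson_kernel e (z.1 - z.2)).
Proof.
move=> e0 mf; apply: measurable_funM; last exact: measurable_poisson_kernel_sub.
by apply: measurable_funX; apply: measurable_funB; exact: measurableT_comp.
Qed.

Lemma energy_integrand_ge0 e f x y : 0 < e ->
  0 <= (f x - f y) ^+ 2 * poisson_kernel e (x - y).
Proof. by move=> e0; rewrite mulr_ge0 ?sqr_ge0// poisson_kernel_ge0// ltW. Qed.

Lemma measurable_tonelli (u : R * R -> R) :
  measurable_fun [set: R * R] u -> (forall z, 0 <= u z) ->
  measurable_fun [set: R] (fun x => (\int[mu]_y (u (x, y))%:E)%E).
Proof.
move=> mu' u0.
have mU : measurable_fun [set: R * R] (EFin \o u) by exact/measurable_EFinP.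
by apply: (@measurable_fun_fubini_tonelli_F _ _ _ _ R mu _ mU) => z; rewrite lee_fin.
Qed.

Lemma le_double_integral (u v : R * R -> R) :
  measurable_fun [set: R * R] u -> measurable_fun [set: R * R] v ->
  (forall z, 0 <= u z <= v z) ->
  (double_integral u <= double_integral v)%E.
Proof.
move=> mu' mv uv.
have u0 z : 0 <= u z by case/andP: (uv z).
have v0 z : 0 <= v z by case/andP: (uv z) => /le_trans; apply.
have mU : measurable_fun [set: R * R] (EFin \o u) by exact/measurable_EFinP.
have mV : measurable_fun [set: R * R] (EFin \o v) by exact/measurable_EFinP.
apply: ge0_le_integral => //.
- by move=> x _; apply: integral_ge0 => y _; rewrite lee_fin.
- exact: measurable_tonelli.
- exact: measurable_tonelli.
- move=> x _; apply: ge0_le_integral => //.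
  + by move=> y _; rewrite lee_fin.
  + by apply/measurable_EFinP; exact: (measurableT_comp mu' (pair1_measurable x)).
  + by apply/measurable_EFinP; exact: (measurableT_comp mv (pair1_measurable x)).
  + by move=> y _; rewrite lee_fin; case/andP: (uv (x, y)).
Qed.

Lemma double_integralD (u v : R * R -> R) :
  measurable_fun [set: R * R] u -> measurable_fun [set: R * R] v ->
  (forall z, 0 <= u z) -> (forall z, 0 <= v z) ->
  double_integral (u \+ v)%R = (double_integral u + double_integral v)%E.
Proof.
move=> mu' mv u0 v0.
have mU : measurable_fun [set: R * R] (EFin \o u) by exact/measurable_EFinP.
have mV : measurable_fun [set: R * R] (EFin \o v) by exact/measurable_EFinP.
rewrite /double_integral -ge0_integralD//; last 4 first.
- by move=> x _; apply: integral_ge0 => y _; rewrite lee_fin.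
- exact: measurable_tonelli.
- by move=> x _; apply: integral_ge0 => y _; rewrite lee_fin.
- exact: measurable_tonelli.
apply: eq_integral => x _; rewrite -ge0_integralD//.
- by move=> y _; rewrite lee_fin.
- by apply/measurable_EFinP; exact: (measurableT_comp mu' (pair1_measurable x)).
- by move=> y _; rewrite lee_fin.
- by apply/measurable_EFinP; exact: (measurableT_comp mv (pair1_measurable x)).
Qed.

(** By (a - b)^2 <= 2 a^2 + 2 b^2 and the mass pi of the kernel, in each of the two
variables. *)
Lemma energy_le e f : 0 < e -> measurable_fun setT f ->
  (energy e f <= (4 * pi)%:E * \int[mu]_x (f x ^+ 2)%:E)%E.
Proof.
move=> e0 mf; have mf2 : measurable_fun setT (fun x => 2 * f x ^+ 2).
  by apply: measurable_funM => //; exact: measurable_funX.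
have f20 x : 0 <= 2 * f x ^+ 2 by rewrite mulr_ge0// sqr_ge0.
have mk := measurable_poisson_kernel_sub e0.
have k0 t : 0 <= poisson_kernel e t by rewrite poisson_kernel_ge0// ltW.
pose F1 (z : R * R) := 2 * f z.1 ^+ 2 * poisson_kernel e (z.1 - z.2).
pose F2 (z : R * R) := 2 * f z.2 ^+ 2 * poisson_kernel e (z.1 - z.2).
have mF1 : measurable_fun [set: R * R] F1.
  by apply: measurable_funM => //; exact: (measurableT_comp mf2).
have mF2 : measurable_fun [set: R * R] F2.
  by apply: measurable_funM => //; exact: (measurableT_comp mf2).
apply: (@le_trans _ _ (double_integral (F1 \+ F2))).
  apply: le_double_integral; [exact: measurable_energy_integrand|exact: measurable_funD|].
  move=> z; rewrite energy_integrand_ge0//= /F1 /F2 -mulrDl ler_wpM2r//.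
  rewrite -subr_ge0.
  rewrite [X in 0 <= X](_ : _ = (f z.1 + f z.2) ^+ 2) ?sqr_ge0//; ring.
rewrite double_integralD//; last 2 first.
- by move=> z; rewrite mulr_ge0.
- by move=> z; rewrite mulr_ge0.
rewrite /double_integral/= (tonelli_poisson_kernel1 e0 mf2)// (tonelli_poisson_kernel2 e0 mf2)//.
under eq_integral do rewrite EFinM.
rewrite ge0_integralZl//; last 2 first.
- by apply/measurable_EFinP; exact: measurable_funX.
- by move=> x _; rewrite lee_fin sqr_ge0.
rewrite muleA -ge0_muleDl; [|by rewrite mule_ge0// lee_fin pi_ge0|by rewrite mule_ge0// lee_fin pi_ge0].
by rewrite -EFinM -EFinD (_ : 4 * pi = pi * 2 + pi * 2)//; ring.
Qed.

(** With energy_le for f - h, this reduces the convergence of energies to 0 from f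
to an approximation h of f in L^2. *)
Lemma energy_le_split e f h : 0 < e -> measurable_fun setT f -> measurable_fun setT h ->
  (energy e f <= 2%:E * energy e h + 2%:E * energy e (f \- h)%R)%E.
Proof.
move=> e0 mf mh; have mfh : measurable_fun setT (f \- h) by exact: measurable_funB.
pose F g (z : R * R) := (g z.1 - g z.2) ^+ 2 * poisson_kernel e (z.1 - z.2).
have F0 g z : 0 <= F g z by exact: energy_integrand_ge0.
have mF g : measurable_fun setT g -> measurable_fun [set: R * R] (F g).
  exact: measurable_energy_integrand.
have mfF := mF _ mf; have mhF := mF _ mh; have mfhF := mF _ mfh.
have ge0D (u v : R * R -> R) : (forall z, 0 <= u z) -> (forall z, 0 <= v z) ->
  forall z, 0 <= (u \+ v) z by move=> u0 v0 z; rewrite addr_ge0.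
apply: (@le_trans _ _
    (double_integral ((F h \+ F h) \+ (F (f \- h) \+ F (f \- h))))); last first.
  rewrite (double_integralD (measurable_funD mhF mhF) (measurable_funD mfhF mfhF)); last 2 first.
  - exact: ge0D.
  - exact: ge0D.
  rewrite (double_integralD mhF mhF (F0 _) (F0 _)) (double_integralD mfhF mfhF (F0 _) (F0 _)).
  by rewrite !mule_natl !mule2n.
apply: le_double_integral => //; first by apply: measurable_funD; exact: measurable_funD.
move=> z; rewrite F0/= /F/= -!mulrDl ler_wpM2r//.
  by rewrite poisson_kernel_ge0// ltW.
rewrite -subr_ge0.
rewrite [X in 0 <= X](_ : _ = (2 * (h z.1 - h z.2) - (f z.1 - f z.2)) ^+ 2) ?sqr_ge0//; ring.
Qed.

End energy.

(** * Vanishing of the Poisson energy *)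

Lemma ge0_cvge0P (R : realType) (u : (\bar R)^nat) : (forall n, 0 <= u n)%E ->
  (u @ \oo --> 0%E) <->
  (forall eta : R, 0 < eta -> \forall n \near \oo, (u n <= eta%:E)%E).
Proof.
move=> u0; split.
  move=> /fine_cvgP[ufin /cvgr0_norm_le u_0] eta eta0.
  have := u_0 _ eta0; apply: filterS2 ufin => n un /=.
  by rewrite -{2}(fineK un) lee_fin ger0_norm// fine_ge0.
move=> H; have ufin : \forall n \near \oo, u n \is a fin_num.
  have := H 1 ltr01; apply: filterS => n un.
  by rewrite ge0_fin_numE// (le_lt_trans un)// ltry.
apply/fine_cvgP; split => //; apply/cvgr0Pnorm_le => eta eta0.
have := H _ eta0; apply: filterS2 ufin => n un /=.
by rewrite -{1}(fineK un) lee_fin ger0_norm// fine_ge0.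
Qed.

Section kernel_average.
Context (R : realType).
Local Notation mu := (@lebesgue_measure R).
Implicit Types (e x y : R) (f g h : R -> R).

(** Away from 0 the kernel is of order e while remaining a multiple of the fixed
integrable function k_1. *)
Lemma poisson_kernel_tail e d t : 0 < e -> 0 < d -> d <= `|t| ->
  poisson_kernel e t <= e * (1 + d ^- 2) * poisson_kernel 1 t.
Proof.
move=> e0 d0 dt.
have t20 : 0 < t ^+ 2.
  by rewrite -real_normK ?num_real// exprn_gt0// (lt_le_trans d0).
have dt2 : d ^+ 2 <= t ^+ 2.
  by rewrite -[t ^+ 2]real_normK ?num_real// lerXn2r ?nnegrE// ltW.
have d20 : 0 < d ^+ 2 by rewrite exprn_gt0.
have d1 : 0 < e ^+ 2 + t ^+ 2 by exact: poisson_kernel_den_gt0.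
have d2 : 0 < 1 ^+ 2 + t ^+ 2 by exact: poisson_kernel_den_gt0.
rewrite /poisson_kernel -mulrA ler_pM2l//.
rewrite (@le_trans _ _ (t ^+ 2)^-1)//.
  by rewrite lef_pV2 ?posrE// lerDr sqr_ge0.
rewrite mul1r ler_pdivlMr// mulrDr expr1n mulr1 mulVf ?gt_eqF//.
by rewrite addrC lerD2l lef_pV2.
Qed.

(** The kernel concentrates at 0: near x the integrand is small by continuity of h,
and away from x the kernel is of order e. *)
Lemma poisson_average_cvg0 h C x : continuous h -> (forall x, `|h x| <= C) ->
  (fun n => \int[mu]_y ((h x - h y) ^+ 2 * poisson_kernel n.+1%:R^-1 (x - y))%:E)%E @ \oo --> 0%E.
Proof.
move=> ch hC.
have e0 n : 0 < n.+1%:R^-1 :> R by rewrite invr_gt0.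
have mh : measurable_fun setT h by exact: continuous_measurable_fun.
have mk e : 0 < e -> measurable_fun setT (fun y => poisson_kernel e (x - y)).
  move=> ?; apply: (measurableT_comp (continuous_measurable_fun (continuous_poisson_kernel _))) => //.
  exact: measurable_funB.
apply/ge0_cvge0P.
  by move=> n; apply: integral_ge0 => y _; rewrite lee_fin energy_integrand_ge0.
move=> eta eta0.
(* The near part is at most s times the mass pi of the kernel, that is eta / 2. *)
pose s := eta / (2 * pi).
have s0 : 0 < s by rewrite divr_gt0// mulr_gt0// pi_gt0.
have /cvgr_dist_le/(_ (Num.sqrt s)) := ch x.
rewrite sqrtr_gt0 => /(_ s0)/nbhs_ballP[d /= d0 Hd].
pose A := 4 * C ^+ 2 * (1 + d ^- 2).
have A0 : 0 <= A.
  apply: mulr_ge0; first by rewrite mulr_ge0// sqr_ge0.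
  by rewrite addr_ge0// invr_ge0 sqr_ge0.
have pw n y : (h x - h y) ^+ 2 * poisson_kernel n.+1%:R^-1 (x - y) <=
    s * poisson_kernel n.+1%:R^-1 (x - y) + A * n.+1%:R^-1 * poisson_kernel 1 (x - y).
  have k0 e : 0 < e -> 0 <= poisson_kernel e (x - y) by move=> ?; rewrite poisson_kernel_ge0// ltW.
  have [xyd|xyd] := ltP `|x - y| d.
    apply: ler_wpDr; first by apply: mulr_ge0; [exact: mulr_ge0|exact: k0].
    rewrite ler_wpM2r ?k0//.
    have := Hd y xyd; rewrite /= => hxy.
    rewrite -real_normK ?num_real// -(sqr_sqrtr (ltW s0)).
    by rewrite lerXn2r ?nnegrE// sqrtr_ge0.
  apply: ler_wpDl; first by apply: mulr_ge0; [exact: ltW|exact: k0].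
  rewrite (_ : A * _ * _ = 4 * C ^+ 2 *
    (n.+1%:R^-1 * (1 + d ^- 2) * poisson_kernel 1 (x - y))); last by rewrite /A; ring.
  apply: ler_pM; [exact: sqr_ge0|exact: k0| |exact: poisson_kernel_tail].
  rewrite -real_normK ?num_real// (_ : 4 * C ^+ 2 = (C + C) ^+ 2); last by ring.
  have C0 : 0 <= C by rewrite (le_trans _ (hC x)).
  rewrite lerXn2r ?nnegrE ?addr_ge0//.
  by rewrite (le_trans (ler_normB _ _))// lerD.
have Gle n : (\int[mu]_y ((h x - h y) ^+ 2 * poisson_kernel n.+1%:R^-1 (x - y))%:E <=
    (s * pi + A * n.+1%:R^-1 * pi)%:E)%E.
  have k0 e y : 0 < e -> (0 <= (poisson_kernel e (x - y))%:E)%E.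
    by move=> ?; rewrite lee_fin poisson_kernel_ge0// ltW.
  have mke e : 0 < e -> measurable_fun setT (fun y => (poisson_kernel e (x - y))%:E).
    by move=> ?; apply/measurable_EFinP; exact: mk.
  have An : 0 <= A * n.+1%:R^-1 by rewrite mulr_ge0// ltW.
  apply: (@le_trans _ _ (\int[mu]_y (s%:E * (poisson_kernel n.+1%:R^-1 (x - y))%:E +
    (A * n.+1%:R^-1)%:E * (poisson_kernel 1 (x - y))%:E))%E).
    apply: ge0_le_integral => //.
    - by move=> y _; rewrite lee_fin energy_integrand_ge0.
    - apply/measurable_EFinP/measurable_funM; last exact: mk.
      by apply: measurable_funX; exact: measurable_funB.
    - by apply: emeasurable_funD; apply: measurable_funeM; exact: mke.
    - by move=> y _; rewrite -!EFinM -EFinD lee_fin pw.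
  rewrite ge0_integralD//; last 4 first.
  - by move=> y _; rewrite mule_ge0 ?k0// lee_fin ltW.
  - by apply: measurable_funeM; exact: mke.
  - by move=> y _; rewrite mule_ge0 ?k0// lee_fin.
  - by apply: measurable_funeM; exact: mke.
  rewrite !ge0_integralZl//; [|exact: mke|by move=> y _; exact: k0|exact: mke|
    by move=> y _; exact: k0|by rewrite lee_fin ltW].
  by rewrite !integral_poisson_kernel_shift// -!EFinM -EFinD.
have Ap0 : 0 <= A * pi by rewrite mulr_ge0// pi_ge0.
have pi0 : pi != 0 :> R by rewrite gt_eqF ?pi_gt0.
have s2 : s * pi = eta / 2 by rewrite /s invfM mulrA divfK.
have c0 : 0 < eta / 2 / (A * pi + 1) by rewrite !divr_gt0// ltr_wpDl.
near=> n; rewrite (le_trans (Gle n))// lee_fin s2 mulrAC.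
rewrite [leRHS]splitr lerD2l.
have /ltW : n.+1%:R^-1 < eta / 2 / (A * pi + 1).
  by near: n; apply: near_infty_natSinv_lt (PosNum c0).
rewrite ler_pdivlMr ?ltr_wpDl// => /(le_trans _); apply.
by rewrite mulrC; apply: ler_wpM2l; rewrite ?invr_ge0 ?lerDl.
Unshelve. all: by end_near. Qed.

End kernel_average.

Section compact_support.
Context (R : realType).
Local Notation mu := (@lebesgue_measure R).
Implicit Types (e x y : R) (f g h : R -> R).

Lemma double_integral_swap (u : R * R -> R) : measurable_fun [set: R * R] u ->
  (forall z, 0 <= u z) -> double_integral (fun z => u (z.2, z.1)) = double_integral u.
Proof.
move=> mu' u0.
have mF : measurable_fun [set: R * R] (fun z : R * R => (u z)%:E).
  exact/measurable_EFinP.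
have := @fubini_tonelli _ _ _ _ R mu mu _ mF.
by rewrite /double_integral => -> // z; rewrite lee_fin.
Qed.

(** The integrand vanishes when both points lie outside the support.  By symmetry
the energy is thus at most twice its part with x in the support, where
dominated convergence applies to the inner integrals. *)
Lemma energy_cvg0_compact h C M : continuous h -> (forall x, `|h x| <= C) ->
  (forall x, M < `|x| -> h x = 0) ->
  (fun n => energy n.+1%:R^-1 h) @ \oo --> 0%E.
Proof.
move=> ch hC hM.
have e0 n : 0 < n.+1%:R^-1 :> R by rewrite invr_gt0.
have mh : measurable_fun setT h by exact: continuous_measurable_fun.
pose E : set R := `[- M, M]%classic.
have mE : measurable E by exact: measurable_itv.
have EP x : x \notin E -> h x = 0.
  rewrite notin_setE /E/= in_itv/= => /negP; rewrite -ler_norml -ltNge.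
  exact: hM.
pose F n (z : R * R) := (h z.1 - h z.2) ^+ 2 * poisson_kernel n.+1%:R^-1 (z.1 - z.2).
have F0 n z : 0 <= F n z by exact: energy_integrand_ge0.
have mF n : measurable_fun [set: R * R] (F n) by exact: measurable_energy_integrand.
pose F1 n (z : R * R) := \1_E z.1 * F n z.
pose F2 n (z : R * R) := \1_E z.2 * F n z.
have mF1 n : measurable_fun [set: R * R] (F1 n).
  apply: measurable_funM => //.
  by apply: (measurableT_comp (measurable_indic mE)).
have mF2 n : measurable_fun [set: R * R] (F2 n).
  apply: measurable_funM => //.
  by apply: (measurableT_comp (measurable_indic mE)).
have F10 n z : 0 <= F1 n z by exact: mulr_ge0.
have F20 n z : 0 <= F2 n z by exact: mulr_ge0.
pose G n x : \bar R := (\int[mu]_y (F n (x, y))%:E)%E.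
have mG n : measurable_fun setT (G n) by exact: measurable_tonelli.
have le1 n : (energy n.+1%:R^-1 h <= 2%:E * \int[mu]_(x in E) G n x)%E.
  apply: (@le_trans _ _ (double_integral (F1 n \+ F2 n))).
    apply: (le_double_integral (mF n) (measurable_funD (mF1 n) (mF2 n))).
    move=> z; rewrite F0/=; have [z1|z1] := boolP (z.1 \in E).
      by rewrite /F1 indicE z1 mul1r lerDl F20.
    have [z2|z2] := boolP (z.2 \in E).
      by rewrite /F2 indicE z2 mul1r lerDr F10.
    by rewrite /F (EP _ z1) (EP _ z2) subrr expr0n/= mul0r addr_ge0.
  rewrite (double_integralD (mF1 n) (mF2 n) (F10 n) (F20 n)).
  rewrite (_ : double_integral (F2 n) = double_integral (F1 n)); last first.
    rewrite -(double_integral_swap (mF1 n) (F10 n)); congr double_integral; apply/funext => z.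
    rewrite /F1 /F2 /F/=; congr (_ * (_ * _)); first by rewrite -sqrrN opprB.
    by rewrite -poisson_kernelN opprB.
  suff -> : double_integral (F1 n) = (\int[mu]_(x in E) G n x)%E by rewrite mule_natl mule2n.
  rewrite [RHS]integral_mkcond; apply: eq_integral => x _.
  rewrite patchE /F1/=; case: ifPn => xE.
    by apply: eq_integral => y _; rewrite indicE xE mul1r.
  under eq_integral do rewrite indicE (negbTE xE) mul0r.
  by rewrite integral0.
have C0 : 0 <= C by rewrite (le_trans _ (hC 0)).
have bnd n x : (G n x <= (4 * C ^+ 2 * pi)%:E)%E.
  have C20 : 0 <= 4 * C ^+ 2 by rewrite mulr_ge0 ?sqr_ge0.
  have k0 y : 0 <= poisson_kernel n.+1%:R^-1 (x - y) by rewrite poisson_kernel_ge0// ltW.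
  have mk : measurable_fun setT (fun y => poisson_kernel n.+1%:R^-1 (x - y)).
    apply: (measurableT_comp (continuous_measurable_fun (continuous_poisson_kernel (e0 n)))).
    exact: measurable_funB.
  apply: (@le_trans _ _ (\int[mu]_y ((4 * C ^+ 2)%:E *
      (poisson_kernel n.+1%:R^-1 (x - y))%:E))%E).
    apply: ge0_le_integral => //.
    - by move=> y _; rewrite lee_fin.
    - by apply/measurable_EFinP; exact: (measurableT_comp (mF n) (pair1_measurable x)).
    - by apply: measurable_funeM; exact/measurable_EFinP.
    - move=> y _; rewrite -EFinM lee_fin /F/= ler_wpM2r//.
      rewrite -real_normK ?num_real// (_ : 4 * C ^+ 2 = (C + C) ^+ 2); last by ring.
      rewrite lerXn2r ?nnegrE ?addr_ge0//.
      by rewrite (le_trans (ler_normB _ _))// lerD.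
  rewrite ge0_integralZl//; last 2 first.
  - exact/measurable_EFinP.
  - by move=> y _; rewrite lee_fin.
  by rewrite integral_poisson_kernel_shift// -EFinM.
have iE : mu.-integrable E (fun=> (4 * C ^+ 2 * pi)%:E).
  apply: (@continuous_compact_integrable _ (fun=> 4 * C ^+ 2 * pi)).
    exact: segment_compact.
  by apply: continuous_subspaceT => x; exact: cvg_cst.
have := @dominated_convergence _ _ _ mu E mE G (cst 0%E) (fun=> (4 * C ^+ 2 * pi)%:E).
case.
- move=> n. apply: measurable_funTS; exact: mG.
- exact: measurable_cst.
- apply: aeW => x _; exact: poisson_average_cvg0.
- exact: iE.
- apply: aeW => x n _. rewrite gee0_abs//.
  by apply: integral_ge0 => y _; rewrite lee_fin.
move=> _ _; rewrite integral0 => /= H.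
have : (fun n => 2%:E * \int[mu]_(x in E) G n x)%E @ \oo --> 0%E.
  rewrite -(mule0 2%:E); apply: cvgeZl => //.
apply: squeeze_cvge; last exact: cvg_cst.
apply: nearW => n; rewrite le1 andbT.
by apply: integral_ge0 => x _; apply: integral_ge0 => y _; rewrite lee_fin F0.
Qed.

End compact_support.

Section density.
Context (R : realType).
Local Notation mu := (@lebesgue_measure R).
Implicit Types (e x y : R) (f g h : R -> R).

Lemma sqrD_le (s t : R) : (s + t) ^+ 2 <= 2 * s ^+ 2 + 2 * t ^+ 2.
Proof.
rewrite -subr_ge0.
by rewrite [X in 0 <= X](_ : _ = (s - t) ^+ 2) ?sqr_ge0//; ring.
Qed.

(** Cutting off both the domain and the values makes f bounded with bounded support,
which is what the approximation by continuous functions below requires. *)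
Definition truncate (n : nat) f x : R :=
  f x * (`|x| <= n%:R)%R%:R * (`|f x| <= n%:R)%R%:R.

Lemma measurable_truncate n f : measurable_fun setT f ->
  measurable_fun setT (truncate n f).
Proof.
move=> mf.
have mle g : measurable_fun setT g -> measurable_fun setT (fun x => (`|g x| <= n%:R)%R%:R : R).
  move=> mg; rewrite (_ : (fun x => _) = \1_[set x | `|g x| <= n%:R]); last first.
    apply/funext => x; rewrite indicE; congr (_%:R); congr nat_of_bool.
    by apply/idP/idP; rewrite inE.
  apply: measurable_indic.
  rewrite -[X in measurable X]setTI; apply: measurable_fun_le => //.
  exact: measurableT_comp.
by apply: measurable_funM; [apply: measurable_funM => //|]; exact: mle.
Qed.

Lemma truncate_cvg f : measurable_fun setT f ->
  (\int[mu]_x (f x ^+ 2)%:E < +oo)%E ->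
  (fun n => \int[mu]_x ((f x - truncate n f x) ^+ 2)%:E)%E @ \oo --> 0%E.
Proof.
move=> mf f2.
have := @dominated_convergence _ _ _ mu setT measurableT
  (fun n x => ((f x - truncate n f x) ^+ 2)%:E) (cst 0%E) (fun x => (f x ^+ 2)%:E).
case.
- move=> n; apply/measurable_EFinP; apply: measurable_funX.
  by apply: measurable_funB => //; exact: measurable_truncate.
- exact: measurable_cst.
- apply: aeW => x _; apply: cvg_near_cst.
  near=> n; rewrite /truncate.
  have -> : `|x| <= n%:R by near: n; exact: nbhs_infty_ger.
  have -> : `|f x| <= n%:R by near: n; exact: nbhs_infty_ger.
  by rewrite !mulr1 subrr expr0n.
- apply/integrableP; split.
    by apply/measurable_EFinP; exact: measurable_funX.
  by under eq_integral do rewrite /= ger0_norm ?sqr_ge0//.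
- apply: aeW => x n _; rewrite /= lee_fin ger0_norm ?sqr_ge0// /truncate.
  case: (`|x| <= n%:R); case: (`|f x| <= n%:R); rewrite ?mulr1 ?mulr0 ?mul0r ?subrr ?subr0 ?expr0n//= ?sqr_ge0//.
by move=> _ _; rewrite integral0.
Unshelve. all: by end_near. Qed.

(** Clipping an approximation to the range of the truncated function does not
increase the error ([clip_dist]) and keeps the approximation bounded. *)
Definition clip (c t : R) : R := Num.max (- c) (Num.min c t).

Lemma clip_dist (c s t : R) : `|s| <= c -> `|s - clip c t| <= `|s - t|.
Proof.
rewrite /clip ler_norml => /andP[cs sc].
rewrite /Num.max /Num.min.
by case: (ltP c t) => ct; [case: (ltP (- c) c) => h|case: (ltP (- c) t) => h];
  rewrite // ler_norml; have [H|H] := ger0P (s - t); lra.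
Qed.

Lemma clip_le (c t : R) : 0 <= c -> `|clip c t| <= c.
Proof.
move=> c0; rewrite /clip ler_norml le_max lexx/= ge_max ge_min lexx/= andbT.
by rewrite (le_trans _ c0)// oppr_le0.
Qed.

Lemma continuous_clip (c : R) : continuous (clip c).
Proof.
move=> x; rewrite (_ : clip c = cst (- c) \max (cst c \min id))//.
by apply: continuous_max; [|apply: continuous_min]; [exact: cvg_cst|exact: cvg_cst|exact: cvg_id].
Qed.

(** A continuous cut-off: 1 for |x| <= m and 0 for |x| >= m + 1. *)
Definition plateau (m x : R) : R := Num.max 0 (Num.min 1 (m + 1 - `|x|)).

Lemma continuous_plateau (m : R) : continuous (plateau m).
Proof.
move=> x; rewrite (_ : plateau m =
  cst 0 \max (cst 1 \min (fun x => m + 1 - `|x|)))//.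
apply: continuous_max; first exact: cvg_cst.
apply: continuous_min; first exact: cvg_cst.
by apply: cvgB; [exact: cvg_cst|exact: norm_continuous].
Qed.

(** Continuous functions are dense in L^1 of a bounded interval.  As both functions
are bounded by n, (t - h)^2 <= 2 n |t - h|, so that an approximation in L^1 is
one in L^2. *)
Lemma truncate_approx (n : nat) f eta : 0 < eta -> measurable_fun setT f ->
  exists h, [/\ continuous h, (forall x, `|h x| <= n%:R),
    (forall x, n%:R + 1 < `|x| -> h x = 0) &
    (\int[mu]_x ((truncate n f x - h x) ^+ 2)%:E <= eta%:E)%E].
Proof.
move=> eta0 mf; set t := truncate n f.
have mt : measurable_fun setT t by exact: measurable_truncate.
have tn x : `|t x| <= n%:R.
  rewrite /t /truncate; case: (lerP `|f x|) => fx; rewrite ?mulr0 ?normr0//.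
  by rewrite mulr1; case: (`|x| <= n%:R); rewrite ?mulr1// mulr0 normr0.
have t0 x : n%:R < `|x| -> t x = 0.
  by move=> nx; rewrite /t /truncate leNgt nx/= mulr0 mul0r.
pose E : set R := `[- (n%:R + 1), n%:R + 1]%classic.
have mE : measurable E by exact: measurable_itv.
have Eoo : (mu E < +oo)%E.
  by rewrite /E lebesgue_measure_itv/=; case: ifP => _; rewrite ?ltry// -EFinB ltry.
have it : mu.-integrable E (EFin \o t).
  apply: measurable_bounded_integrable => //; first exact: measurable_funTS.
  by exists n%:R; split; [rewrite num_real|move=> M nM x _ /=; rewrite (le_trans (tn x))// ltW].
have [g [cg ig g0]] := approximation_continuous_integrable mE Eoo it.
have d0 : 0 < eta / (2 * n%:R + 1).
  by rewrite divr_gt0// ltr_wpDl// mulr_ge0.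
have gk0 k : (0 <= \int[mu]_(z in E) `|(t z - g k z)%:E|)%E.
  exact: integral_ge0.
have [k _ /(_ k (leqnn k)) gk] := (ge0_cvge0P gk0).1 g0 _ d0.
pose h x := plateau n%:R x * clip n%:R (g k x).
have p01 x : 0 <= plateau n%:R x <= 1.
  by rewrite /plateau le_max lexx/= ge_max ler01 ge_min lexx.
have ch : continuous h.
  move=> x; apply: cvgM; first exact: continuous_plateau.
  by apply: continuous_comp; [exact: cg|exact: continuous_clip].
have mh : measurable_fun setT h by exact: continuous_measurable_fun.
exists h; split => //.
- move=> x; rewrite normrM -[leRHS]mul1r ler_pM//.
    by rewrite ger0_norm; case/andP: (p01 x).
  exact: clip_le.
- move=> x nx; rewrite /h /plateau max_l ?mul0r//.
  by rewrite ge_min subr_le0 (ltW nx) orbT.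
have pt x : (t x - h x) ^+ 2 <= (2 * n%:R) * (`|t x - g k x| * \1_E x).
  have [xE|xE] := boolP (x \in E); last first.
    have nx : n%:R + 1 < `|x|.
      by move: xE; rewrite notin_setE /E/= in_itv/= => /negP; rewrite -ler_norml -ltNge.
    rewrite t0; last by rewrite (lt_trans _ nx)// ltrDl.
    rewrite /h /plateau max_l; last by rewrite ge_min subr_le0 (ltW nx) orbT.
    by rewrite mul0r subrr expr0n/= indicE (negbTE xE) !mulr0.
  (* The cut-off is 1 wherever t differs from 0. *)
  have tp : t x = plateau n%:R x * t x.
    have [xn|/t0->] := leP `|x| n%:R; last by rewrite mulr0.
    rewrite /plateau min_l; last by move: xn; lra.
    by rewrite max_r// mul1r.
  have -> : (t x - h x) ^+ 2 = plateau n%:R x ^+ 2 * (`|t x - clip n%:R (g k x)| * `|t x - clip n%:R (g k x)|).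
    by rewrite -expr2 real_normK ?num_real// -exprMn /h {1}tp -mulrBr.
  rewrite indicE xE mulr1.
  have /andP[p0 p1] := p01 x.
  rewrite -[leRHS]mul1r; apply: ler_pM => //.
  - exact: sqr_ge0.
  - by rewrite -[leRHS](expr1n _ 2) lerXn2r ?nnegrE.
  - apply: ler_pM => //; last exact: clip_dist.
    by rewrite (le_trans (ler_normB _ _))// mulr_natl mulr2n lerD// clip_le.
have mgk : measurable_fun setT (g k) by exact: continuous_measurable_fun (cg k).
have n20 : 0 <= 2 * n%:R :> R by rewrite mulr_ge0.
apply: (@le_trans _ _ ((2 * n%:R)%:E * (eta / (2 * n%:R + 1))%:E)%E); last first.
  rewrite -EFinM lee_fin mulrCA ger_pMr// ler_pdivrMr ?mul1r ?lerDl//.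
apply: (@le_trans _ _ (\int[mu]_x ((2 * n%:R)%:E * (`|t x - g k x| * \1_E x)%:E))%E).
  have mr : measurable_fun setT (fun x => `|t x - g k x| * \1_E x : R).
    apply: measurable_funM; last exact: measurable_indic.
    by apply: measurableT_comp => //; exact: measurable_funB.
  apply: ge0_le_integral => //.
  - by move=> x _; rewrite lee_fin sqr_ge0.
  - by apply/measurable_EFinP; apply: measurable_funX; exact: measurable_funB.
  - by apply: measurable_funeM; exact/measurable_EFinP.
  - by move=> x _; rewrite -EFinM lee_fin pt.
rewrite ge0_integralZl//; last first.
  apply/measurable_EFinP; apply: measurable_funM; last exact: measurable_indic.
  by apply: measurableT_comp => //; exact: measurable_funB.
apply: lee_wpmul2l; first by rewrite lee_fin.
rewrite (le_trans _ gk)// [leRHS]integral_mkcond le_eqVlt; apply/orP; left.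
apply/eqP; apply: eq_integral => x _; rewrite patchE indicE.
by case: ifP => _; rewrite ?mulr1// mulr0.
Qed.

(** Approximate f in L^2 by a continuous h with compact support: by energy_le_split
the energy of f is controlled by that of h, which tends to 0, and by
energy_le for f - h, uniformly in the parameter of the kernel. *)
Lemma energy_cvg0 f : measurable_fun setT f ->
  (\int[mu]_x (f x ^+ 2)%:E < +oo)%E ->
  (fun n => energy n.+1%:R^-1 f) @ \oo --> 0%E.
Proof.
move=> mf f2.
have e0 n : 0 < n.+1%:R^-1 :> R by rewrite invr_gt0.
have en0 g n : (0 <= energy n.+1%:R^-1 g)%E.
  apply: integral_ge0 => x _; apply: integral_ge0 => y _.
  by rewrite lee_fin energy_integrand_ge0.
apply/ge0_cvge0P; first exact: en0.
move=> eta eta0.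
have p0 : 0 < pi :> R by exact: pi_gt0.
(* |f - h|^2 <= 2 s + 2 s = 4 s in L^2, which contributes 2 (4 pi) (4 s) = eta / 2
   to the energy. *)
pose s : R := eta / (64 * pi).
have s0 : 0 < s by rewrite divr_gt0// mulr_gt0.
have tr0 n : (0 <= \int[mu]_x ((f x - truncate n f x) ^+ 2)%:E)%E.
  by apply: integral_ge0 => x _; rewrite lee_fin sqr_ge0.
have [k _ /(_ k (leqnn k)) fk] := (ge0_cvge0P tr0).1 (truncate_cvg mf f2) _ s0.
have [h [ch hk hk0 th]] := truncate_approx k s0 mf.
have mh : measurable_fun setT h by exact: continuous_measurable_fun.
have mt : measurable_fun setT (truncate k f) by exact: measurable_truncate.
have fh : (\int[mu]_x ((f x - h x) ^+ 2)%:E <= (4 * s)%:E)%E.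
  apply: (@le_trans _ _ (\int[mu]_x (2%:E * ((f x - truncate k f x) ^+ 2)%:E +
      2%:E * ((truncate k f x - h x) ^+ 2)%:E))%E).
    apply: ge0_le_integral => //.
    - by move=> x _; rewrite lee_fin sqr_ge0.
    - by apply/measurable_EFinP; apply: measurable_funX; exact: measurable_funB.
    - by apply: emeasurable_funD; apply: measurable_funeM;
        apply/measurable_EFinP; apply: measurable_funX; exact: measurable_funB.
    - move=> x _; rewrite -!EFinM -EFinD lee_fin.
      have := sqrD_le (f x - truncate k f x) (truncate k f x - h x).
      by rewrite addrA subrK.
  rewrite ge0_integralD//; last 4 first.
  - by move=> x _; rewrite mule_ge0// lee_fin sqr_ge0.
  - by apply: measurable_funeM; apply/measurable_EFinP; apply: measurable_funX; exact: measurable_funB.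
  - by move=> x _; rewrite mule_ge0// lee_fin sqr_ge0.
  - by apply: measurable_funeM; apply/measurable_EFinP; apply: measurable_funX; exact: measurable_funB.
  rewrite !ge0_integralZl//; last 4 first.
  - by apply/measurable_EFinP; apply: measurable_funX; exact: measurable_funB.
  - by move=> x _; rewrite lee_fin sqr_ge0.
  - by apply/measurable_EFinP; apply: measurable_funX; exact: measurable_funB.
  - by move=> x _; rewrite lee_fin sqr_ge0.
  rewrite (_ : 4 * s = 2 * s + 2 * s); last by ring.
  by rewrite [leRHS]EFinD (EFinM 2 s); apply: leeD; apply: lee_wpmul2l.
have := (ge0_cvge0P (en0 h)).1 (energy_cvg0_compact ch hk hk0) (eta / 4).
have eta4 : 0 < eta / 4 by rewrite divr_gt0.
move=> /(_ eta4); apply: filterS => n hn.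
rewrite (le_trans (energy_le_split (e0 n) mf mh))//.
apply: (@le_trans _ _ (2%:E * (eta / 4)%:E +
  2%:E * ((4 * pi)%:E * (4 * s)%:E))%E).
  apply: leeD; apply: lee_wpmul2l => //.
  rewrite (le_trans (energy_le (e0 n) (measurable_funB mf mh)))//.
  by apply: lee_wpmul2l => //; rewrite lee_fin mulr_ge0// ltW.
rewrite -!EFinM -EFinD lee_fin.
have -> : 2 * (4 * pi * (4 * s)) = eta / 2.
  by rewrite /s; move: pi p0 => p p0; field; rewrite gt_eqF.
lra.
Qed.

End density.

(** * The Plancherel identity on the line *)

Section real_plancherel.
Context (R : realType).
Local Notation mu := (@lebesgue_measure R).
Implicit Types (e x y p : R).
Variable f : R -> R.
Hypothesis fi : mu.-integrable setT (EFin \o f).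

Let mf : measurable_fun setT f.
Proof. by apply/measurable_EFinP; exact: measurable_int fi. Qed.

Let C p := \int[mu]_x (f x * cos (p * x)).
Let S p := \int[mu]_x (f x * sin (p * x)).

Let mpx p : measurable_fun [set: R] (fun x => p * x).
Proof. exact: measurable_funM. Qed.

Let mprod : measurable_fun [set: R * R] (fun z : R * R => z.1 * z.2).
Proof. exact: measurable_funM. Qed.

Let mf2 : measurable_fun [set: R * R] (fun z : R * R => f z.2).
Proof. exact: measurableT_comp. Qed.

Lemma measurable_cos_transform : measurable_fun setT C.
Proof.
apply: (@measurable_fun_Rintegral2 _ _ _ _ R mu (fun p x => f x * cos (p * x))).
by apply: measurable_funM => //; exact: measurable_cos_comp.
Qed.

Lemma measurable_sin_transform : measurable_fun setT S.
Proof.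
apply: (@measurable_fun_Rintegral2 _ _ _ _ R mu (fun p x => f x * sin (p * x))).
by apply: measurable_funM => //; exact: measurable_sin_comp.
Qed.

Let N := \int[mu]_x `|f x|.

Let CN p : `|C p| <= N.
Proof.
apply: normr_RintegralM_le => //; first exact: measurable_cos_comp.
by move=> x; exact: normr_cos_le1.
Qed.

Let SN p : `|S p| <= N.
Proof.
apply: normr_RintegralM_le => //; first exact: measurable_sin_comp.
by move=> x; exact: normr_sin_le1.
Qed.

Let CS p x := C p * cos (p * x) + S p * sin (p * x).

Let CSE p x : CS p x = \int[mu]_y (f y * cos (p * (x - y))).
Proof.
have ic := integrableM_cos fi (mpx p); have is_ := integrableM_sin fi (mpx p).
rewrite /CS /C /S mulrC [X in _ + X]mulrC -Rintegral_lin2//.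
by apply: eq_Rintegral => y _; rewrite mulrBr cosB; ring.
Qed.

Let CSN p x : `|CS p x| <= N.
Proof.
rewrite CSE; apply: normr_RintegralM_le => //.
  by apply: measurable_cos_comp; apply: measurable_funM => //; exact: measurable_funB.
by move=> y; exact: normr_cos_le1.
Qed.

Let mCS : measurable_fun [set: R * R] (fun z : R * R => CS z.1 z.2).
Proof.
have mC := measurable_cos_transform; have mS := measurable_sin_transform.
apply: measurable_funD; apply: measurable_funM.
- exact: (measurableT_comp mC).
- exact: measurable_cos_comp.
- exact: (measurableT_comp mS).
- exact: measurable_sin_comp.
Qed.

(** By the addition formula for the cosine, C(p)^2 + S(p)^2 is the double integral of
f(x) f(y) cos (p (x - y)); integrating over p first gives the kernel. *)
Lemma poisson_plancherel e : 0 < e ->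
  \int[mu]_p (exp_weight e p * (C p ^+ 2 + S p ^+ 2)) =
  \int[mu]_x (f x * \int[mu]_y (f y * poisson_kernel e (x - y))).
Proof.
move=> e0.
have wi := integrable_exp_weight e0.
have mw := measurable_exp_weight e.
have H p x : exp_weight e p * (C p ^+ 2 + S p ^+ 2) =
    \int[mu]_x (exp_weight e p * f x * CS p x).
  have ic := integrableM_cos fi (mpx p); have is_ := integrableM_sin fi (mpx p).
  rewrite mulrDr !expr2 !mulrA /C /S -Rintegral_lin2//.
  by apply: eq_Rintegral => y _; rewrite /CS /C /S; ring.
have iCS x : mu.-integrable setT (fun p => (exp_weight e p * CS p x)%:E).
  apply: (integrableM_bounded wi _ (CSN ^~ x)).
  exact: (measurableT_comp mCS (pair2_measurable x)).
transitivity (\int[mu]_p \int[mu]_x (exp_weight e p * f x * CS p x)).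
  by apply: eq_Rintegral => p _; exact: H.
rewrite (@Rintegral_Fubini _ _ _ _ R mu mu (fun p x => exp_weight e p * f x * CS p x)); last first.
  apply: (@integrableM_bounded _ _ _ (mu \x mu)%E (fun z => exp_weight e z.1 * f z.2) (fun z => CS z.1 z.2) N) => //.
  exact: integrable_prod.
apply: eq_Rintegral => x _.
transitivity (f x * \int[mu]_p (exp_weight e p * CS p x)).
  rewrite -RintegralZl//; last exact: iCS.
  by apply: eq_Rintegral => p _; ring.
congr (_ * _).
transitivity (\int[mu]_p \int[mu]_y (exp_weight e p * f y * cos (p * (x - y)))).
  apply: eq_Rintegral => p _; rewrite CSE -RintegralZl//.
    by apply: eq_Rintegral => y _; rewrite mulrA.
  by apply: integrableM_cos => //; apply: measurable_funM => //; exact: measurable_funB.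
rewrite (@Rintegral_Fubini _ _ _ _ R mu mu (fun p y => exp_weight e p * f y * cos (p * (x - y)))); last first.
  apply: (@integrableM_cos _ _ _ (mu \x mu)%E (fun z => exp_weight e z.1 * f z.2)
    (fun z : R * R => z.1 * (x - z.2))); first exact: integrable_prod.
  by apply: measurable_funM => //; exact: measurable_funB.
apply: eq_Rintegral => y _; rewrite -(integral_exp_weight_cos (x - y) e0) -RintegralZl//.
  by apply: eq_Rintegral => p _; ring.
exact: integrable_exp_weight_cos.
Qed.

Hypothesis f2 : (\int[mu]_x (f x ^+ 2)%:E < +oo)%E.

Let A e (z : R * R) := f z.1 * f z.2 * poisson_kernel e (z.1 - z.2).
Let E e (z : R * R) := (f z.1 - f z.2) ^+ 2 * poisson_kernel e (z.1 - z.2).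
Let Q e (z : R * R) := (f z.1 ^+ 2 + f z.2 ^+ 2) * poisson_kernel e (z.1 - z.2).

Let E0 e z : 0 < e -> 0 <= E e z.
Proof. by move=> e0; exact: energy_integrand_ge0. Qed.

Let Q0 e z : 0 < e -> 0 <= Q e z.
Proof.
by move=> e0; rewrite mulr_ge0 ?addr_ge0 ?sqr_ge0// poisson_kernel_ge0// ltW.
Qed.

Let mE e : 0 < e -> measurable_fun [set: R * R] (E e).
Proof. by move=> e0; exact: measurable_energy_integrand. Qed.

Let mf1 : measurable_fun [set: R * R] (fun z : R * R => f z.1).
Proof. exact: measurableT_comp. Qed.

Let mQ e : 0 < e -> measurable_fun [set: R * R] (Q e).
Proof.
move=> e0; apply: measurable_funM; last exact: measurable_poisson_kernel_sub.
by apply: measurable_funD; exact: measurable_funX.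
Qed.

Let double_integralQ e : 0 < e -> (double_integral (Q e) = (2 * pi)%:E * \int[mu]_x (f x ^+ 2)%:E)%E.
Proof.
move=> e0.
have mff : measurable_fun setT (fun x => f x ^+ 2) by exact: measurable_funX.
have f20 x : 0 <= f x ^+ 2 by exact: sqr_ge0.
have k0 t : 0 <= poisson_kernel e t by rewrite poisson_kernel_ge0// ltW.
pose Q1 (z : R * R) := f z.1 ^+ 2 * poisson_kernel e (z.1 - z.2).
pose Q2 (z : R * R) := f z.2 ^+ 2 * poisson_kernel e (z.1 - z.2).
have mk := measurable_poisson_kernel_sub e0.
have -> : Q e = Q1 \+ Q2 by apply/funext => z; rewrite /Q mulrDl.
rewrite double_integralD; last 4 first.
- by apply: measurable_funM => //; exact: measurable_funX.
- by apply: measurable_funM => //; exact: measurable_funX.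
- by move=> z; exact: mulr_ge0.
- by move=> z; exact: mulr_ge0.
rewrite /double_integral/= (tonelli_poisson_kernel1 e0 mff f20) (tonelli_poisson_kernel2 e0 mff f20).
rewrite -ge0_muleDl ?lee_fin ?pi_ge0// -EFinD.
by rewrite (_ : pi + pi = 2 * pi)//; ring.
Qed.

Let prodE (u : R * R -> R) : measurable_fun [set: R * R] u -> (forall z, 0 <= u z) ->
  (\int[(mu \x mu)%E]_z (u z)%:E = double_integral u)%E.
Proof.
move=> mu' u0.
have mU : measurable_fun [set: R * R] (EFin \o u) by exact/measurable_EFinP.
by apply: (@fubini_tonelli1 _ _ _ _ R mu mu _ mU) => z; rewrite lee_fin.
Qed.

(** 2 f(x) f(y) = f(x)^2 + f(y)^2 - (f(x) - f(y))^2, and the kernel has mass pi in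
either variable. *)
Lemma poisson_form_energy e : 0 < e ->
  ((2 * \int[mu]_x (f x * \int[mu]_y (f y * poisson_kernel e (x - y))))%:E + energy e f
   = (2 * pi)%:E * \int[mu]_x (f x ^+ 2)%:E)%E.
Proof.
move=> e0.
have k0 t : 0 <= poisson_kernel e t by rewrite poisson_kernel_ge0// ltW.
have mk := measurable_poisson_kernel_sub e0.
have mA : measurable_fun [set: R * R] (A e).
  by apply: measurable_funM => //; exact: measurable_funM.
have iQ : (mu \x mu)%E.-integrable setT (EFin \o Q e).
  apply/integrableP; split; first by apply/measurable_EFinP; exact: mQ.
  under eq_integral do rewrite /= ger0_norm ?Q0//.
  rewrite prodE ?double_integralQ//; [|exact: mQ|by move=> z; exact: Q0].
  by rewrite lte_mul_pinfty// lee_fin mulr_ge0// pi_ge0.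
have iA : (mu \x mu)%E.-integrable setT (EFin \o A e).
  apply: (le_integrable measurableT _ _ iQ); first exact/measurable_EFinP.
  move=> z _; rewrite /= lee_fin [leRHS]ger0_norm ?Q0// /A /Q normrM.
  rewrite (ger0_norm (k0 _)) ler_wpM2r// normrM.
  rewrite -[f z.1 ^+ 2]real_normK ?num_real// -[f z.2 ^+ 2]real_normK ?num_real//.
  have := sqr_ge0 (`|f z.1| - `|f z.2|); rewrite sqrrB.
  have : 0 <= `|f z.1| * `|f z.2| by rewrite mulr_ge0.
  lra.
have QE z : Q e z = 2 * A e z + E e z by rewrite /Q /A /E; ring.
have i2A : (mu \x mu)%E.-integrable setT (fun z => (2 * A e z)%:E).
  by have := integrableZl measurableT 2 iA; apply: eq_integrable.
have iE : (mu \x mu)%E.-integrable setT (EFin \o E e).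
  have := integrableB measurableT iQ i2A; apply: eq_integrable => // z _.
  by rewrite /= -EFinB QE addrAC subrr add0r.
rewrite -(double_integralQ e0) -prodE; [|exact: mQ|by move=> z; exact: Q0].
under eq_integral do rewrite QE EFinD.
rewrite integralD//= (prodE (mE e0) (fun z => E0 z e0)).
congr (_ + _)%E.
transitivity (\int[(mu \x mu)%E]_z (2 * A e z))%:E; last first.
  by rewrite /Rintegral fineK//; exact: (integrable_fin_num _ i2A).
congr _%:E; rewrite RintegralZl//; congr (2 * _).
rewrite -(@Rintegral12_prod _ _ _ _ R mu mu (fun x y => A e (x, y)))//.
apply: eq_Rintegral => x _; rewrite -RintegralZl//.
  by apply: eq_Rintegral => y _; rewrite /A/= mulrA.
apply: (@integrableM_bounded _ _ _ mu f (fun y => poisson_kernel e (x - y)) e^-1) => //.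
  exact: (measurableT_comp mk (pair1_measurable x)).
move=> y; rewrite ger0_norm//.
rewrite /poisson_kernel ler_pdivrMr ?poisson_kernel_den_gt0// mulrDr expr2 mulKf ?gt_eqF//.
by rewrite lerDl mulr_ge0 ?sqr_ge0// invr_ge0 ltW.
Qed.

(** As e decreases to 0 the weight increases to 1 on the half-line, so the weighted
integrals converge by monotone convergence, while the energy vanishes. *)
Lemma plancherel_halfline :
  (\int[mu]_(p in `[0%R, +oo[) (C p ^+ 2 + S p ^+ 2)%:E =
   pi%:E * \int[mu]_x (f x ^+ 2)%:E)%E.
Proof.
have mC := measurable_cos_transform; have mS := measurable_sin_transform.
have mCS2 : measurable_fun setT (fun p => C p ^+ 2 + S p ^+ 2).
  by apply: measurable_funD; exact: measurable_funX.
have CS0 p : 0 <= C p ^+ 2 + S p ^+ 2 by rewrite addr_ge0 ?sqr_ge0.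
pose g n p := (exp_weight n.+1%:R^-1 p * (C p ^+ 2 + S p ^+ 2))%:E.
pose F2 := fine (\int[mu]_x (f x ^+ 2)%:E)%E.
have f2fin : (\int[mu]_x (f x ^+ 2)%:E)%E \is a fin_num.
  by rewrite ge0_fin_numE// integral_ge0// => x _; rewrite lee_fin sqr_ge0.
have f2E : (\int[mu]_x (f x ^+ 2)%:E)%E = F2%:E by rewrite fineK.
have n0 n : 0 < n.+1%:R^-1 :> R by rewrite invr_gt0.
have mg n : measurable_fun setT (g n).
  by apply/measurable_EFinP/measurable_funM => //; exact: measurable_exp_weight.
have g0 n p : (0 <= g n p)%E by rewrite lee_fin mulr_ge0// exp_weight_ge0.
have ig n : mu.-integrable setT (g n).
  apply: (integrableM_bounded (integrable_exp_weight (n0 n)) mCS2 (M := N ^+ 2 + N ^+ 2)).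
  move=> p; rewrite ger0_norm//.
  have N0 : 0 <= N by rewrite (le_trans _ (CN 0)).
  rewrite -[C p ^+ 2]real_normK ?num_real// -[S p ^+ 2]real_normK ?num_real//.
  by rewrite lerD// lerXn2r ?nnegrE.
have gn n : (\int[mu]_p g n p = (pi * F2)%:E - 2^-1%:E * energy n.+1%:R^-1 f)%E.
  have := poisson_form_energy (n0 n); rewrite -poisson_plancherel// f2E -EFinM.
  have -> : (\int[mu]_p g n p = (\int[mu]_p (exp_weight n.+1%:R^-1 p *
      (C p ^+ 2 + S p ^+ 2)))%:E)%E.
    by rewrite /Rintegral fineK//; exact: (integrable_fin_num _ (ig n)).
  case: (energy _ _) => [r| |]//=.
  rewrite -!EFinD => -[H]; congr _%:E; lra.
have cv1 : (fun n => \int[mu]_p g n p)%E @ \oo --> (pi * F2)%:E.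
  rewrite (_ : (fun n => _) = (fun n => (pi * F2)%:E - 2^-1%:E * energy n.+1%:R^-1 f)%E); last by apply/funext => n; exact: gn.
  rewrite -[X in _ --> X]sube0 -[X in (_ - X)%E](mule0 2^-1%:E).
  apply: cvgeB; [by rewrite mule0|exact: cvg_cst|].
  by apply: cvgeZl => //; exact: energy_cvg0.
have cv2 : (fun n => \int[mu]_p g n p)%E @ \oo -->
   (\int[mu]_(p in `[0%R, +oo[) (C p ^+ 2 + S p ^+ 2)%:E)%E.
  rewrite integral_mkcond (_ : (\int[mu]_p _)%E = (\int[mu]_p limn (g ^~ p))%E).
    apply: cvg_monotone_convergence => // p _ m n mn.
    rewrite lee_fin ler_wpM2r// /exp_weight indicE.
    have [p0|p0] := boolP (p \in _); last by rewrite !mulr0.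
    rewrite !mulr1 ler_expR lerN2 ler_wpM2r//.
      by move: p0; rewrite inE/= in_itv/= andbT.
    by rewrite lef_pV2 ?posrE// ler_nat.
  apply: eq_integral => p _; apply/esym/cvg_lim => //.
  rewrite patchE /g /exp_weight indicE; case: ifPn => _; last first.
    under eq_fun do rewrite mulr0 mul0r.
    exact: cvg_cst.
  under eq_fun do rewrite mulr1.
  apply: cvg_EFin; first exact: nearW.
  rewrite -[X in _ --> X]mul1r; apply: cvgMl.
  have H : (fun n => - (n.+1%:R^-1 * p)) @ \oo --> (0 : R).
    rewrite -[X in _ --> X]oppr0 -[X in - X](mul0r p).
    by apply: cvgN; apply: cvgMl; exact: cvg_harmonic.
  rewrite -[X in _ --> X]expR0.
  exact: (@cvg_comp _ _ _ (fun n => - (n.+1%:R^-1 * p)) expR _ _ _ H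
    (@continuous_expR R 0)).
by rewrite (cvg_unique _ cv2 cv1)// f2E -EFinM.
Qed.

End real_plancherel.

Section fold.
Context (R : realType).
Local Notation mu := (@lebesgue_measure R).
Local Open Scope ereal_scope.

Lemma ge0_integral_fold (g : R -> \bar R) : measurable_fun [set: R] g ->
  (forall x, 0 <= g x) ->
  \int[mu]_x g x = \int[mu]_(x in `[0%R, +oo[) (g x + g (- x)%R).
Proof.
move=> mg g0.
have mgN : measurable_fun [set: R] (fun x => g (- x)%R).
  exact: (measurableT_comp mg (@oppr_measurable R setT)).
rewrite -(setUv `[0%R, +oo[%classic) ge0_integral_setU//=; last 3 first.
- exact: measurableC.
- by rewrite setUv.
- exact/disj_setPCl.
rewrite ge0_integralD//; last 2 first.
- exact: measurable_funTS.
- exact: measurable_funTS.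
congr (_ + _).
rewrite setCitvr integral_itv_bndo_bndc; last exact: measurable_funTS.
rewrite [RHS]ge0_integration_by_substitution0//.
by apply: eq_integral => x _; rewrite opprK.
Qed.

End fold.

Section transform.
Context d (T : measurableType d) (R : realType) (m : {measure set T -> \bar R}).
Implicit Types (ph a b : T -> R).

(** The real part of \int (a + i b) e^(-i ph).  The imaginary part is
re_transform ph b (\- a), so real functions suffice to express transforms of
complex ones. *)
Definition re_transform ph a b : R := \int[m]_x (a x * cos (ph x) + b x * sin (ph x)).

Lemma RintegralN a : \int[m]_x (- a x) = - \int[m]_x a x.
Proof.
rewrite /Rintegral integralE [in RHS]integralE.
rewrite (_ : (fun x => (- a x)%:E)^\+%E = (fun x => (a x)%:E)^\-%E); last first.
  by apply/funext => x; rewrite funeposE funenegE EFinN.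
rewrite (_ : (fun x => (- a x)%:E)^\-%E = (fun x => (a x)%:E)^\+%E); last first.
  by apply/funext => x; rewrite funeposE funenegE EFinN oppeK.
have : (0 <= \int[m]_x (fun x => (a x)%:E)^\+ x)%E by exact: integral_ge0.
have : (0 <= \int[m]_x (fun x => (a x)%:E)^\- x)%E by exact: integral_ge0.
case: (\int[m]_x _)%E => [r| |]//; case: (\int[m]_x _)%E => [s| |]//= _ _;
  by rewrite ?oppr0// opprB.
Qed.

Lemma re_transformNN ph a b : re_transform ph (\- a) (\- b) = - re_transform ph a b.
Proof.
rewrite /re_transform -RintegralN; apply: eq_Rintegral => x _ /=.
by rewrite opprD !mulNr.
Qed.

Lemma re_transform_lin ph a b : m.-integrable setT (EFin \o a) ->
  m.-integrable setT (EFin \o b) -> measurable_fun setT ph ->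
  re_transform ph a b = \int[m]_x (a x * cos (ph x)) + \int[m]_x (b x * sin (ph x)).
Proof.
move=> ia ib mp.
have ic := integrableM_cos ia mp; have is_ := integrableM_sin ib mp.
have := Rintegral_lin2 1 1 ic is_; rewrite !mul1r => <-.
by apply: eq_Rintegral => x _; rewrite !mul1r.
Qed.

Lemma integrable_re_transform ph a b : m.-integrable setT (EFin \o a) ->
  m.-integrable setT (EFin \o b) -> measurable_fun setT ph ->
  m.-integrable setT (fun x => (a x * cos (ph x) + b x * sin (ph x))%:E).
Proof.
move=> ia ib mp.
have ic := integrableM_cos ia mp; have is_ := integrableM_sin ib mp.
by have := integrableD measurableT ic is_; apply: eq_integrable.
Qed.

Lemma integrableN_fun a : m.-integrable setT (EFin \o a) ->
  m.-integrable setT (EFin \o (\- a)).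
Proof. by move=> /integrableN; apply: eq_integrable. Qed.

End transform.

Section complex_plancherel.
Context (R : realType).
Local Notation mu := (@lebesgue_measure R).
Variables a b : R -> R.
Hypothesis ia : mu.-integrable setT (EFin \o a).
Hypothesis ib : mu.-integrable setT (EFin \o b).
Hypothesis a2 : (\int[mu]_x (a x ^+ 2)%:E < +oo)%E.
Hypothesis b2 : (\int[mu]_x (b x ^+ 2)%:E < +oo)%E.

(** The cosine transform is even and the sine transform odd, so that adding the values
at p and -p cancels the mixed terms and leaves the half-line identities of a and
of b. *)
Lemma plancherel1 :
  (\int[mu]_p ((re_transform mu ( *%R p) a b) ^+ 2 + (re_transform mu ( *%R p) b (\- a)) ^+ 2)%:E =
   (2 * pi)%:E * \int[mu]_x (a x ^+ 2 + b x ^+ 2)%:E)%E.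
Proof.
pose C (f : R -> R) p := \int[mu]_x (f x * cos (p * x)).
pose S (f : R -> R) p := \int[mu]_x (f x * sin (p * x)).
have mp p : measurable_fun setT ( *%R p : R -> R) by exact: measurable_funM.
have ma : measurable_fun setT a by apply/measurable_EFinP; exact: measurable_int ia.
have mb : measurable_fun setT b by apply/measurable_EFinP; exact: measurable_int ib.
have mCf f : mu.-integrable setT (EFin \o f) -> measurable_fun setT (C f).
  exact: measurable_cos_transform.
have mSf f : mu.-integrable setT (EFin \o f) -> measurable_fun setT (S f).
  exact: measurable_sin_transform.
have AE p : re_transform mu ( *%R p) a b = C a p + S b p by exact: re_transform_lin.
have BE p : re_transform mu ( *%R p) b (\- a) = C b p - S a p.
  rewrite re_transform_lin//; last exact: integrableN_fun.
  congr (_ + _); rewrite /S -RintegralN; apply: eq_Rintegral => x _ /=.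
  by rewrite mulNr.
have CN f p : C f (- p) = C f p.
  by apply: eq_Rintegral => x _; rewrite mulNr cosN.
have SN f p : S f (- p) = - S f p.
  by rewrite /S -RintegralN; apply: eq_Rintegral => x _; rewrite mulNr sinN mulrN.
under eq_integral do rewrite AE BE.
have mCa := mCf _ ia; have mCb := mCf _ ib; have mSa := mSf _ ia; have mSb := mSf _ ib.
have mg : measurable_fun setT (fun p => ((C a p + S b p) ^+ 2 + (C b p - S a p) ^+ 2)%:E).
  apply/measurable_EFinP; apply: measurable_funD; apply: measurable_funX.
    exact: measurable_funD.
  exact: measurable_funB.
rewrite [LHS]ge0_integral_fold//; last by move=> x; rewrite lee_fin addr_ge0 ?sqr_ge0.
have CS0 f p : (0 <= (C f p ^+ 2 + S f p ^+ 2)%:E)%E by rewrite lee_fin addr_ge0 ?sqr_ge0.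
have mCS f : mu.-integrable setT (EFin \o f) ->
    measurable_fun (`[0%R, +oo[%classic : set R) (fun p => (C f p ^+ 2 + S f p ^+ 2)%:E).
  move=> fi; apply: measurable_funTS; apply/measurable_EFinP; apply: measurable_funD;
    apply: measurable_funX; [exact: mCf|exact: mSf].
transitivity (\int[mu]_(p in `[0%R, +oo[) (2%:E * ((C a p ^+ 2 + S a p ^+ 2)%:E +
    (C b p ^+ 2 + S b p ^+ 2)%:E)))%E.
  apply: eq_integral => p _; rewrite !CN !SN -!EFinD -EFinM; congr _%:E; ring.
rewrite ge0_integralZl//; last 2 first.
- by apply: emeasurable_funD; exact: mCS.
- by move=> p _; exact: adde_ge0.
rewrite ge0_integralD//; [|exact: mCS|exact: mCS].
rewrite (plancherel_halfline ia a2) (plancherel_halfline ib b2).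
under [in RHS]eq_integral do rewrite EFinD.
rewrite [in RHS]ge0_integralD//; last 4 first.
- by move=> x _; rewrite lee_fin sqr_ge0.
- by apply/measurable_EFinP; exact: measurable_funX.
- by move=> x _; rewrite lee_fin sqr_ge0.
- by apply/measurable_EFinP; exact: measurable_funX.
have i20 (f : R -> R) : (0 <= \int[mu]_x (f x ^+ 2)%:E)%E.
  by apply: integral_ge0 => x _; rewrite lee_fin sqr_ge0.
by rewrite -ge0_muleDr// muleA.
Qed.

End complex_plancherel.

(** * The Plancherel identity in dimension n *)

Section dot.
Context (R : realType).

Lemma dot_cons n (p x : R) (q v : 'rV[R]_n) :
  dot (cons_rV (p, q)) (cons_rV (x, v)) = p * x + dot q v.
Proof.
have c0 (t : R) (w : 'rV[R]_n) : cons_rV (t, w) ord0 ord0 = t.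
  by have := cons_rVK (t, w) => -[].
have cS (t : R) (w : 'rV[R]_n) i : cons_rV (t, w) ord0 (lift ord0 i) = w ord0 i.
  by rewrite (_ : lift ord0 i = rshift 1 i); [rewrite [LHS]row_mxEr|exact/val_inj].
rewrite /dot big_ord_recl !c0; congr (_ + _).
by apply: eq_bigr => i _; rewrite !cS.
Qed.

Lemma measurable_dot n :
  measurable_fun [set: 'rV[R]_n * 'rV[R]_n] (fun z : 'rV[R]_n * 'rV[R]_n => dot z.1 z.2).
Proof.
apply: measurable_sum => i; apply: measurable_funM.
- exact: (measurableT_comp (measurable_coord i)).
- exact: (measurableT_comp (measurable_coord i)).
Qed.

End dot.

Section transform_measurable.
Context d1 d2 (T1 : measurableType d1) (T2 : measurableType d2) (R : realType).
Variables (m : {sigma_finite_measure set T2 -> \bar R}).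

Lemma measurable_re_transform (ph a b : T1 -> T2 -> R) :
  measurable_fun [set: T1 * T2] (fun z => ph z.1 z.2) ->
  measurable_fun [set: T1 * T2] (fun z => a z.1 z.2) ->
  measurable_fun [set: T1 * T2] (fun z => b z.1 z.2) ->
  measurable_fun [set: T1] (fun x => re_transform m (ph x) (a x) (b x)).
Proof.
move=> mph ma mb.
apply: (@measurable_fun_Rintegral2 _ _ _ _ R m
  (fun x y => a x y * cos (ph x y) + b x y * sin (ph x y))).
apply: measurable_funD; apply: measurable_funM => //.
  exact: measurable_cos_comp.
exact: measurable_sin_comp.
Qed.

End transform_measurable.

Section step.
Context (R : realType) (n : nat).
Local Notation lam := (@lebesgue_measure R).
Local Notation mu := (@borel_lebesgue R n).
Local Notation muS := (@borel_lebesgue R n.+1).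

Let mcons := @measurable_cons_rV R n.

Lemma ge0_integral_cons (f : 'rV[R]_n.+1 -> \bar R) :
  measurable_fun setT f -> (forall x, 0 <= f x)%E ->
  (\int[muS]_x f x = \int[lam]_x \int[mu]_v f (cons_rV (x, v)))%E.
Proof.
move=> mf f0.
transitivity (\int[(lam \x mu)%E]_z f (cons_rV z))%E.
  exact: (ge0_integral_pushforward mcons (lam \x mu)%E).
have mF : measurable_fun [set: R * 'rV[R]_n] (fun z => f (cons_rV z)).
  exact: (measurableT_comp mf mcons).
by have := @fubini_tonelli1 _ _ _ _ R lam mu _ mF; apply.
Qed.

End step.

Lemma measurable_re_transform_dot (R : realType) n (a b : 'rV[R]_n -> R) :
  measurable_fun setT a -> measurable_fun setT b ->
  measurable_fun setT (fun p => re_transform (@borel_lebesgue R n) (dot p) a b).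
Proof.
move=> ma mb.
apply: (@measurable_re_transform _ _ _ _ R _ (@dot R n) (fun=> a) (fun=> b)).
- exact: measurable_dot.
- exact: (measurableT_comp ma measurable_snd).
- exact: (measurableT_comp mb measurable_snd).
Qed.

Section ae.
Context d (T : measurableType d) (R : realType) (m : {measure set T -> \bar R}).

Lemma ae_eq_integral_when (P : T -> Prop) (f g : T -> \bar R) :
  measurable_fun setT f -> measurable_fun setT g ->
  {ae m, forall x, P x} -> (forall x, P x -> f x = g x) ->
  (\int[m]_x f x = \int[m]_x g x)%E.
Proof.
move=> mf mg Pm fg; apply: ae_eq_integral => //.
by apply: filterS Pm => x Px _; exact: fg.
Qed.

Lemma ae_both (P Q : T -> Prop) : {ae m, forall x, P x} -> {ae m, forall x, Q x} ->
  {ae m, forall x, P x /\ Q x}.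
Proof. exact: filterS2. Qed.

Lemma ae_imp (P Q : T -> Prop) : {ae m, forall x, P x} -> (forall x, P x -> Q x) ->
  {ae m, forall x, Q x}.
Proof. by move=> mP PQ; apply: filterS mP. Qed.

End ae.

Section cons_integral.
Context (R : realType) (n : nat).
Local Notation lam := (@lebesgue_measure R).
Local Notation mu := (@borel_lebesgue R n).
Local Notation muS := (@borel_lebesgue R n.+1).

Lemma integrable_cons (f : 'rV[R]_n.+1 -> R) :
  muS.-integrable setT (EFin \o f) ->
  (lam \x mu)%E.-integrable setT (fun z => (f (cons_rV (z.1, z.2)))%:E).
Proof.
move=> fi; have mf : measurable_fun setT f.
  by apply/measurable_EFinP; exact: measurable_int fi.
have mfc : measurable_fun [set: R * 'rV[R]_n] (fun z => f (cons_rV (z.1, z.2))).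
  rewrite (_ : (fun z => _) = f \o (@cons_rV R n)); last first.
    by apply/funext => -[].
  exact: (measurableT_comp mf (@measurable_cons_rV R n)).
apply/integrable12ltyP; first exact/measurable_EFinP.
move/integrableP: fi => [_].
rewrite ge0_integral_cons//; first by move/measurable_EFinP : mf; exact: measurableT_comp.
Qed.

Lemma Rintegral_cons (f : 'rV[R]_n.+1 -> R) :
  muS.-integrable setT (EFin \o f) ->
  \int[muS]_x f x = \int[lam]_x \int[mu]_v f (cons_rV (x, v)).
Proof.
move=> fi; have ic := integrable_cons fi.
rewrite (@Rintegral12_prod _ _ _ _ R lam mu (fun x v => f (cons_rV (x, v))) ic).
rewrite /Rintegral; congr fine.
have mf : measurable_fun setT (EFin \o f) by exact: measurable_int fi.
transitivity (\int[(lam \x mu)%E]_z (EFin \o f \o (@cons_rV R n)) z)%E.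
  have := @integral_pushforward _ _ _ _ R _ (@measurable_cons_rV R n) (lam \x mu)%E setT _ mf.
  apply => //.
by apply: eq_integral => -[].
Qed.

End cons_integral.

Section plancherel_step.
Context (R : realType) (n : nat).
Local Notation lam := (@lebesgue_measure R).
Local Notation mu := (@borel_lebesgue R n).
Local Notation muS := (@borel_lebesgue R n.+1).

Definition slice (a : 'rV[R]_n.+1 -> R) (x : R) (v : 'rV[R]_n) : R := a (cons_rV (x, v)).

(** The real part of the transform of a + i b in all variables but the first, at
frequency q. *)
Definition partial_transform a b (x : R) (q : 'rV[R]_n) : R :=
  re_transform mu (dot q) (slice a x) (slice b x).

Lemma measurable_slice a : measurable_fun setT a ->
  measurable_fun [set: R * 'rV[R]_n] (fun z => slice a z.1 z.2).
Proof.
move=> ma; rewrite (_ : (fun z => _) = a \o (@cons_rV R n)); last first.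
  by apply/funext => -[].
exact: (measurableT_comp ma (@measurable_cons_rV R n)).
Qed.

Lemma measurable_partial_transform a b : measurable_fun setT a -> measurable_fun setT b ->
  measurable_fun [set: R * 'rV[R]_n] (fun z => partial_transform a b z.1 z.2).
Proof.
move=> ma mb.
have ms c : measurable_fun setT c ->
  measurable_fun [set: R * 'rV[R]_n * 'rV[R]_n] (fun z => slice c z.1.1 z.2).
  move=> mc; have := measurable_slice mc => msc.
  have := measurableT_comp msc (measurable_fun_pair (measurableT_comp measurable_fst measurable_fst) measurable_snd).
  exact.
apply: (@measurable_re_transform _ _ _ _ R mu (fun z => dot z.2) (fun z => slice a z.1) (fun z => slice b z.1)).
- have := measurableT_comp (@measurable_dot R n) (measurable_fun_pair (measurableT_comp measurable_snd measurable_fst) measurable_snd).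
  exact.
- exact: ms.
- exact: ms.
Qed.

Lemma measurable_dotr m (q : 'rV[R]_m) : measurable_fun setT (dot q).
Proof. exact: (measurableT_comp (@measurable_dot R m) (pair1_measurable q)). Qed.

Section ab.
Variables a b : 'rV[R]_n.+1 -> R.
Hypothesis ia : muS.-integrable setT (EFin \o a).
Hypothesis ib : muS.-integrable setT (EFin \o b).

Let ma : measurable_fun setT a.
Proof. by apply/measurable_EFinP; exact: measurable_int ia. Qed.
Let mb : measurable_fun setT b.
Proof. by apply/measurable_EFinP; exact: measurable_int ib. Qed.

Lemma ae_integrable_slices : {ae lam, forall x,
  mu.-integrable setT (EFin \o slice a x) /\ mu.-integrable setT (EFin \o slice b x)}.
Proof.
exact: ae_both (ae_integrable1 (integrable_cons ia)) (ae_integrable1 (integrable_cons ib)).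
Qed.

(** For every q, not just almost every: the modulus of the partial transform is
bounded by an integral in v of an integrable function, as |cos|, |sin| <= 1. *)
Lemma integrable_partial_transform q : lam.-integrable setT (EFin \o (partial_transform a b ^~ q)).
Proof.
pose F (x : R) (v : 'rV[R]_n) := slice a x v * cos (dot q v) + slice b x v * sin (dot q v).
have iF : (lam \x mu)%E.-integrable setT (fun z => (F z.1 z.2)%:E).
  apply: (@integrable_re_transform _ _ _ (lam \x mu)%E (fun z => dot q z.2) (fun z => slice a z.1 z.2) (fun z => slice b z.1 z.2)).
  - exact: integrable_cons.
  - exact: integrable_cons.
  - exact: (measurableT_comp (measurable_dotr q) measurable_snd).
have := integrable_fubini_F iF; apply: le_integrable => //.
  apply/measurable_EFinP.
  exact: (measurableT_comp (measurable_partial_transform ma mb) (pair2_measurable q)).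
move=> x _; rewrite /= /fubini_F /partial_transform /re_transform /Rintegral /F/=.
by case: (\int[_]_(x in _) _)%E => [r| |]//=; rewrite normr0 leey.
Qed.

(** e^(-i (p, q).(x, v)) = e^(-i p x) e^(-i q.v), in real and imaginary parts: the
full transform is the transform in the first variable of the partial one. *)
Lemma re_transform_cons p q : re_transform muS (dot (cons_rV (p, q))) a b =
  re_transform lam ( *%R p) (partial_transform a b ^~ q) (partial_transform b (\- a) ^~ q).
Proof.
rewrite /re_transform Rintegral_cons; last first.
  by apply: integrable_re_transform => //; exact: measurable_dotr.
rewrite /Rintegral; congr fine.
apply: (ae_eq_integral_when _ _ ae_integrable_slices).
- apply/measurable_EFinP.
  apply: (@measurable_fun_Rintegral2 _ _ _ _ R mu (fun x v =>
    slice a x v * cos (dot (cons_rV (p, q)) (cons_rV (x, v))) +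
    slice b x v * sin (dot (cons_rV (p, q)) (cons_rV (x, v))))).
  have md := measurable_slice (measurable_dotr (cons_rV (p, q))).
  by apply: measurable_funD; apply: measurable_funM;
    [exact: measurable_slice|exact: measurable_cos_comp|exact: measurable_slice|
     exact: measurable_sin_comp].
- apply/measurable_EFinP.
  have mpq a' b' : measurable_fun setT a' -> measurable_fun setT b' ->
      measurable_fun setT (partial_transform a' b' ^~ q).
    move=> ma' mb'.
    exact: (measurableT_comp (measurable_partial_transform ma' mb') (pair2_measurable q)).
  have mna : measurable_fun setT (\- a) by exact: measurable_funN.
  apply: measurable_funD; apply: measurable_funM.
  + exact: mpq.
  + by apply: measurable_cos_comp; exact: measurable_funM.
  + exact: mpq.
  + by apply: measurable_sin_comp; exact: measurable_funM.
- move=> x [iax ibx]; congr _%:E.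
  have md := measurable_dotr q.
  have i1 := integrable_re_transform iax ibx md.
  have i2 := integrable_re_transform ibx (integrableN_fun iax) md.
  rewrite /partial_transform /re_transform mulrC [X in _ + X]mulrC -Rintegral_lin2//.
  by apply: eq_Rintegral => v _; rewrite dot_cons cosD sinD /slice/=; ring.
Qed.

End ab.
End plancherel_step.

Section ae_finite.
Context d (T : measurableType d) (R : realType) (m : {measure set T -> \bar R}).

Lemma ge0_integral_ae_lty (f : T -> \bar R) : measurable_fun setT f ->
  (forall x, 0 <= f x)%E -> (\int[m]_x f x < +oo)%E ->
  {ae m, forall x, (f x < +oo)%E}.
Proof.
move=> mf f0 foo; have fi : m.-integrable setT f.
  by apply/integrableP; split => //; under eq_integral do rewrite gee0_abs//.
have := integrable_ae measurableT fi; apply: filterS => x /(_ I).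
by rewrite ge0_fin_numE.
Qed.

Lemma ge0_integral_sum2 (f g : T -> R) : measurable_fun setT f -> measurable_fun setT g ->
  (\int[m]_x (f x ^+ 2 + g x ^+ 2)%:E =
   \int[m]_x (f x ^+ 2)%:E + \int[m]_x (g x ^+ 2)%:E)%E.
Proof.
move=> mf mg; under eq_integral do rewrite EFinD.
rewrite ge0_integralD//.
- by move=> x _; rewrite lee_fin sqr_ge0.
- by apply/measurable_EFinP; exact: measurable_funX.
- by move=> x _; rewrite lee_fin sqr_ge0.
- by apply/measurable_EFinP; exact: measurable_funX.
Qed.

Lemma ge0_sqr_sum2_lty (f g : T -> R) : measurable_fun setT f -> measurable_fun setT g ->
  (\int[m]_x (f x ^+ 2 + g x ^+ 2)%:E < +oo)%E ->
  (\int[m]_x (f x ^+ 2)%:E < +oo)%E /\ (\int[m]_x (g x ^+ 2)%:E < +oo)%E.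
Proof.
move=> mf mg fgoo; have i0 (h : T -> R) : (0 <= \int[m]_x (h x ^+ 2)%:E)%E.
  by apply: integral_ge0 => x _; rewrite lee_fin sqr_ge0.
move: fgoo; rewrite ge0_integral_sum2// => fgoo; split; apply: le_lt_trans fgoo.
  by rewrite leeDl.
by rewrite leeDr.
Qed.

End ae_finite.

Section plancherel.
Context (R : realType).
Local Notation lam := (@lebesgue_measure R).
Local Notation mu := (@borel_lebesgue R).

(** The transform carries no normalizing constant here, whence the factor
(2 pi)^n. *)
Definition plancherel_at n := forall a b : 'rV[R]_n -> R,
  (mu n).-integrable setT (EFin \o a) -> (mu n).-integrable setT (EFin \o b) ->
  (\int[mu n]_x (a x ^+ 2)%:E < +oo)%E -> (\int[mu n]_x (b x ^+ 2)%:E < +oo)%E ->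
  (\int[mu n]_q (re_transform (mu n) (dot q) a b ^+ 2 + re_transform (mu n) (dot q) b (\- a) ^+ 2)%:E =
   ((2 * pi) ^+ n)%:E * \int[mu n]_x (a x ^+ 2 + b x ^+ 2)%:E)%E.

(** R^0 is a point of mass 1 and the transform is the identity. *)
Lemma plancherel0 : plancherel_at 0.
Proof.
move=> a b ia ib a2 b2.
have dot0 (q v : 'rV[R]_0) : dot q v = 0 by rewrite /dot big_ord0.
have ma : measurable_fun setT a by apply/measurable_EFinP; exact: measurable_int ia.
have mb : measurable_fun setT b by apply/measurable_EFinP; exact: measurable_int ib.
have ftE (f g : 'rV[R]_0 -> R) q : measurable_fun setT f -> re_transform (mu 0) (dot q) f g = f 0.
  move=> mf; rewrite /re_transform.
  transitivity (\int[\d_(0 : 'rV[R]_0)]_x f x).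
    by apply: eq_Rintegral => x _; rewrite dot0 cos0 sin0 mulr1 mulr0 addr0.
  rewrite /Rintegral integral_dirac//; last exact/measurable_EFinP.
  by rewrite diracT mul1e.
rewrite expr0 mul1e; apply: eq_integral => q _.
rewrite !ftE//; congr (_%:E); congr (a _ ^+ 2 + b _ ^+ 2).
  by apply/rowP => -[].
by apply/rowP => -[].
Qed.

(** The induction hypothesis applies to almost every slice and gives the identity for
the partial transform, in the variables (x, q).  Exchanging the order of
integration, the identity on the line then applies, for almost every q, to the
partial transform as a function of x. *)
Lemma plancherelS n : plancherel_at n -> plancherel_at n.+1.
Proof.
move=> IH a b ia ib a2 b2.
have ma : measurable_fun setT a by apply/measurable_EFinP; exact: measurable_int ia.
have mb : measurable_fun setT b by apply/measurable_EFinP; exact: measurable_int ib.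
have mna : measurable_fun setT (\- a) by exact: measurable_funN.
have ina := integrableN_fun ia.
pose w1 := partial_transform a b; pose w2 := partial_transform b (\- a).
have mw1 : measurable_fun [set: R * 'rV[R]_n] (fun z => w1 z.1 z.2) by exact: measurable_partial_transform.
have mw2 : measurable_fun [set: R * 'rV[R]_n] (fun z => w2 z.1 z.2) by exact: measurable_partial_transform.
pose W (z : R * 'rV[R]_n) := (w1 z.1 z.2 ^+ 2 + w2 z.1 z.2 ^+ 2)%:E.
have mW : measurable_fun [set: R * 'rV[R]_n] W.
  by apply/measurable_EFinP; apply: measurable_funD; exact: measurable_funX.
have W0 z : (0 <= W z)%E by rewrite lee_fin addr_ge0 ?sqr_ge0.
pose S (x : 'rV[R]_n.+1) := (a x ^+ 2 + b x ^+ 2)%:E.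
have mS : measurable_fun setT S.
  by apply/measurable_EFinP; apply: measurable_funD; exact: measurable_funX.
have S0 x : (0 <= S x)%E by rewrite lee_fin addr_ge0 ?sqr_ge0.
have Soo : (\int[mu n.+1]_x S x < +oo)%E.
  by rewrite /S ge0_integral_sum2// lte_add_pinfty.
have SE := ge0_integral_cons mS S0.
have mSc : measurable_fun [set: R * 'rV[R]_n] (fun z => S (cons_rV z)).
  exact: (measurableT_comp mS (@measurable_cons_rV R n)).
have mSx : measurable_fun setT (fun x : R => \int[mu n]_v S (cons_rV (x, v)))%E.
  by apply: (@measurable_fun_fubini_tonelli_F _ _ _ _ R (mu n) _ mSc).
(* Plancherel in the last n variables, for almost every slice, integrated over x. *)
have IHW : (\int[lam]_x \int[mu n]_q W (x, q) =
    ((2 * pi) ^+ n)%:E * \int[mu n.+1]_x S x)%E.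
  rewrite SE -[RHS]ge0_integralZl//; last 2 first.
  - by move=> x _; exact: integral_ge0.
  - by rewrite lee_fin exprn_ge0// mulr_ge0// pi_ge0.
  have Sae : {ae lam, forall x, (\int[mu n]_v S (cons_rV (x, v)) < +oo)%E}.
    apply: ge0_integral_ae_lty => //; first by move=> x; exact: integral_ge0.
    by rewrite -SE.
  apply: (ae_eq_integral_when _ _ (ae_both (ae_integrable_slices ia ib) Sae)).
  - by apply: (@measurable_fun_fubini_tonelli_F _ _ _ _ R (mu n) _ mW).
  - exact: measurable_funeM.
  move=> x [[iax ibx] Sx].
  have [||a2x b2x] := ge0_sqr_sum2_lty _ _ Sx.
  - exact: (measurableT_comp (measurable_slice ma) (pair1_measurable x)).
  - exact: (measurableT_comp (measurable_slice mb) (pair1_measurable x)).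
  exact: IH iax ibx a2x b2x.
have Woo : (\int[lam]_x \int[mu n]_q W (x, q) < +oo)%E.
  by rewrite IHW lte_mul_pinfty// lee_fin exprn_ge0// mulr_ge0// pi_ge0.
have Wswap : (\int[lam]_x \int[mu n]_q W (x, q) = \int[mu n]_q \int[lam]_x W (x, q))%E.
  exact: (@fubini_tonelli _ _ _ _ R lam (mu n) _ mW W0).
pose G (r : 'rV[R]_n.+1) := (re_transform (mu n.+1) (dot r) a b ^+ 2 + re_transform (mu n.+1) (dot r) b (\- a) ^+ 2)%:E.
have mG : measurable_fun setT G.
  by apply/measurable_EFinP; apply: measurable_funD; apply: measurable_funX;
    exact: measurable_re_transform_dot.
have G0 r : (0 <= G r)%E by rewrite lee_fin addr_ge0 ?sqr_ge0.
have mGc : measurable_fun [set: R * 'rV[R]_n] (fun z => G (cons_rV z)).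
  exact: (measurableT_comp mG (@measurable_cons_rV R n)).
transitivity (\int[mu n.+1]_r G r)%E; first by [].
rewrite (ge0_integral_cons mG G0).
rewrite (@fubini_tonelli _ _ _ _ R lam (mu n) _ mGc (fun z => G0 _)).
have mWG : measurable_fun setT (fun q => \int[lam]_x W (x, q))%E.
  by apply: (@measurable_fun_fubini_tonelli_G _ _ _ _ R lam _ mW).
have Wae : {ae mu n, forall q, (\int[lam]_x W (x, q) < +oo)%E}.
  apply: ge0_integral_ae_lty => //; last by rewrite -Wswap.
  by move=> q; exact: integral_ge0.
transitivity (\int[mu n]_q ((2 * pi)%:E * \int[lam]_x W (x, q)))%E.
  apply: (ae_eq_integral_when _ _ Wae).
  - by apply: (@measurable_fun_fubini_tonelli_G _ _ _ _ R lam _ mGc).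
  - exact: measurable_funeM.
  move=> q Wq.
  have iw1 : lam.-integrable setT (EFin \o (w1 ^~ q)) by exact: integrable_partial_transform.
  have iw2 : lam.-integrable setT (EFin \o (w2 ^~ q)) by exact: integrable_partial_transform.
  have [||w12 w22] := ge0_sqr_sum2_lty _ _ Wq.
  - exact: (measurableT_comp mw1 (pair2_measurable q)).
  - exact: (measurableT_comp mw2 (pair2_measurable q)).
  rewrite /W/= -(plancherel1 iw1 iw2 w12 w22).
  apply: eq_integral => p _; rewrite /G !re_transform_cons//.
  have -> : partial_transform (\- a) (\- b) ^~ q = \- (w1 ^~ q).
    by apply/funext => x; rewrite /partial_transform re_transformNN.
  by [].
rewrite ge0_integralZl//; last 2 first.
- by move=> q _; exact: integral_ge0.
- by rewrite lee_fin mulr_ge0// pi_ge0.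
by rewrite -Wswap IHW muleA -EFinM exprS.
Qed.

Lemma plancherel n : plancherel_at n.
Proof. by elim: n => [|n IH]; [exact: plancherel0|exact: plancherelS]. Qed.

End plancherel.

(** * Borel versions of Lebesgue measurable functions *)

Section completion.
Context d (T : measurableType d) (R : realType).
Variable mu : {sigma_finite_measure set T -> \bar R}.
Local Notation L := (caratheodory_type (mu_ext mu)).
Local Notation leb := (@completed_measure_extension _ T R mu).
Local Open Scope ereal_scope.

Lemma measurable_completion (A : set T) : measurable A -> measurable (A : set L).
Proof. exact: caratheodory_measurable_mu_ext. Qed.

Lemma completionE (A : set T) : measurable A -> leb A = mu A.
Proof. exact: measurable_mu_extE. Qed.

(** More sets are measurable for the completion, so more functions are. *)
Lemma measurable_fun_completion d' (Y : measurableType d') (f : T -> Y) :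
  measurable_fun [set: T] f -> measurable_fun [set: L] f.
Proof.
by move=> mf _ B mB; rewrite setTI; apply: measurable_completion; rewrite -[X in measurable X]setTI; exact: mf.
Qed.

(** The measure is the push-forward of its completion under the identity map. *)
Lemma ge0_integral_completion (f : T -> \bar R) : measurable_fun [set: T] f ->
  (forall x, 0 <= f x) -> \int[leb]_x f x = \int[mu]_x f x.
Proof.
move=> mf f0.
have mid : measurable_fun [set: L] (id : L -> T).
  exact: (@measurable_fun_completion _ T id (@measurable_id _ T setT)).
transitivity (\int[pushforward leb (id : L -> T)]_x f x).
  by rewrite (ge0_integral_pushforward mid).
apply: eq_measure_integral => A mA _; exact: completionE.
Qed.

Lemma integral_completion (f : T -> \bar R) : measurable_fun [set: T] f ->
  \int[leb]_x f x = \int[mu]_x f x.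
Proof.
move=> mf; rewrite integralE [RHS]integralE; congr (_ - _).
  by apply: ge0_integral_completion => //; exact: measurable_funepos.
by apply: ge0_integral_completion => //; exact: measurable_funeneg.
Qed.

(** The intersection of countable covers whose total measure exceeds the outer
measure by less than 1/(n+1). *)
Lemma measurable_hull (X : set T) : exists B : set T,
  [/\ measurable B, X `<=` B & mu B = mu_ext mu X].
Proof.
have [Xoo|Xfin] := eqVneq (mu_ext mu X) +oo.
  exists setT; split => //; rewrite Xoo; apply/eqP; rewrite -leye_eq -Xoo.
  rewrite -(measurable_mu_extE mu measurableT).
  by apply: le_mu_ext.
have {}Xfin : mu_ext mu X \is a fin_num.
  by rewrite ge0_fin_numE ?ltey// mu_ext_ge0.
have H n : exists A : (set T)^nat, measurable_cover X A /\
    \sum_(k <oo) mu (A k) < mu_ext mu X + n.+1%:R^-1%:E.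
  have n0 : (0 < n.+1%:R^-1 :> R)%R by rewrite invr_gt0.
  by have [_ [A XA <-] ?] := lb_ereal_inf_adherent n0 Xfin; exists A.
pose A n := sval (cid (H n)).
have cA n : measurable_cover X (A n) by rewrite /A; case: cid => ? [].
have sA n : \sum_(k <oo) mu (A n k) < mu_ext mu X + n.+1%:R^-1%:E.
  by rewrite /A; case: cid => ? [].
pose F n := \bigcup_k A n k.
have mF n : measurable (F n) by apply: bigcupT_measurable => k; case: (cA n).
pose B := \bigcap_n F n.
have mB : measurable B by exact: bigcapT_measurable.
have XB : X `<=` B by apply: sub_bigcap => n _; case: (cA n).
exists B; split => //; apply/eqP; rewrite eq_le; apply/andP; split; last first.
  by rewrite -(measurable_mu_extE mu mB); apply: le_mu_ext.
apply/lee_addgt0Pr => _/posnumP[e]; near \oo => n.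
apply: (@le_trans _ _ (mu (F n))).
  by apply: le_measure; rewrite ?inE//; exact: bigcap_inf.
apply: (@le_trans _ _ (\sum_(k <oo) mu (A n k))).
  by apply: measure_sigma_subadditive => // k; case: (cA n).
rewrite (le_trans (ltW (sA n)))// leeD// lee_fin ltW//.
by near: n; apply: near_infty_natSinv_lt.
Unshelve. all: by end_near. Qed.

Lemma completion_null (X : set T) : mu_ext mu X = 0 ->
  exists N : set T, [/\ measurable N, mu N = 0 & X `<=` N].
Proof. by move=> X0; have [B [mB XB BX]] := measurable_hull X; exists B; rewrite BX. Qed.

(** On a piece S n of finite measure, a measurable hull of A exceeds A by a set of
outer measure 0, itself contained in a measurable null set; the pieces are
countably many. *)
Lemma completion_approx (A : set L) : measurable A ->
  exists B N : set T, [/\ measurable B, measurable N, mu N = 0 & A `\` N = B `\` N].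
Proof.
move=> mA; have /sigma_finiteP[S [ST ndS Soo]] := sigma_finiteT mu.
have H n : exists BN : set T * set T,
  [/\ measurable BN.1, measurable BN.2, mu BN.2 = 0 & (A `&` S n) `\` BN.2 = BN.1 `\` BN.2].
  have [mS Sn] := Soo n.
  have mAS : measurable (A `&` S n : set L).
    by apply: measurableI => //; exact: measurable_completion.
  have [B [mB ASB BAS]] := measurable_hull (A `&` S n).
  have [N [mN N0 BN]] : exists N : set T, [/\ measurable N, mu N = 0 & B `\` (A `&` S n) `<=` N].
    apply: completion_null.
    have mBL := measurable_completion mB.
    have ASfin : leb (A `&` S n) < +oo.
      apply: (@le_lt_trans _ _ (leb (S n))); last by rewrite completionE.
      by apply: le_measure; rewrite ?inE//; exact: measurable_completion.
    have BE : leb B = leb (A `&` S n) by rewrite completionE.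
    have Bfin : leb B < +oo by rewrite BE.
    have -> : mu_ext mu (B `\` (A `&` S n)) = leb B - leb (B `&` (A `&` S n)).
      exact: (measureD mBL mAS Bfin).
    rewrite (setIidr ASB) -BE subee// ge0_fin_numE//.
  exists (B, N); split => //=.
  apply/seteqP; split => x [].
    by move=> ASx Nx; split => //; exact: ASB.
  move=> Bx Nx; split => //; apply: contrapT => ASx; exact/Nx/BN.
pose BN n := sval (cid (H n)).
have BNP n : [/\ measurable (BN n).1, measurable (BN n).2, mu (BN n).2 = 0 &
  (A `&` S n) `\` (BN n).2 = (BN n).1 `\` (BN n).2] by rewrite /BN; case: cid.
pose N := \bigcup_n (BN n).2.
have mN : measurable N by apply: bigcupT_measurable => n; case: (BNP n).
have N0 : mu N = 0.
  apply/eqP; rewrite eq_le measure_ge0 andbT.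
  apply: (@le_trans _ _ (\sum_(n <oo) mu (BN n).2)).
    by apply: measure_sigma_subadditive => // n; case: (BNP n).
  by rewrite eseries0// => n _ _; case: (BNP n).
exists (\bigcup_n (BN n).1), N; split => //.
  by apply: bigcupT_measurable => n; case: (BNP n).
apply/seteqP; split => x [].
  move=> Ax Nx; split => //.
  have [n _ Sx] : (\bigcup_n S n) x by rewrite -ST.
  have [_ _ _ E] := BNP n.
  have : ((A `&` S n) `\` (BN n).2) x by split => // Nnx; apply: Nx; exists n.
  by rewrite E => -[? _]; exists n.
move=> [n _ Bx] Nx; split => //.
have [_ _ _ E] := BNP n.
have : ((BN n).1 `\` (BN n).2) x by split => // Nnx; apply: Nx; exists n.
by rewrite -E => -[[]].
Qed.

(** Each level set {f > q} with q rational agrees with a measurable set off a null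
set.  Outside the union of these countably many null sets f is measurable, and g
is f set to 0 on that union. *)
Lemma completion_measurable_fun (f : T -> R) : measurable_fun [set: L] f ->
  exists (g : T -> R) (N : set T), [/\ measurable_fun [set: T] g, measurable N,
    mu N = 0 & forall x, ~ N x -> f x = g x].
Proof.
move=> mf; pose q n : R := ratr (odflt 0 (unpickle n : option rat))%R.
have H n : exists BN : set T * set T,
    [/\ measurable BN.1, measurable BN.2, mu BN.2 = 0 &
     (f @^-1` `]q n, +oo[) `\` BN.2 = BN.1 `\` BN.2].
  have [|B [N [? ? ? ?]]] := @completion_approx (f @^-1` `]q n, +oo[).
    by rewrite -[X in measurable X]setTI; exact: mf.
  by exists (B, N).
pose BN n := sval (cid (H n)).
have BNP n : [/\ measurable (BN n).1, measurable (BN n).2, mu (BN n).2 = 0 &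
     (f @^-1` `]q n, +oo[) `\` (BN n).2 = (BN n).1 `\` (BN n).2].
  by rewrite /BN; case: cid.
pose N := \bigcup_n (BN n).2.
have mN : measurable N by apply: bigcupT_measurable => n; case: (BNP n).
have N0 : mu N = 0.
  apply/eqP; rewrite eq_le measure_ge0 andbT.
  apply: (@le_trans _ _ (\sum_(n <oo) mu (BN n).2)).
    by apply: measure_sigma_subadditive => // n; case: (BNP n).
  by rewrite eseries0// => n _ _; case: (BNP n).
have BNE n x : ~ N x -> (q n < f x)%R <-> (BN n).1 x.
  move=> Nx; have [_ _ _ E] := BNP n.
  have Nnx : ~ (BN n).2 x by move=> ?; apply: Nx; exists n.
  split => h.
    have : ((f @^-1` `]q n, +oo[) `\` (BN n).2) x by split => //=; rewrite in_itv/= andbT.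
    by rewrite E => -[].
  have : ((BN n).1 `\` (BN n).2) x by [].
  by rewrite -E => -[/=]; rewrite in_itv/= andbT.
exists (fun x => f x * \1_(~` N) x)%R, N; split => //; last first.
  by move=> x Nx; rewrite indicE mem_set// mulr1.
apply: (measurability _ (RGenOInfty.measurableE R)) => //.
move=> /= _ [_ [x ->] <-]; rewrite setTI.
(* A value above x is separated from x by a rational; on N the function is 0,
   which exceeds x when x < 0. *)
rewrite (_ : _ @^-1` _ = (\bigcup_(n in [set n | x < q n]%R) ((BN n).1 `\` N))
  `|` (if (x < 0)%R then N else set0)); last first.
  apply/seteqP; split => y /=; rewrite in_itv/= andbT indicE.
    have [Ny|Ny] := pselect (N y).
      by rewrite memNset ?mulr0; [move=> ->; right|move=> /(_ Ny)].
    rewrite mem_set// mulr1 => /rat_in_itvoo[r]; rewrite in_itv/= => /andP[xr ry].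
    have qr : q (pickle r) = ratr r by rewrite /q pickleK.
    by left; exists (pickle r); rewrite /= ?qr//; split => //; apply/BNE => //; rewrite qr.
  move=> [[n /= xq [By Ny]]|].
    by rewrite mem_set// mulr1 (lt_trans xq)//; apply/BNE.
  by case: ifPn => // x0 Ny; rewrite memNset ?mulr0// => /(_ Ny).
apply: measurableU; last by case: ifP.
by apply: bigcup_measurable => n _; apply: measurableD => //; case: (BNP n).
Qed.

End completion.

(** * Complex square-integrable functions *)

Section complex_parts.
Context (R : realType).
Implicit Types z w : R[i].
Local Notation re := (@complex.Re R).
Local Notation im := (@complex.Im R).

Lemma re_add z w : re (z + w) = re z + re w. Proof. by case: z w => [? ?] [? ?]. Qed.
Lemma im_add z w : im (z + w) = im z + im w. Proof. by case: z w => [? ?] [? ?]. Qed.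
Lemma re_mul z w : re (z * w) = re z * re w - im z * im w.
Proof. by case: z w => [? ?] [? ?]. Qed.
Lemma im_mul z w : im (z * w) = re z * im w + im z * re w.
Proof. by case: z w => [? ?] [? ?]. Qed.
Lemma re_conj z : re (z^*%C) = re z. Proof. by case: z. Qed.
Lemma im_conj z : im (z^*%C) = - im z. Proof. by case: z. Qed.

Lemma complex_eq z w : re z = re w -> im z = im w -> z = w.
Proof. by case: z w => [? ?] [? ?] /= -> ->. Qed.

Lemma sqnormcM z w : sqnormc (z * w) = sqnormc z * sqnormc w.
Proof. by rewrite /sqnormc re_mul im_mul; ring. Qed.

Lemma sqnormc_ge0 z : 0 <= sqnormc z.
Proof. by rewrite addr_ge0 ?sqr_ge0. Qed.

Lemma sqnormcD_le z w : sqnormc (z + w) <= 2 * sqnormc z + 2 * sqnormc w.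
Proof.
rewrite /sqnormc re_add im_add -subr_ge0.
rewrite [X in 0 <= X](_ : _ = (re z - re w) ^+ 2 + (im z - im w) ^+ 2); last by ring.
by rewrite addr_ge0 ?sqr_ge0.
Qed.

Lemma mul_conj_sqnormc z : z^*%C * z = (sqnormc z)%:C%C.
Proof.
apply: complex_eq; first by rewrite re_mul re_conj im_conj /sqnormc/=; ring.
by rewrite im_mul re_conj im_conj/=; ring.
Qed.

Lemma sqnormc_eq0 z : sqnormc z = 0 -> z = 0.
Proof.
move=> z0; have re2 := sqr_ge0 (re z); have im2 := sqr_ge0 (im z).
apply: complex_eq => /=; apply/eqP; rewrite -sqrf_eq0; apply/eqP;
  move: z0; rewrite /sqnormc; lra.
Qed.

Lemma normr_sum2_le (a b c e : R) :
  `|a * b + c * e| <= (a ^+ 2 + c ^+ 2) + (b ^+ 2 + e ^+ 2).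
Proof.
have h1 := sqr_ge0 (a + b); have h2 := sqr_ge0 (a - b).
have h3 := sqr_ge0 (c + e); have h4 := sqr_ge0 (c - e).
have h5 := sqr_ge0 a; have h6 := sqr_ge0 b; have h7 := sqr_ge0 c; have h8 := sqr_ge0 e.
by rewrite ler_norml; apply/andP; split; nra.
Qed.

Lemma re_conjM_le z w : `|re (z^*%C * w)| <= sqnormc z + sqnormc w.
Proof. by rewrite re_mul re_conj im_conj mulNr opprK; exact: normr_sum2_le. Qed.

Lemma im_conjM_le z w : `|im (z^*%C * w)| <= sqnormc z + sqnormc w.
Proof.
rewrite im_mul re_conj im_conj.
have := normr_sum2_le (re z) (im w) (- im z) (re w).
by rewrite sqrrN [X in _ <= _ + X]addrC.
Qed.

End complex_parts.

Section complex_valued.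
Context disp (T : measurableType disp) (R : realType) (m : {measure set T -> \bar R}).
Local Notation re := (@complex.Re R).
Local Notation im := (@complex.Im R).
Implicit Types (f g u v w : T -> R[i]).

Definition complex_integral f : R[i] :=
  ((\int[m]_x re (f x)) +i* (\int[m]_x im (f x)))%C.

Definition complex_measurable f :=
  measurable_fun [set: T] (fun x => re (f x)) /\
  measurable_fun [set: T] (fun x => im (f x)).

(** On the completed Lebesgue measure this is [square_integrable], as
[complex_integral] is [cintegral] and [L2inner] is [inner]; the algebra of L^2
is the same on any measure space. *)
Definition sq_integrable u :=
  complex_measurable u /\ (\int[m]_x (sqnormc (u x))%:E < +oo)%E.

Definition L2inner u v : R[i] := complex_integral (fun x => (u x)^*%C * v x).

Definition complex_integrable f :=
  m.-integrable setT (fun x => (re (f x))%:E) /\ m.-integrable setT (fun x => (im (f x))%:E).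

Lemma complex_integral_lin (a : R[i]) f g : complex_integrable f -> complex_integrable g ->
  complex_integral (fun x => a * f x + g x) = a * complex_integral f + complex_integral g.
Proof.
move=> [fr fi] [gr gi].
have ilin (s t : R) (h k : T -> R) : m.-integrable setT (EFin \o h) ->
    m.-integrable setT (EFin \o k) ->
    m.-integrable setT (EFin \o (fun x => s * h x + t * k x)).
  move=> ih ik.
  have := integrableD measurableT (integrableZl measurableT s ih) (integrableZl measurableT t ik).
  exact: eq_integrable.
rewrite /complex_integral; apply: complex_eq.
- rewrite re_add re_mul/=.
  have := Rintegral_lin2 1 1 (ilin (re a) (- im a) _ _ fr fi) gr.
  rewrite [X in _ = 1 * X + _](@Rintegral_lin2 _ _ _ m
    (fun x => re (f x)) (fun x => im (f x)))// !mul1r mulNr => <-.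
  by apply: eq_Rintegral => x _; rewrite re_add re_mul; ring.
- rewrite im_add im_mul/=.
  have := Rintegral_lin2 1 1 (ilin (re a) (im a) _ _ fi fr) gi.
  rewrite [X in _ = 1 * X + _](@Rintegral_lin2 _ _ _ m
    (fun x => im (f x)) (fun x => re (f x)))// !mul1r => <-.
  by apply: eq_Rintegral => x _; rewrite im_add im_mul; ring.
Qed.

Lemma complex_integral_conj f : complex_integral (fun x => (f x)^*%C) = (complex_integral f)^*%C.
Proof.
apply: complex_eq; rewrite /complex_integral/=.
  by apply: eq_Rintegral => x _; rewrite re_conj.
by rewrite -RintegralN; apply: eq_Rintegral => x _; rewrite im_conj.
Qed.

Lemma measurable_sqnormc u : complex_measurable u ->
  measurable_fun [set: T] (fun x => sqnormc (u x)).
Proof. by move=> [mr mi]; apply: measurable_funD; exact: measurable_funX. Qed.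

Lemma complex_measurable_lin (a : R[i]) u v : complex_measurable u -> complex_measurable v ->
  complex_measurable (fun x => a * u x + v x).
Proof.
move=> [ur ui] [vr vi]; split.
- under eq_fun do rewrite re_add re_mul.
  by apply: measurable_funD => //; apply: measurable_funB; exact: measurable_funM.
- under eq_fun do rewrite im_add im_mul.
  by apply: measurable_funD => //; apply: measurable_funD; exact: measurable_funM.
Qed.

Lemma complex_measurable_conjM u v : complex_measurable u -> complex_measurable v ->
  complex_measurable (fun x => (u x)^*%C * v x).
Proof.
move=> [ur ui] [vr vi]; split.
- under eq_fun do rewrite re_mul re_conj im_conj mulNr opprK.
  by apply: measurable_funD; exact: measurable_funM.
- under eq_fun do rewrite im_mul re_conj im_conj mulNr.
  by apply: measurable_funB; exact: measurable_funM.
Qed.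

Lemma sq_integrable_lin (a : R[i]) u v : sq_integrable u -> sq_integrable v ->
  sq_integrable (fun x => a * u x + v x).
Proof.
move=> [mu' u2] [mv v2]; split; first exact: complex_measurable_lin.
have msu := measurable_sqnormc mu'; have msv := measurable_sqnormc mv.
have s0 (z : R[i]) : (0 <= (sqnormc z)%:E)%E by rewrite lee_fin sqnormc_ge0.
apply: (@le_lt_trans _ _ (\int[m]_x ((2 * sqnormc a)%:E * (sqnormc (u x))%:E +
  2%:E * (sqnormc (v x))%:E))%E).
  apply: ge0_le_integral => //.
  - by apply/measurable_EFinP; apply: measurable_sqnormc; exact: complex_measurable_lin.
  - by apply: emeasurable_funD; apply: measurable_funeM; exact/measurable_EFinP.
  - move=> x _; rewrite -!EFinM -EFinD lee_fin -mulrA -sqnormcM.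
    exact: sqnormcD_le.
have a20 : (0 <= (2 * sqnormc a)%:E)%E by rewrite lee_fin mulr_ge0// sqnormc_ge0.
rewrite ge0_integralD//; last 4 first.
- by move=> x _; exact: mule_ge0.
- by apply: measurable_funeM; exact/measurable_EFinP.
- by move=> x _; exact: mule_ge0.
- by apply: measurable_funeM; exact/measurable_EFinP.
rewrite ge0_integralZl//; last exact/measurable_EFinP.
rewrite ge0_integralZl//; last exact/measurable_EFinP.
by rewrite lte_add_pinfty// lte_mul_pinfty.
Qed.

Lemma integrable_sqnormc u : sq_integrable u -> m.-integrable setT (fun x => (sqnormc (u x))%:E).
Proof.
move=> [mu' u2]; apply/integrableP; split.
  by apply/measurable_EFinP; exact: measurable_sqnormc.
by under eq_integral do rewrite gee0_abs ?lee_fin ?sqnormc_ge0//.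
Qed.

(** |Re (u^* v)| and |Im (u^* v)| are at most |u|^2 + |v|^2. *)
Lemma complex_integrable_conjM u v : sq_integrable u -> sq_integrable v ->
  complex_integrable (fun x => (u x)^*%C * v x).
Proof.
move=> su sv; have [mu' u2] := su; have [mv v2] := sv.
have s0 (z : R[i]) : (0 <= (sqnormc z)%:E)%E by rewrite lee_fin sqnormc_ge0.
have iuv : m.-integrable setT (fun x => (sqnormc (u x))%:E + (sqnormc (v x))%:E)%E.
  by apply: integrableD => //; exact: integrable_sqnormc.
have [mr mi] := complex_measurable_conjM mu' mv.
split; apply: (le_integrable measurableT _ _ iuv).
- exact/measurable_EFinP.
- move=> x _; rewrite [leRHS]gee0_abs ?adde_ge0// /= -?EFinD lee_fin.
  exact: re_conjM_le.
- exact/measurable_EFinP.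
- move=> x _; rewrite [leRHS]gee0_abs ?adde_ge0// /= -?EFinD lee_fin.
  exact: im_conjM_le.
Qed.

Lemma L2inner_lin u (a : R[i]) v w : sq_integrable u -> sq_integrable v ->
  sq_integrable w ->
  L2inner u (fun x => a * v x + w x) = a * L2inner u v + L2inner u w.
Proof.
move=> su sv sw; rewrite /L2inner -complex_integral_lin; try exact: complex_integrable_conjM.
by congr complex_integral; apply/funext => x; ring.
Qed.

Lemma L2inner_conj u v : L2inner v u = (L2inner u v)^*%C.
Proof.
rewrite /L2inner -complex_integral_conj; congr complex_integral; apply/funext => x.
by apply: complex_eq; rewrite !(re_mul, im_mul, re_conj, im_conj); ring.
Qed.

Lemma L2innerE u : L2inner u u = (\int[m]_x sqnormc (u x))%:C%C.
Proof.
rewrite /L2inner /complex_integral; apply: complex_eq => /=.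
  by apply: eq_Rintegral => x _; rewrite mul_conj_sqnormc.
transitivity (\int[m]_x (0 : R)); last by rewrite /Rintegral integral0.
by apply: eq_Rintegral => x _; rewrite mul_conj_sqnormc.
Qed.

Lemma sq_integrable0 : sq_integrable (fun=> 0 : R[i]).
Proof.
split; first by split; exact: measurable_cst.
by rewrite (_ : (fun x => _) = cst 0%E) ?integral0 ?ltry//; apply/funext => x; rewrite /sqnormc/= expr0n addr0.
Qed.

Lemma L2inner0 u : L2inner u (fun=> 0) = 0.
Proof.
have R0 : \int[m]_x (0 : R) = 0 by rewrite /Rintegral integral0.
by apply: complex_eq; rewrite /= -[RHS]R0; apply: eq_Rintegral => x _; rewrite mulr0.
Qed.

Section sums.
Variables (I : Type) (c : I -> R[i]) (v : I -> T -> R[i]).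
Hypothesis sv : forall i, sq_integrable (v i).

Lemma sq_integrable_sum (r : seq I) :
  sq_integrable (fun x => \sum_(i <- r) c i * v i x).
Proof.
elim: r => [|i r IH]; first by under eq_fun do rewrite big_nil; exact: sq_integrable0.
by under eq_fun do rewrite big_cons; exact: sq_integrable_lin.
Qed.

Lemma L2inner_sumr u (r : seq I) : sq_integrable u ->
  L2inner u (fun x => \sum_(i <- r) c i * v i x) = \sum_(i <- r) c i * L2inner u (v i).
Proof.
move=> su; elim: r => [|i r IH].
  by rewrite big_nil -[RHS](L2inner0 u); congr L2inner; apply/funext => x; rewrite big_nil.
rewrite big_cons -IH -L2inner_lin//; last exact: sq_integrable_sum.
by congr L2inner; apply/funext => x; rewrite big_cons.
Qed.

Lemma L2inner_suml u (r : seq I) : sq_integrable u ->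
  L2inner (fun x => \sum_(i <- r) c i * v i x) u = \sum_(i <- r) (c i)^*%C * L2inner (v i) u.
Proof.
move=> su; rewrite L2inner_conj L2inner_sumr// rmorph_sum/=.
by apply: eq_bigr => i _; rewrite (L2inner_conj u (v i)) rmorphM.
Qed.

End sums.

End complex_valued.

(** * The Bessel inequality and orthonormalization *)

Section hilbert.
Context disp (T : measurableType disp) (R : realType) (m : {measure set T -> \bar R}).
Local Notation re := (@complex.Re R).
Local Notation im := (@complex.Im R).
Implicit Types (u v w : T -> R[i]).

(** Square integrability has to be required: the scalar product has a value, without
meaning, for all functions. *)
Definition orthonormal (I : finType) (f : I -> T -> R[i]) :=
  (forall i, sq_integrable m (f i)) /\ forall i j, L2inner m (f i) (f j) = (i == j)%:R.

Lemma sqnormc_conj (z : R[i]) : sqnormc z^*%C = sqnormc z.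
Proof. by rewrite /sqnormc re_conj im_conj sqrrN. Qed.

(** Expand 0 <= |g - h|^2 where h is the projection of g on the span of f. *)
Lemma bessel (I : finType) (f : I -> T -> R[i]) g : orthonormal f -> sq_integrable m g ->
  \sum_i sqnormc (L2inner m (f i) g) <= \int[m]_x sqnormc (g x).
Proof.
move=> [sf of_] sg.
pose c i := L2inner m (f i) g.
pose h x := \sum_i c i * f i x.
have sh : sq_integrable m h by exact: sq_integrable_sum.
pose S := \sum_i sqnormc (c i).
have SE : (S%:C)%C = \sum_i c i * (c i)^*%C.
  by rewrite rmorph_sum/=; apply: eq_bigr => i _; rewrite -mul_conj_sqnormc mulrC.
have gh : L2inner m g h = S%:C%C.
  rewrite L2inner_sumr// SE; apply: eq_bigr => i _.
  by rewrite (L2inner_conj m (f i) g).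
have hg : L2inner m h g = S%:C%C by rewrite L2inner_conj gh conjc_real.
have hh : L2inner m h h = S%:C%C.
  rewrite L2inner_suml// SE; apply: eq_bigr => i _.
  rewrite mulrC; congr (_ * _).
  rewrite L2inner_sumr// (bigD1 i)//= of_ eqxx mulr1 big1 ?addr0// => j ji.
  by rewrite of_ eq_sym (negbTE ji) mulr0.
pose r x := -1 * h x + g x.
have sr : sq_integrable m r by exact: sq_integrable_lin.
have gr : L2inner m g r = (\int[m]_x sqnormc (g x))%:C%C - S%:C%C.
  by rewrite L2inner_lin// gh L2innerE mulN1r addrC.
have hr : L2inner m h r = 0 by rewrite L2inner_lin// hh hg mulN1r addNr.
have : L2inner m r r = (\int[m]_x sqnormc (g x))%:C%C - S%:C%C.
  rewrite L2inner_lin// (L2inner_conj m h r) hr conjc0 mulr0 add0r.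
  by rewrite (L2inner_conj m g r) gr -rmorphB conjc_real.
rewrite L2innerE -rmorphB => -[] rr.
have : 0 <= \int[m]_x sqnormc (r x) by apply: Rintegral_ge0 => x _; exact: sqnormc_ge0.
by rewrite rr subr_ge0.
Qed.

Lemma sq_integrable_norm0 u : sq_integrable m u -> \int[m]_x sqnormc (u x) = 0 ->
  {ae m, forall x, u x = 0}.
Proof.
move=> [mu' u2] u0; have ms := measurable_sqnormc mu'.
have : (\int[m]_x `|(sqnormc (u x))%:E| = 0)%E.
  under eq_integral do rewrite gee0_abs ?lee_fin ?sqnormc_ge0//.
  move: u0; rewrite /Rintegral => u0; rewrite -[LHS]fineK ?u0//.
  by rewrite ge0_fin_numE// integral_ge0// => x _; rewrite lee_fin sqnormc_ge0.
move/(ae_eq_integral_abs m measurableT) => H.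
have {}H := H ((measurable_EFinP _ _).2 ms).
by apply: filterS H => x /(_ I) /= [] /sqnormc_eq0.
Qed.

Variable P : (T -> R[i]) -> Prop.
Hypothesis P0 : P (fun=> 0).
Hypothesis Plin : forall a u v, P u -> P v -> P (fun x => a * u x + v x).
Hypothesis Psq : forall u, P u -> sq_integrable m u.

Lemma lin_closed_sum (I : Type) (r : seq I) (c : I -> R[i]) (v : I -> T -> R[i]) :
  (forall i, P (v i)) -> P (fun x => \sum_(i <- r) c i * v i x).
Proof.
move=> Pv; elim: r => [|i r IH].
  by rewrite (_ : (fun x => _) = fun=> 0)//; apply/funext => x; rewrite big_nil.
rewrite (_ : (fun x => _) = fun x => c i * v i x + \sum_(i <- r) c i * v i x); last first.
  by apply/funext => x; rewrite big_cons.
exact: Plin.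
Qed.

(** If f consists of k < n orthonormal vectors, the k conditions of orthogonality to
f have a nontrivial solution among the combinations of the n independent vectors e;
it is not 0 almost everywhere, and can be normalized and added to f.  The vectors
f lie in any linear class P that contains e, such as an eigenspace. *)
Lemma orthonormal_of_indep n (e : 'I_n -> T -> R[i]) : (forall i, P (e i)) ->
  (forall c : 'I_n -> R[i], {ae m, forall x, \sum_(i < n) c i * e i x = 0} ->
    forall i, c i = 0) ->
  forall k, (k <= n)%N -> exists f : 'I_k -> T -> R[i], (forall i, P (f i)) /\ orthonormal f.
Proof.
move=> Pe indep; elim => [|k IH] kn.
  by exists (fun _ _ => 0); split; [case|split; case].
have [f [Pf [sf of_]]] := IH (ltnW kn).
pose C := \matrix_(i < n, j < k) L2inner m (f j) (e i).
(* C has fewer columns than rows, hence a nonzero left kernel. *)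
have [v v0 vC] : exists2 v : 'rV[R[i]]_n, v != 0 & v *m C = 0.
  have : kermx C != 0.
    rewrite kermx_eq0 /row_free; apply: contraTneq kn => rC.
    by rewrite -leqNgt -rC rank_leq_col.
  by case/rowV0Pn => v /sub_kermxP vC v0; exists v.
pose r x := \sum_(i < n) v ord0 i * e i x.
have Pr : P r by exact: lin_closed_sum.
have fr j : L2inner m (f j) r = 0.
  rewrite L2inner_sumr//; last by move=> i; exact: Psq.
  have := congr1 (fun A : 'rV_k => A ord0 j) vC; rewrite !mxE => vCj.
  by rewrite -[RHS]vCj; apply: eq_bigr => i _; rewrite mxE.
pose s := \int[m]_x sqnormc (r x).
have s0 : 0 < s.
  rewrite lt_neqAle Rintegral_ge0 ?andbT//; last by move=> x _; exact: sqnormc_ge0.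
  apply: contraNneq v0 => rs; apply/eqP/rowP => i; rewrite mxE.
  have r0 : {ae m, forall x, r x = 0} by apply: sq_integrable_norm0; [exact: Psq|exact/esym].
  exact: (indep (fun i => v ord0 i) r0).
(* The normalized vector is written t * r + 0 to be an instance of Plin. *)
pose t : R[i] := ((Num.sqrt s)^-1)%:C%C.
pose g x := t * r x + 0.
have Pg : P g by exact: (Plin t Pr P0).
have sr := Psq Pr; have sg := Psq Pg; have s00 := Psq P0.
have fg j : L2inner m (f j) g = 0.
  by rewrite L2inner_lin// fr mulr0 L2inner0 addr0.
have gf j : L2inner m g (f j) = 0 by rewrite L2inner_conj fg conjc0.
have gg : L2inner m g g = 1.
  rewrite L2inner_lin// L2inner0 addr0 (L2inner_conj m r g) L2inner_lin// L2inner0 addr0.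
  rewrite L2innerE -/s /t; apply: complex_eq.
    rewrite !(re_mul, im_mul, re_conj, im_conj)/=.
    rewrite !(mul0r, mulr0, subr0, addr0) mulrA -invfM -expr2 sqr_sqrtr ?ltW//.
    by rewrite mulVf ?gt_eqF.
  by rewrite !(re_mul, im_mul, re_conj, im_conj)/= !(mul0r, mulr0, subr0, addr0, oppr0).
exists (fun i => oapp f g (unlift ord0 i)); split.
  by move=> i; case: unliftP => [j|] _ /=.
split; first by move=> i; case: unliftP => [j|] _ /=.
move=> i j; case: unliftP => [i'|] ->; case: unliftP => [j'|] -> /=.
- by rewrite of_ (inj_eq lift_inj).
- by rewrite fg.
- by rewrite gf.
- by rewrite gg.
Qed.

End hilbert.

(** * Plane waves cut off to a set of finite measure *)

Section expi.
Context disp (T : measurableType disp) (R : realType) (m : {measure set T -> \bar R}).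
Local Notation re := (@complex.Re R).
Local Notation im := (@complex.Im R).
Implicit Types (u v : T -> R[i]).

Lemma sqnormc_expi (t : R) : sqnormc (expi t) = 1.
Proof. by rewrite /sqnormc/= cos2Dsin2. Qed.

Lemma conj_expi (t : R) : (expi t)^*%C = expi (- t).
Proof. by apply: complex_eq; rewrite ?re_conj ?im_conj/= ?cosN ?sinN. Qed.

Lemma complex_integrable_expi (ph : T -> R) u : measurable_fun setT ph -> complex_integrable m u ->
  complex_integrable m (fun x => expi (ph x) * u x).
Proof.
move=> mph [ur ui].
have ic f := @integrableM_cos _ T R m f ph.
have is_ f := @integrableM_sin _ T R m f ph.
split.
- have := integrableB measurableT (ic _ ur mph) (is_ _ ui mph).
  by apply: eq_integrable => // x _; rewrite re_mul/= -EFinB; congr _%:E; ring.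
- have := integrableD measurableT (ic _ ui mph) (is_ _ ur mph).
  by apply: eq_integrable => // x _; rewrite im_mul/= -EFinD; congr _%:E; ring.
Qed.

Variable B : set T.
Hypothesis mB : measurable B.
Hypothesis Boo : (m B < +oo)%E.

(** t <= 1 + t^2 on B, and u vanishes outside B. *)
Lemma sq_integrable_integrable u : sq_integrable m u -> {ae m, forall x, ~ B x -> u x = 0} ->
  complex_integrable m u.
Proof.
move=> [[mr mi] u2] uB.
have ms : measurable_fun setT (fun x => sqnormc (u x)) by exact: measurable_sqnormc.
have bnd : (\int[m]_x (\1_B x + sqnormc (u x))%:E < +oo)%E.
  under eq_integral do rewrite EFinD.
  rewrite ge0_integralD//; last 3 first.
  - by apply/measurable_EFinP; exact: measurable_indic.
  - by move=> x _; rewrite lee_fin sqnormc_ge0.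
  - exact/measurable_EFinP.
  by rewrite integral_indic// setIT lte_add_pinfty.
have key (f : T -> R) : measurable_fun setT f -> (forall x, u x = 0 -> f x = 0) ->
    (forall x, `|f x| ^+ 2 <= sqnormc (u x)) -> m.-integrable setT (fun x => (f x)%:E).
  move=> mf f0 fu; apply/integrableP; split; first exact/measurable_EFinP.
  apply: le_lt_trans bnd; apply: ae_ge0_le_integral => //.
  - by apply/measurable_EFinP; exact: measurableT_comp.
  - by move=> x _; rewrite lee_fin addr_ge0// sqnormc_ge0.
  - by apply/measurable_EFinP; apply: measurable_funD => //; exact: measurable_indic.
  apply: filterS uB => x uBx _; rewrite /= lee_fin indicE.
  have [xB|xB] := pselect (B x).
    rewrite mem_set//= (le_trans _ (lerD (lexx _) (fu x)))//.
    have h1 (t : R) : t <= 1 + t ^+ 2.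
      by have := sqr_ge0 (t - 1); have := sqr_ge0 t; nra.
    exact: h1.
  by rewrite memNset// add0r f0 ?uBx// normr0 sqnormc_ge0.
split; apply: key => //.
- by move=> x ->.
- by move=> x; rewrite real_normK ?num_real// lerDl sqr_ge0.
- by move=> x ->.
- by move=> x; rewrite real_normK ?num_real// lerDr sqr_ge0.
Qed.

Definition wave (ph : T -> R) (x : T) : R[i] := expi (ph x) * (\1_B x)%:C%C.

Lemma sqnormc_wave ph x : sqnormc (wave ph x) = \1_B x.
Proof.
rewrite /wave sqnormcM sqnormc_expi mul1r /sqnormc/= expr0n addr0.
by rewrite indicE; case: (_ \in _); rewrite ?expr1n// expr0n.
Qed.

Lemma sq_integrable_wave ph : measurable_fun setT ph -> sq_integrable m (wave ph).
Proof.
move=> mph; have mi : measurable_fun [set: T] (\1_B : T -> R) by exact: measurable_indic.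
split.
  split; rewrite /wave.
    under eq_fun do rewrite re_mul/= mulr0 subr0.
    by apply: measurable_funM => //; exact: measurable_cos_comp.
  under eq_fun do rewrite im_mul/= mulr0 add0r.
  by apply: measurable_funM => //; exact: measurable_sin_comp.
under eq_integral do rewrite sqnormc_wave.
by rewrite integral_indic// setIT.
Qed.

Lemma wave_norm ph : \int[m]_x sqnormc (wave ph x) = fine (m B).
Proof.
rewrite /Rintegral; congr fine.
under eq_integral do rewrite sqnormc_wave.
by rewrite integral_indic// setIT.
Qed.

(** Up to a factor, the Fourier coefficient of u at p, for ph x = p.x.  The cut-off to
B makes the wave square-integrable and is invisible to u. *)
Lemma L2inner_wave ph u : measurable_fun setT ph -> sq_integrable m u ->
  {ae m, forall x, ~ B x -> u x = 0} ->
  L2inner m (wave ph) u = complex_integral m (fun x => expi (- ph x) * u x).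
Proof.
move=> mph su uB; have iu := sq_integrable_integrable su uB.
have [ir ii] := complex_integrable_expi (measurable_funN mph) iu.
have [jr ji] := complex_integrable_conjM (sq_integrable_wave mph) su.
have E x : (~ B x -> u x = 0) -> (wave ph x)^*%C * u x = expi (- ph x) * u x.
  have cM (z w : R[i]) : (z * w)^*%C = z^*%C * w^*%C by exact: rmorphM.
  move=> uBx; rewrite /wave cM conj_expi conjc_real indicE.
  by have [xB|xB] := pselect (B x); [rewrite mem_set// mulr1|rewrite uBx// !mulr0].
rewrite /L2inner /complex_integral; apply: complex_eq => /=;
  rewrite /Rintegral; congr fine.
- apply: (ae_eq_integral_when _ _ uB).
  + exact: measurable_int jr.
  + exact: measurable_int ir.
  + by move=> x /E ->.
- apply: (ae_eq_integral_when _ _ uB).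
  + exact: measurable_int ji.
  + exact: measurable_int ii.
  + by move=> x /E ->.
Qed.

End expi.

Section version.
Context disp (T : measurableType disp) (R : realType).
Variable mu : {sigma_finite_measure set T -> \bar R}.
Local Notation L := (caratheodory_type (mu_ext mu)).
Local Notation leb := (@completed_measure_extension _ T R mu).
Local Notation re := (@complex.Re R).
Local Notation im := (@complex.Im R).

Lemma ae_completion (N : set T) (P : T -> Prop) : measurable N -> mu N = 0%E ->
  (forall x, ~ N x -> P x) -> {ae leb, forall x, P x}.
Proof.
move=> mN N0 NP; exists N; split.
- exact: measurable_completion.
- by rewrite completionE.
- by move=> x /= Px; apply: contrapT => Nx; exact/Px/NP.
Qed.

(** Replacing Re u and Im u by Borel versions a and b changes no integral, and turns
integrals for the completed measure into integrals for the Borel measure. *)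
Lemma transform_version (u : T -> R[i]) : @sq_integrable _ L R leb u -> @complex_integrable _ L R leb u ->
  exists a b : T -> R,
  [/\ mu.-integrable setT (EFin \o a) /\ mu.-integrable setT (EFin \o b),
      (\int[mu]_x (a x ^+ 2)%:E < +oo)%E /\ (\int[mu]_x (b x ^+ 2)%:E < +oo)%E,
      (\int[leb]_x (sqnormc (u x))%:E = \int[mu]_x (a x ^+ 2 + b x ^+ 2)%:E)%E &
      forall ph : T -> R, measurable_fun setT ph ->
        @complex_integral _ L R leb (fun x => expi (- ph x) * u x) =
        (re_transform mu ph a b +i* re_transform mu ph b (\- a))%C].
Proof.
move=> [[mr mi] u2] [ir ii].
have [a [Na [ma mNa Na0 ua]]] := completion_measurable_fun mr.
have [b [Nb [mb mNb Nb0 ub]]] := completion_measurable_fun mi.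
pose N := Na `|` Nb.
have mN : measurable N by exact: measurableU.
have N0 : mu N = 0%E by exact: null_set_setU.
have uN : {ae leb, forall x, re (u x) = a x /\ im (u x) = b x}.
  apply: (ae_completion mN N0) => x Nx; split.
    by apply: ua => ?; apply: Nx; left.
  by apply: ub => ?; apply: Nx; right.
have transfer (f g : T -> R) : measurable_fun [set: L] f -> measurable_fun [set: T] g ->
    (forall x, re (u x) = a x /\ im (u x) = b x -> f x = g x) ->
    (\int[leb]_x (f x)%:E = \int[mu]_x (g x)%:E)%E.
  move=> mf mg fg.
  have mgE : measurable_fun [set: T] (fun x => (g x)%:E) by exact/measurable_EFinP.
  rewrite -integral_completion//.
  apply: (ae_eq_integral_when _ _ uN).
  - exact/measurable_EFinP.
  - exact: measurable_fun_completion mgE.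
  - by move=> x /fg ->.
have sqE : (\int[leb]_x (sqnormc (u x))%:E = \int[mu]_x (a x ^+ 2 + b x ^+ 2)%:E)%E.
  apply: transfer.
  - exact: (@measurable_sqnormc _ L).
  - by apply: measurable_funD; exact: measurable_funX.
  - by move=> x [<- <-].
have mabs (f : T -> R) : measurable_fun [set: T] f -> measurable_fun [set: T] (fun x => `|f x|).
  by move=> mf; exact: measurableT_comp.
exists a, b; split => //.
- have mrL : measurable_fun [set: L] (fun x => `|re (u x)|).
    exact: (@measurableT_comp _ _ _ L).
  have miL : measurable_fun [set: L] (fun x => `|im (u x)|).
    exact: (@measurableT_comp _ _ _ L).
  have Er := transfer (fun x => `|re (u x)|) (fun x => `|a x|) mrL (mabs _ ma).
  have Ei := transfer (fun x => `|im (u x)|) (fun x => `|b x|) miL (mabs _ mb).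
  split; apply/integrableP; split; first exact/measurable_EFinP.
  + move: ir => /integrableP[_ irL]; apply: le_lt_trans irL.
    by rewrite le_eqVlt; apply/orP; left; apply/eqP/esym/Er => x [-> _].
  + exact/measurable_EFinP.
  + move: ii => /integrableP[_ iiL]; apply: le_lt_trans iiL.
    by rewrite le_eqVlt; apply/orP; left; apply/eqP/esym/Ei => x [_ ->].
- by apply: ge0_sqr_sum2_lty => //; rewrite -sqE.
move=> ph mph.
have mphL : measurable_fun [set: L] ph by exact: measurable_fun_completion mph.
have mc : measurable_fun [set: L] (fun x => cos (ph x)) by exact: measurable_cos_comp.
have ms : measurable_fun [set: L] (fun x => sin (ph x)) by exact: measurable_sin_comp.
have mcT : measurable_fun [set: T] (fun x => cos (ph x)) by exact: measurable_cos_comp.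
have msT : measurable_fun [set: T] (fun x => sin (ph x)) by exact: measurable_sin_comp.
rewrite /complex_integral; apply: complex_eq => /=; rewrite /re_transform /Rintegral; congr fine; apply: transfer.
- under eq_fun do rewrite re_mul /= cosN sinN.
  exact: (measurable_funB (measurable_funM mc mr) (measurable_funM (measurable_funN ms) mi)).
- by apply: measurable_funD; exact: measurable_funM.
- by move=> x [ra ib]; rewrite re_mul/= cosN sinN ra ib; ring.
- under eq_fun do rewrite im_mul /= cosN sinN.
  exact: (measurable_funD (measurable_funM mc mi) (measurable_funM (measurable_funN ms) mr)).
- exact: (measurable_funD (measurable_funM mb mcT) (measurable_funM (measurable_funN ma) msT)).
- by move=> x [ra ib]; rewrite im_mul/= cosN sinN ra ib; ring.
Qed.

End version.

(** * Eigenvalue sums of a symbol *)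

Section symbol_operator.
Context disp (X : measurableType disp) (R : realType) (m : {measure set X -> \bar R}).
Local Notation re := (@complex.Re R).
Local Notation im := (@complex.Im R).
Variables (F : (X -> R[i]) -> X -> R[i]) (V : (X -> R[i]) -> Prop) (T : X -> R).
Implicit Types (u v w : X -> R[i]).
Hypothesis mT : measurable_fun setT T.
Hypothesis V0 : V (fun=> 0).
Hypothesis Vlin : forall a u v, V u -> V v -> V (fun x => a * u x + v x).
Hypothesis Vsq : forall u, V u -> sq_integrable m u.
Hypothesis Flin : forall a u v, V u -> V v ->
  F (fun x => a * u x + v x) = fun p => a * F u p + F v p.
Hypothesis Fsq : forall u, V u -> sq_integrable m (F u).
Hypothesis Fisometry : forall u, V u ->
  \int[m]_p sqnormc (F u p) = \int[m]_x sqnormc (u x).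

(** The bound on the eigenvalues depends only on V being a linear space of
square-integrable functions, F being linear and isometric on V, and the pointwise
Bessel bound Fbessel below.  So it is derived for such V and F on any measure
space; V is to be the space of functions supported in Omega, F the Fourier
transform, and the definitions below specialize to those of the statement. *)
Definition form_dom u := V u /\
  m.-integrable setT (fun p => ((1 + T p) * sqnormc (F u p))%:E).

Definition symbol_form v u : R[i] :=
  complex_integral m (fun p => (T p)%:C%C * ((F v p)^*%C * F u p)).

Definition form_graph u f :=
  [/\ form_dom u, V f & forall v, form_dom v -> symbol_form v u = L2inner m v f].

Definition eigenvector (lam : R) u := form_graph u (fun x => lam%:C%C * u x).

Lemma transform0 : F (fun=> 0) = fun=> 0.
Proof.
have := Flin (-1) V0 V0.
rewrite (_ : (fun x : X => -1 * 0 + 0) = fun=> 0); last by apply/funext => x; rewrite mulr0 addr0.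
by move=> {1}->; apply/funext => p; rewrite mulN1r addNr.
Qed.

(** Since F u is square-integrable, 1 can be removed from the weight 1 + T. *)
Lemma form_dom_integrable u : form_dom u ->
  m.-integrable setT (fun p => (T p * sqnormc (F u p))%:E).
Proof.
move=> [Vu iu]; have := integrableB measurableT iu (integrable_sqnormc (Fsq Vu)).
by apply: eq_integrable => // p _; rewrite /= -EFinB; congr _%:E; ring.
Qed.

(** The modulus of the integrand is at most |T| (|F u|^2 + |F v|^2). *)
Lemma complex_integrable_form u v : form_dom u -> form_dom v ->
  complex_integrable m (fun p => (T p)%:C%C * ((F v p)^*%C * F u p)).
Proof.
move=> du dv; have iu := form_dom_integrable du; have iv := form_dom_integrable dv.
have [muF _] := Fsq du.1; have [mvF _] := Fsq dv.1.
have [mr mi] := complex_measurable_conjM mvF muF.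
have iuv := integrableD measurableT (integrable_abse iu) (integrable_abse iv).
have key (g : X -> R) : measurable_fun setT g ->
    (forall p, `|g p| <= sqnormc (F v p) + sqnormc (F u p)) ->
    m.-integrable setT (fun p => (T p * g p)%:E).
  move=> mg gle; apply: (le_integrable measurableT _ _ iuv).
    by apply/measurable_EFinP; exact: measurable_funM.
  move=> p _ /=; rewrite lee_fin [leRHS]ger0_norm ?addr_ge0//.
  rewrite !normrM (ger0_norm (sqnormc_ge0 (F u p))) (ger0_norm (sqnormc_ge0 (F v p))).
  by rewrite -mulrDr ler_wpM2l// addrC.
split.
- rewrite (_ : (fun p => _) = (fun p => (T p * re ((F v p)^*%C * F u p))%:E)); last first.
    by apply/funext => p; rewrite re_mul/= mul0r subr0.
  by apply: key => // p; exact: re_conjM_le.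
- rewrite (_ : (fun p => _) = (fun p => (T p * im ((F v p)^*%C * F u p))%:E)); last first.
    by apply/funext => p; rewrite im_mul/= mul0r addr0.
  by apply: key => // p; exact: im_conjM_le.
Qed.

Lemma symbol_form_lin v a u w : form_dom v -> form_dom u -> form_dom w ->
  symbol_form v (fun x => a * u x + w x) = a * symbol_form v u + symbol_form v w.
Proof.
move=> dv du dw; rewrite /symbol_form -complex_integral_lin; try exact: complex_integrable_form.
congr complex_integral; rewrite Flin; [|exact: du.1|exact: dw.1].
by apply/funext => p; ring.
Qed.

Lemma symbol_form_conj u v : symbol_form u v = (symbol_form v u)^*%C.
Proof.
rewrite /symbol_form -complex_integral_conj; congr complex_integral; apply/funext => p.
by apply: complex_eq; rewrite !(re_mul, im_mul, re_conj, im_conj)/=; ring.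
Qed.

Lemma form_dom_lin a u w : form_dom u -> form_dom w -> form_dom (fun x => a * u x + w x).
Proof.
move=> [Vu iu] [Vw iw]; have VL := Vlin a Vu Vw; split => //.
have iuw := integrableD measurableT (integrableZl measurableT (2 * sqnormc a) (integrable_abse iu))
  (integrableZl measurableT 2 (integrable_abse iw)).
apply: (le_integrable measurableT _ _ iuw).
  apply/measurable_EFinP; apply: measurable_funM; first exact: measurable_funD.
  by apply: measurable_sqnormc; case: (Fsq VL).
move=> p _ /=; rewrite lee_fin Flin//.
have s0 := sqnormc_ge0 (F u p); have s1 := sqnormc_ge0 (F w p).
rewrite [leRHS]ger0_norm ?addr_ge0 ?mulr_ge0 ?sqnormc_ge0//.
rewrite !normrM (ger0_norm s0) (ger0_norm s1) (ger0_norm (sqnormc_ge0 _)).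
have := sqnormcD_le (a * F u p) (F w p); rewrite sqnormcM => h.
have n0 := normr_ge0 (1 + T p).
apply: (le_trans (ler_wpM2l n0 h)); rewrite le_eqVlt; apply/orP; left; apply/eqP; ring.
Qed.

Lemma eigenvector_lin lam a u w : eigenvector lam u -> eigenvector lam w ->
  eigenvector lam (fun x => a * u x + w x).
Proof.
move=> [du Vu eu] [dw Vw ew]; split.
- exact: form_dom_lin.
- rewrite (_ : (fun x => _) = fun x => a * (lam%:C%C * u x) + lam%:C%C * w x); first exact: Vlin.
  by apply/funext => x; ring.
- move=> v dv; rewrite symbol_form_lin// eu// ew// -L2inner_lin; [|exact/Vsq/dv.1|exact: Vsq|exact: Vsq].
  by congr L2inner; apply/funext => x; ring.
Qed.

Lemma eigenvector0 lam : eigenvector lam (fun=> 0).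
Proof.
have l0 : (fun x : X => lam%:C%C * 0) = (fun=> 0 : R[i]) by apply/funext => x; rewrite mulr0.
have d0 : form_dom (fun=> 0).
  split => //; rewrite transform0; have := @integrable0 _ _ _ m setT.
  by apply: eq_integrable => // p _; rewrite /sqnormc/= expr0n addr0 mulr0.
split => //; first by rewrite l0.
move=> v dv; rewrite l0 L2inner0 /symbol_form transform0 -[RHS](L2inner0 m v) /L2inner.
by congr complex_integral; apply/funext => p; rewrite !mulr0.
Qed.

Lemma eigenvector_sq_integrable lam u : eigenvector lam u -> sq_integrable m u.
Proof. by move=> [[Vu _] _ _]; exact: Vsq. Qed.

Lemma eigenvectorE lam u v : eigenvector lam u -> form_dom v -> symbol_form v u = lam%:C%C * L2inner m v u.
Proof.
move=> [du Vu eu] dv; rewrite eu//.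
have sz : sq_integrable m (fun=> 0) by exact: Vsq.
have := L2inner_lin lam%:C%C (Vsq dv.1) (Vsq du.1) sz.
rewrite L2inner0 addr0 => <-; congr L2inner; apply/funext => x; by rewrite addr0.
Qed.

(** The two eigenvector equations evaluate the Hermitian form at (u, v) as lam' <u, v>
and, the eigenvalue lam being real, as lam <u, v>. *)
Lemma eigenvector_orthogonal lam lam' u v : eigenvector lam u -> eigenvector lam' v -> lam != lam' ->
  L2inner m u v = 0.
Proof.
move=> eu ev ll.
have du : form_dom u by case: eu. have dv : form_dom v by case: ev.
have := symbol_form_conj u v; rewrite (eigenvectorE ev du) (eigenvectorE eu dv) (L2inner_conj m u v).
set z := L2inner m u v => H.
have : (lam'%:C%C - lam%:C%C) * z = 0.
  rewrite mulrBl H; apply: complex_eq; rewrite !(re_add, im_add, re_mul, im_mul, re_conj, im_conj)/=;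
    by case: (z) => a b /=; ring.
move/eqP; rewrite mulf_eq0 => /orP[|/eqP//].
by rewrite subr_eq0 => /eqP[] E; rewrite E eqxx in ll.
Qed.

Lemma neg_part_ge0 (x : R) : 0 <= neg_part x.
Proof. by rewrite /neg_part divr_ge0// subr_ge0 ler_norm. Qed.

Lemma neg_part_ge (x : R) : - x <= neg_part x.
Proof. by rewrite /neg_part; have := ler_norm (- x); rewrite normrN; lra. Qed.

Lemma neg_part_le0 (x : R) : x <= 0 -> neg_part x = - x.
Proof. by move=> x0; rewrite /neg_part ler0_norm//; lra. Qed.

Lemma neg_part_eq0 (x : R) : 0 <= x -> neg_part x = 0.
Proof. by move=> x0; rewrite /neg_part ger0_norm// subrr mul0r. Qed.

Lemma measurable_neg_part (Lam : R) :
  measurable_fun setT (fun p => neg_part (T p - Lam)).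
Proof.
apply: measurable_funM => //; apply: measurable_funB; last exact: measurable_funB.
by apply: measurableT_comp => //; exact: measurable_funB.
Qed.

Lemma le_integral_ge0 (g h : X -> R) : m.-integrable setT (EFin \o g) ->
  measurable_fun setT h -> (forall x, 0 <= h x) -> (forall x, g x <= h x) ->
  (\int[m]_x (g x)%:E <= \int[m]_x (h x)%:E)%E.
Proof.
move=> ig mh h0 gh; have [hoo|] := ltP (\int[m]_x (h x)%:E)%E +oo%E; last first.
  by rewrite leye_eq => /eqP ->; rewrite leey.
apply: le_integral => //; last by move=> x _; rewrite lee_fin.
apply/integrableP; split; first exact/measurable_EFinP.
by under eq_integral do rewrite gee0_abs ?lee_fin//.
Qed.

(** lam is the mean of T for the probability density |F u|^2, so
Lam - lam = \int (Lam - T) |F u|^2, and Lam - T <= (T - Lam)_-. *)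
Lemma eigenvector_neg_part lam Lam u : eigenvector lam u -> L2inner m u u = 1 ->
  ((neg_part (lam - Lam))%:E <=
   \int[m]_p (neg_part (T p - Lam) * sqnormc (F u p))%:E)%E.
Proof.
move=> eu uu; have du : form_dom u by case: eu.
have mn := measurable_neg_part Lam.
have [mFu _] := Fsq du.1; have ms := measurable_sqnormc mFu.
have [Ll|lL] := leP Lam lam.
  rewrite neg_part_eq0 ?subr_ge0//; apply: integral_ge0 => p _.
  by rewrite lee_fin mulr_ge0 ?neg_part_ge0 ?sqnormc_ge0.
rewrite neg_part_le0; last by rewrite subr_le0 ltW.
have iT := form_dom_integrable du; have iF := integrable_sqnormc (Fsq du.1).
have E1 : \int[m]_p (T p * sqnormc (F u p)) = lam.
  have := eigenvectorE eu du; rewrite uu mulr1 /symbol_form /complex_integral => -[<- _].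
  apply: eq_Rintegral => p _; rewrite mul_conj_sqnormc re_mul/=; ring.
have E2 : \int[m]_p sqnormc (F u p) = 1.
  rewrite Fisometry; last exact: du.1.
  by have := L2innerE m u; rewrite uu => /(congr1 re)/= <-.
have ig : m.-integrable setT (EFin \o (fun p => (Lam - T p) * sqnormc (F u p))).
  have := integrableB measurableT (integrableZl measurableT Lam iF) iT.
  by apply: eq_integrable => // p _; rewrite /= -EFinM -EFinB; congr _%:E; ring.
have -> : ((- (lam - Lam))%:E = \int[m]_p ((Lam - T p) * sqnormc (F u p))%:E)%E.
  rewrite -(fineK (integrable_fin_num measurableT ig)); congr _%:E.
  transitivity (\int[m]_p (Lam * sqnormc (F u p) + -1 * (T p * sqnormc (F u p)))).
    rewrite (@Rintegral_lin2 _ _ _ m (fun p => sqnormc (F u p)) (fun p => T p * sqnormc (F u p)))//.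
    by rewrite E1 E2; ring.
  by apply: eq_Rintegral => p _; ring.
apply: le_integral_ge0 => //.
- exact: measurable_funM.
- by move=> p; rewrite mulr_ge0 ?neg_part_ge0 ?sqnormc_ge0.
- move=> p; rewrite ler_wpM2r ?sqnormc_ge0//.
  by have := neg_part_ge (T p - Lam); rewrite opprB.
Qed.

Variable K : R.
Hypothesis Fbessel : forall (I : finType) (f : I -> X -> R[i]) (p : X),
  (forall i, V (f i)) -> orthonormal m f -> \sum_i sqnormc (F (f i) p) <= K.
Hypothesis K0 : 0 <= K.

(** Sum the previous estimate over the family, exchange sum and integral, and use
the pointwise Bessel bound \sum_i |F (f i) p|^2 <= K. *)
Lemma orthonormal_neg_part_sum (I : finType) (f : I -> X -> R[i]) (lam : I -> R) Lam :
  (forall i, eigenvector (lam i) (f i)) -> orthonormal m f ->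
  ((\sum_i neg_part (lam i - Lam))%:E <=
   K%:E * \int[m]_p (neg_part (T p - Lam))%:E)%E.
Proof.
move=> ef of_; have mn := measurable_neg_part Lam.
have Vf i : V (f i) by case: (ef i) => -[].
have ms i : measurable_fun setT (fun p => sqnormc (F (f i) p)).
  by apply: measurable_sqnormc; case: (Fsq (Vf i)).
have mns i : measurable_fun setT (fun p => (neg_part (T p - Lam) * sqnormc (F (f i) p))%:E).
  by apply/measurable_EFinP; exact: measurable_funM.
rewrite -sumEFin.
apply: (@le_trans _ _ (\sum_i \int[m]_p (neg_part (T p - Lam) * sqnormc (F (f i) p))%:E)%E).
  by apply: lee_sum => i _; apply: eigenvector_neg_part => //; rewrite of_.2 eqxx.
rewrite -ge0_integral_sum//; last first.
  by move=> i p _; rewrite lee_fin mulr_ge0 ?neg_part_ge0 ?sqnormc_ge0.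
rewrite -ge0_integralZl//; [|exact/measurable_EFinP|by move=> p _; rewrite lee_fin neg_part_ge0].
apply: ge0_le_integral => //.
- by move=> p _; apply: sume_ge0 => i _; rewrite lee_fin mulr_ge0 ?neg_part_ge0 ?sqnormc_ge0.
- by apply: emeasurable_sum.
- by apply: measurable_funeM; exact/measurable_EFinP.
move=> p _; rewrite sumEFin -mulr_sumr -EFinM lee_fin mulrC ler_wpM2r ?neg_part_ge0//.
exact: Fbessel.
Qed.

Definition ae_lin_indep n (e : 'I_n -> X -> R[i]) :=
  forall c : 'I_n -> R[i],
    {ae m, forall x, \sum_(i < n) c i * e i x = 0} -> forall i, c i = 0.

Definition eigen_count lam n := exists e : 'I_n -> X -> R[i],
  (forall i, eigenvector lam (e i)) /\ ae_lin_indep e.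

Definition eigen_multiplicity lam : \bar R :=
  ereal_sup [set n%:R%:E | n in [set n : nat | eigen_count lam n]].

Definition eigen_trace Lam : \bar R :=
  (\esum_(lam in [set: R]) (eigen_multiplicity lam * (neg_part (lam - Lam))%:E))%E.

Lemma eigen_count_orthonormal lam n : eigen_count lam n ->
  exists f : 'I_n -> X -> R[i], (forall i, eigenvector lam (f i)) /\ orthonormal m f.
Proof.
move=> [e [ee ie]].
apply: (orthonormal_of_indep (P := eigenvector lam) (eigenvector0 lam) _ _ ee ie (leqnn n)).
- by move=> a u v; exact: eigenvector_lin.
- by move=> u; exact: eigenvector_sq_integrable.
Qed.

Lemma eigen_count0 lam : eigen_count lam 0.
Proof. by exists (fun _ _ => 0); split; [case|move=> c _; case]. Qed.

(** If the weight (lam - Lam)_- is positive, the bound for orthonormal families limits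
their size in the eigenspace, so the supremum of these sizes is finite and
attained.  If the weight is 0 the product is 0, even for an infinite
multiplicity, and n = 0 will do. *)
Lemma eigen_multiplicity_attained lam Lam :
  (K%:E * \int[m]_p (neg_part (T p - Lam))%:E < +oo)%E ->
  exists2 n, eigen_count lam n &
    (eigen_multiplicity lam * (neg_part (lam - Lam))%:E <= (n%:R * neg_part (lam - Lam))%:E)%E.
Proof.
set B := (K%:E * _)%E => Boo.
have B0 : (0 <= B)%E.
  by rewrite mule_ge0// integral_ge0// => p _; rewrite lee_fin neg_part_ge0.
have [w0|w0] := eqVneq (neg_part (lam - Lam)) 0.
  by exists 0%N; [exact: eigen_count0|rewrite w0 mule0 mulr0].
have wgt0 : 0 < neg_part (lam - Lam) by rewrite lt_neqAle eq_sym w0 neg_part_ge0.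
have cb n : eigen_count lam n -> n%:R * neg_part (lam - Lam) <= fine B.
  move=> /eigen_count_orthonormal[f [ef of_]].
  have h := orthonormal_neg_part_sum Lam ef of_.
  rewrite sumr_const card_ord -mulr_natl -/B in h.
  by rewrite -lee_fin fineK// ge0_fin_numE.
pose N := Num.bound (fine B / neg_part (lam - Lam)).
have Nb n : eigen_count lam n -> (n <= N)%N.
  move=> /cb; rewrite -ler_pdivlMr// => nB.
  rewrite ltnW// -(ltr_nat R) (le_lt_trans nB)// archi_boundP//.
  by rewrite divr_ge0 ?neg_part_ge0// fine_ge0.
pose P n := `[< eigen_count lam n >].
have exP : exists n, P n by exists 0%N; apply/asboolP; exact: eigen_count0.
have ubP n : P n -> (n <= N)%N by move/asboolP; exact: Nb.
have [n /asboolP nP nmax] := ex_maxnP exP ubP.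
exists n => //; rewrite [leRHS]EFinM; apply: lee_wpmul2r; first by rewrite lee_fin neg_part_ge0.
apply: ge_ereal_sup => _ [k kP <-]; rewrite lee_fin ler_nat.
by apply: nmax; exact/asboolP.
Qed.

(** It suffices to bound sums over a finite set of values lam.  Orthonormal families of
maximal size in their eigenspaces are together orthonormal, indexed by pairs of a
value and an index. *)
Lemma eigen_trace_le Lam :
  (eigen_trace Lam <= K%:E * \int[m]_p (neg_part (T p - Lam))%:E)%E.
Proof.
set B := (K%:E * _)%E.
have [Boo|] := ltP B +oo%E; last by rewrite leye_eq => /eqP ->; rewrite leey.
apply: ge_ereal_sup => _ [A [finA _] <-].
have [s us ->] : exists2 s : seq R, uniq s & A = [set` s].
  have [s ->] := (finite_seqP A).1 finA; exists (undup s); first exact: undup_uniq.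
  by apply/seteqP; split => x /=; rewrite mem_undup.
rewrite -fsbig_seq//.
have H lam : exists n, exists f : 'I_n -> X -> R[i],
  [/\ (forall i, eigenvector lam (f i)), orthonormal m f &
    (eigen_multiplicity lam * (neg_part (lam - Lam))%:E <= (n%:R * neg_part (lam - Lam))%:E)%E].
  have [n /eigen_count_orthonormal[f [ef of_]] nle] := eigen_multiplicity_attained lam Boo.
  by exists n, f.
pose n lam := sval (cid (H lam)).
pose f lam : 'I_(n lam) -> X -> R[i] := sval (cid (svalP (cid (H lam)))).
have fP lam : [/\ (forall i, eigenvector lam (f lam i)), orthonormal m (f lam) &
    (eigen_multiplicity lam * (neg_part (lam - Lam))%:E <= ((n lam)%:R * neg_part (lam - Lam))%:E)%E].
  exact: (svalP (cid (svalP (cid (H lam))))).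
pose l (k : 'I_(size s)) := s`_k.
pose I := {k : 'I_(size s) & 'I_(n (l k))}.
pose g (i : I) := f (l (tag i)) (tagged i).
have og : orthonormal m g.
  split; first by move=> [k a]; case: (fP (l k)) => _ [sq _] _; exact: sq.
  move=> [k a] [k' b]; rewrite /g/=; have [kk|kk] := eqVneq k k'.
    by subst k'; rewrite eq_Tagged/=; case: (fP (l k)) => _ [_ ->].
  rewrite (eigenvector_orthogonal (lam := l k) (lam' := l k')).
  - by rewrite -tag_eqE /tag_eq /= (negbTE kk).
  - by case: (fP (l k)).
  - by case: (fP (l k')).
  - by rewrite /l nth_uniq.
apply: (@le_trans _ _ (\sum_(x <- s) ((n x)%:R * neg_part (x - Lam))%:E)%E).
  by apply: lee_sum => x _; case: (fP x).
have eg i : eigenvector (l (tag i)) (g i).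
  by case: i => k a; case: (fP (l k)) => e _ _; exact: e.
apply: le_trans (orthonormal_neg_part_sum Lam eg og).
rewrite (big_nth 0) big_mkord sumEFin lee_fin le_eqVlt; apply/orP; left; apply/eqP.
have := @sig_big_dep _ _ _ 'I_(size s) (fun k => 'I_(n (l k))) xpredT (fun _ => xpredT)
  (fun k _ => neg_part (l k - Lam)).
move=> <-; apply: eq_bigr => k _.
by rewrite sumr_const card_ord mulr_natl.
Qed.

End symbol_operator.

(** * The Fourier transform of functions supported in Omega *)

Section fourier_L2.
Context (R : realType) (d : nat) (Omega : set 'rV[R]_d).
Local Notation L := (lebesgue_space R d).
Local Notation leb := (@lebesgue_rV R d).
Local Notation mu := (@borel_lebesgue R d).
Local Notation re := (@complex.Re R).
Local Notation im := (@complex.Im R).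
Implicit Types (u v : 'rV[R]_d -> R[i]).
Hypothesis Omegaoo : (leb Omega < +oo)%E.

(** Plane waves have to be cut off to a measurable set; a hull of Omega has the same
measure, and functions that vanish off Omega vanish off the hull. *)
Lemma L2_on_hull : exists B : set 'rV[R]_d,
  [/\ measurable (B : set L), leb B = leb Omega &
      forall u, L2_on Omega u -> {ae leb, forall x, ~ B x -> u x = 0}].
Proof.
have [B [mB OB BO]] := measurable_hull mu Omega.
exists B; split.
- exact: measurable_completion.
- by rewrite -[RHS]BO; exact: completionE.
- by move=> u [_ uO]; apply: (@ae_imp _ L R leb _ _ uO) => x ux Bx; apply: ux => /OB.
Qed.

Lemma L2_on_integrable u : L2_on Omega u -> @complex_integrable _ L R leb u.
Proof.
have [B [mB BO BV]] := L2_on_hull => Vu.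
have Boo : (leb B < +oo)%E by rewrite BO.
exact: (@sq_integrable_integrable _ L R leb B mB Boo u Vu.1 (BV u Vu)).
Qed.

Lemma measurable_dot_completion p : measurable_fun [set: L] (dot p).
Proof. exact: (@measurable_fun_completion _ _ _ mu _ _ (dot p) (measurable_dotr p)). Qed.

Lemma L2_on_lin a u v : L2_on Omega u -> L2_on Omega v ->
  L2_on Omega (fun x => a * u x + v x).
Proof.
move=> [su uO] [sv vO]; split; first exact: (@sq_integrable_lin _ L R leb a u v su sv).
apply: (@ae_imp _ L R leb _ _ (@ae_both _ L R leb _ _ uO vO)) => x [ux vx] Ox.
by rewrite (ux Ox) (vx Ox) mulr0 addr0.
Qed.

Lemma L2_on0 : L2_on Omega (fun=> 0).
Proof. by split; [exact: (@sq_integrable0 _ L R leb)|exact: aeW]. Qed.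

Definition fourier_const : R := (2 * pi) `^ (- (d%:R / 2)).

Lemma fourier_const_sq : fourier_const ^+ 2 * (2 * pi) ^+ d = 1.
Proof.
rewrite /fourier_const -powR_mulrn ?powR_ge0// -powRrM.
rewrite -[in X in _ * X]powR_mulrn; last by rewrite mulr_ge0// pi_ge0.
rewrite -powRD; last by apply/implyP => _; rewrite gt_eqF// mulr_gt0// pi_gt0.
by rewrite (_ : _ + _ = 0) ?powRr0//; field.
Qed.

Lemma fourier_lin a u v : L2_on Omega u -> L2_on Omega v ->
  fourier (fun x => a * u x + v x) = fun p => a * fourier u p + fourier v p.
Proof.
move=> Vu Vv; apply/funext => p; rewrite /fourier.
set c := (_)%:C%C.
have mp := measurable_funN (measurable_dot_completion p).
have iu := @complex_integrable_expi _ L R leb _ u mp (L2_on_integrable Vu).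
have iv := @complex_integrable_expi _ L R leb _ v mp (L2_on_integrable Vv).
have := @complex_integral_lin _ L R leb a _ _ iu iv.
set f := (X in complex_integral _ X = _).
rewrite (_ : (fun x => expi (- dot p x) * (a * u x + v x)) = f); last first.
  by apply/funext => x; rewrite /f mulrDr mulrCA.
rewrite /complex_integral /cintegral => ->; ring.
Qed.

(** The square of the normalizing constant of the Fourier transform cancels the factor
(2 pi)^d of the unnormalized identity. *)
Lemma fourier_plancherel u : L2_on Omega u -> @sq_integrable _ L R leb (fourier u) /\
  (\int[leb]_p (sqnormc (fourier u p))%:E = \int[leb]_x (sqnormc (u x))%:E)%E.
Proof.
move=> Vu; have [a [b [[ia ib] [a2 b2] uab Fab]]] := @transform_version _ _ R mu u Vu.1 (L2_on_integrable Vu).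
have ma : measurable_fun setT a by apply/measurable_EFinP; exact: measurable_int ia.
have mb : measurable_fun setT b by apply/measurable_EFinP; exact: measurable_int ib.
pose A p := re_transform mu (dot p) a b; pose B p := re_transform mu (dot p) b (\- a).
have mA : measurable_fun setT A by exact: measurable_re_transform_dot.
have mB : measurable_fun setT B by apply: measurable_re_transform_dot => //; exact: measurable_funN.
have FE p : fourier u p = ((fourier_const * A p)%R +i* (fourier_const * B p)%R)%C.
  rewrite /fourier -/fourier_const.
  have := Fab (dot p) (measurable_dotr p); rewrite /complex_integral /cintegral => ->.
  by apply: complex_eq; rewrite ?re_mul ?im_mul /= mul0r ?subr0 ?addr0.
have sqE p : sqnormc (fourier u p) = fourier_const ^+ 2 * (A p ^+ 2 + B p ^+ 2).
  by rewrite FE /sqnormc/=; ring.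
have c20 : 0 <= fourier_const ^+ 2 by exact: sqr_ge0.
have mS : measurable_fun [set: 'rV[R]_d] (fun p => (fourier_const ^+ 2 * (A p ^+ 2 + B p ^+ 2))%:E).
  by apply/measurable_EFinP; apply: measurable_funM => //; apply: measurable_funD; exact: measurable_funX.
have E : (\int[leb]_p (sqnormc (fourier u p))%:E = \int[leb]_x (sqnormc (u x))%:E)%E.
  transitivity (\int[leb]_p (fourier_const ^+ 2 * (A p ^+ 2 + B p ^+ 2))%:E)%E.
    by apply: eq_integral => p _; rewrite sqE.
  transitivity (\int[mu]_p (fourier_const ^+ 2 * (A p ^+ 2 + B p ^+ 2))%:E)%E.
    exact: (@integral_completion _ _ R mu _ mS).
  transitivity (\int[mu]_x (a x ^+ 2 + b x ^+ 2)%:E)%E; last by rewrite -uab.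
  under eq_integral do rewrite EFinM.
  rewrite ge0_integralZl//; last 2 first.
  - by apply/measurable_EFinP; apply: measurable_funD; exact: measurable_funX.
  - by move=> p _; rewrite lee_fin addr_ge0 ?sqr_ge0.
  rewrite (plancherel ia ib a2 b2) muleA -EFinM fourier_const_sq mul1e.
  by [].
have Eoo : (\int[leb]_p (sqnormc (fourier u p))%:E < +oo)%E.
  apply: le_lt_trans Vu.1.2; rewrite le_eqVlt; apply/orP; left; apply/eqP; exact: E.
apply: conj; last exact: E.
apply: conj; last exact: Eoo.
have mcA : measurable_fun [set: 'rV[R]_d] (fun p => fourier_const * A p) by exact: measurable_funM.
have mcB : measurable_fun [set: 'rV[R]_d] (fun p => fourier_const * B p) by exact: measurable_funM.
have reF : (fun p => re (fourier u p)) = (fun p => fourier_const * A p).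
  by apply/funext => p; rewrite FE.
have imF : (fun p => im (fourier u p)) = (fun p => fourier_const * B p).
  by apply/funext => p; rewrite FE.
apply: conj; rewrite ?reF ?imF.
  exact: (@measurable_fun_completion _ _ _ mu _ _ _ mcA).
exact: (@measurable_fun_completion _ _ _ mu _ _ _ mcB).
Qed.

(** The Bessel inequality against the plane wave of frequency p cut off to a hull of
Omega, whose squared norm is |Omega|. *)
Lemma fourier_bessel (I : finType) (f : I -> 'rV[R]_d -> R[i]) p :
  (forall i, L2_on Omega (f i)) -> @orthonormal _ L R leb I f ->
  \sum_i sqnormc (fourier (f i) p) <= fine (leb Omega) * (2 * pi) ^- d.
Proof.
move=> Vf of_; have [B [mB BO BV]] := L2_on_hull.
have Boo : (leb B < +oo)%E by rewrite BO.
have mp := measurable_dot_completion p.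
have H : \sum_i sqnormc (@L2inner _ L R leb (f i) (wave B (dot p))) <= fine (leb Omega).
  have := bessel of_ (sq_integrable_wave mB Boo mp).
  by have -> := @wave_norm _ L R leb B mB (dot p); rewrite -BO.
have c2E : fourier_const ^+ 2 = (2 * pi) ^- d.
  have pd : (2 * pi) ^+ d != 0 :> R by rewrite expf_neq0// mulf_neq0// gt_eqF// pi_gt0.
  by apply: (mulIf pd); rewrite fourier_const_sq mulVf.
rewrite mulrC -c2E (le_trans _ (ler_wpM2l (sqr_ge0 _) H))//.
rewrite mulr_sumr; apply: ler_sum => i _.
rewrite (L2inner_conj leb (wave B (dot p))) sqnormc_conj.
rewrite (L2inner_wave mB Boo mp (Vf i).1 (BV _ (Vf i))).
rewrite /fourier -/fourier_const sqnormcM {1}/sqnormc/= expr0n addr0.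
exact: lexx.
Qed.

End fourier_L2.

(** * The trace inequality *)

Theorem theorem2 (R : realType) (d : nat) (Omega : set 'rV[R]_d)
    (T : 'rV[R]_d -> R) :
  open Omega ->
  (@lebesgue_rV R d Omega < +oo)%E ->
  measurable_fun [set: lebesgue_space R d] T ->
  assumption_I T ->
  assumption_II T ->
  forall Lambda : R, 0 < Lambda ->
  (trace_neg_part T Omega Lambda <=
   @lebesgue_rV R d Omega * ((2 * pi) ^- d)%:E *
   \int[@lebesgue_rV R d]_p (neg_part (T p - Lambda))%:E)%E.
Proof.
move=> _ Ooo mT _ _ Lambda _.
have O0 : (0 <= @lebesgue_rV R d Omega)%E.
  exact: (@measure_ge0 _ _ _ (@lebesgue_rV R d) Omega).
pose K := fine (@lebesgue_rV R d Omega) * (2 * pi) ^- d.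
have K0 : 0 <= K.
  apply: mulr_ge0; first exact: fine_ge0 O0.
  by rewrite invr_ge0 exprn_ge0// mulr_ge0// pi_ge0.
have -> : (@lebesgue_rV R d Omega * ((2 * pi) ^- d)%:E = K%:E)%E.
  by rewrite EFinM fineK// (ge0_fin_numE O0).
have iso u : L2_on Omega u ->
    \int[@lebesgue_rV R d]_p sqnormc (fourier u p) =
    \int[@lebesgue_rV R d]_x sqnormc (u x).
  by move=> Vu; exact: (congr1 fine (fourier_plancherel Ooo Vu).2).
exact: (@eigen_trace_le _ (lebesgue_space R d) R (@lebesgue_rV R d) (@fourier R d)
  (L2_on Omega) T mT (L2_on0 Omega) (fun a u v => @L2_on_lin _ _ Omega a u v)
  (fun u Vu => Vu.1) (fun a u v => @fourier_lin _ _ Omega Ooo a u v)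
  (fun u Vu => (fourier_plancherel Ooo Vu).1) iso K
  (fun I f p Vf of_ => fourier_bessel Ooo p Vf of_) K0 Lambda).
Qed.
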